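(* Fix real numbers $0<x_{\min}<x_{\max}$, $a>0$, $b\ge 0$. There exist constants $C>0$ and $n_0\in\mathbb N$, depending only on $x_{\max},x_{\min},a,b$, such that the following holds for all integers $n> n_0$, $m,L\ge 1$, $1\le k\le n$ and all real $\sigma_z\ge 0$ with $mL\le n^4k\log n$. Suppose that $A_1,\dots,A_L$ are independent $m\times n$ random matrices with i.i.d. $N(0,1)$ entries, and let $\mathcal C_k\in\mathcal F_{a,b,k,n}$. Then $$R_2(\mathcal C_k,m,n,\sigma_z)\le C\,\min\left(\frac{\max(\sigma_z^4,m^2,n^2)\,k\log n}{m^2nL},\,1\right).$$
   Context: Model: $\boldsymbol x_o\in\mathbb R^n$ is an unknown vector and $X_o=\mathrm{diag}(\boldsymbol x_o)$. One observes $\boldsymbol y_l=A_lX_o\boldsymbol w_l+\boldsymbol z_l\in\mathbb R^m$ for $l=1,\dots,L$, where $\boldsymbol w_1,\dots,\boldsymbol w_L$ are i.i.d. $N(0,I_n)$, $\boldsymbol z_1,\dots,\boldsymbol z_L$ are i.i.d. $N(0,\sigma_z^2I_m)$, and the families $(A_l)$, $(\boldsymbol w_l)$, $(\boldsymbol z_l)$ are mutually independent. The matrices $A_1,\dots,A_L$ are known to the estimator. Minimax risk: $R_2(\mathcal C,m,n,\sigma_z)=\inf_{\hat{\boldsymbol x}}\sup_{\boldsymbol x_o\in\mathcal C}\mathbb E\left[\|\hat{\boldsymbol x}-\boldsymbol x_o\|_2^2/n\right]$, where the infimum is over all measurable estimators $\hat{\boldsymbol x}$ that are functions of $\boldsymbol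 y_1,\dots,\boldsymbol y_L$ and $A_1,\dots,A_L$, and the expectation is over all the randomness (including the $A_l$). The dependence on $L$ is suppressed in the notation. Signal classes: for $\mathcal C\subset\mathbb R^n$, $N_\varepsilon(\mathcal C)$ denotes the $\varepsilon$-covering number, i.e. the least number of $\ell_2$-balls of radius $\varepsilon$ covering $\mathcal C$. $\mathcal F_{a,b,k,n}$ denotes the collection of all nonempty subsets $\mathcal C\subset[x_{\min},x_{\max}]^n$ such that $N_\varepsilon(\mathcal C)\le (an^b/\varepsilon)^k$ for every $0<\varepsilon\le an^b$. *)

(* Defs.v *)
From HB Require Import structures.
From mathcomp Require Import all_boot all_order all_algebra.
From mathcomp Require Import all_classical all_reals all_analysis.

Set Implicit Arguments.
Unset Strict Implicit.
Unset Printing Implicit Defensive.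
Import Order.TTheory GRing.Theory Num.Theory.
Import numFieldNormedType.Exports.

Local Open Scope classical_set_scope.
Local Open Scope ring_scope.

(* The product sigma-algebra on matrices, generated by the entries. Over the
   reals this is the Borel sigma-algebra of R^(m x n). *)
Definition measure_matrix_display : measure_display -> measure_display.
Proof. exact. Qed.

Definition g_sigma_entries d (T : measurableType d) (m n : nat) :
    set (set 'M[T]_(m, n)) :=
  <<s \bigcup_(p in [set: 'I_m * 'I_n])
        preimage_set_system setT (fun A : 'M[T]_(m, n) => A p.1 p.2)
          measurable >>.

Section measurable_matrix.
Context {d} {T : measurableType d}.
Variables m n : nat.

Let mx_set0 : g_sigma_entries (T := T) (m := m) (n := n) set0.
Proof. exact: sigma_algebra0. Qed.

Let mx_setC A : g_sigma_entries (T := T) (m := m) (n := n) A ->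
  g_sigma_entries (~` A).
Proof. exact: sigma_algebraC. Qed.

Let mx_bigcup (F : (set 'M[T]_(m, n))^nat) :
  (forall i, g_sigma_entries (F i)) -> g_sigma_entries (\bigcup_i (F i)).
Proof. exact: sigma_algebra_bigcup. Qed.

HB.instance Definition _ := @isMeasurable.Build (measure_matrix_display d)
  'M[T]_(m, n) (@g_sigma_entries d T m n) mx_set0 mx_setC mx_bigcup.

End measurable_matrix.

Section Euclidean.
Context {R : realType} {n : nat}.
Implicit Types (x c : 'cV[R]_n) (C : set 'cV[R]_n).

(* The library norm on matrices is the sup norm, hence this definition. *)
Definition l2norm x : R := Num.sqrt (\sum_(i < n) x i ord0 ^+ 2).

Definition l2ball c (eps : R) : set 'cV[R]_n := [set x | l2norm (x - c) <= eps].

(* The balls are closed and the centres need not lie in C; the value is +oo if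
   no finite cover exists. *)
Definition covering_number C (eps : R) : \bar R :=
  ereal_inf [set (N%:R : R)%:E | N in [set N : nat |
    exists c : 'I_N -> 'cV[R]_n, C `<=` \bigcup_(i in setT) l2ball (c i) eps]].

Definition signal_class (xmin xmax a b : R) (k : nat) : set (set 'cV[R]_n) :=
  [set C | [/\ C !=set0,
    (forall x, C x -> forall i, xmin <= x i ord0 <= xmax) &
    (forall eps, 0 < eps <= a * n%:R `^ b ->
      (covering_number C eps <= ((a * n%:R `^ b / eps) ^+ k)%:E)%E)]].

End Euclidean.

Section Independence.
Context d (T : measurableType d) (R : realType) (P : probability T R).

Definition sigma_of d' (T' : measurableType d') (X : T -> T') : set (set T) :=
  preimage_set_system setT X measurable.

Definition mutually_independent (I : finType) (F : I -> set (set T)) : Prop :=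
  forall (J : {set I}) (E : I -> set T), (forall i, i \in J -> F i (E i)) ->
    P (\bigcap_(i in [set` J]) E i) = (\prod_(i in J) P (E i))%E.

Definition independent_family d' (T' : measurableType d') (I : finType)
    (X : I -> T -> T') : Prop :=
  mutually_independent (fun i => sigma_of (X i)).

Definition independent3 d1 (T1 : measurableType d1) d2 (T2 : measurableType d2)
    d3 (T3 : measurableType d3) (X : T -> T1) (Y : T -> T2) (Z : T -> T3) :
    Prop :=
  mutually_independent
    (tnth [tuple sigma_of X; sigma_of Y; sigma_of Z]).

(* N(0, s^2), which is the Dirac mass at 0 when s = 0; the library's
   [normal_prob 0 0] is by convention the uniform law on [0, 1]. *)
Definition centered_normal (s : R) (B : set R) : \bar R :=
  if s == 0 then \d_(0 : R) B else normal_prob 0 s B.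

(* i.i.d. N(0, s^2) entries; for column vectors this is N(0, s^2 I). *)
Definition iid_normal_entries (m n : nat) (s : R) (X : T -> 'M[R]_(m, n)) :
    Prop :=
  independent_family (fun (p : 'I_m * 'I_n) t => X t p.1 p.2) /\
  forall i j (B : set R), measurable B ->
    P [set t | B (X t i j)] = centered_normal s B.

End Independence.

Section SpeckleModel.
Context d (T : measurableType d) (R : realType) (P : probability T R).
Variables (m n L : nat).
Variables (A : 'I_L -> {RV P >-> 'M[R]_(m, n)})
  (w : 'I_L -> {RV P >-> 'cV[R]_n}) (z : 'I_L -> {RV P >-> 'cV[R]_m}).

Definition noise_model (sigmaz : R) : Prop :=
  [/\ independent_family P w /\ (forall l, iid_normal_entries P 1 (w l)),
      independent_family P z /\
        (forall l, iid_normal_entries P sigmaz (z l)) &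
      independent3 P (fun t => [tuple A l t | l < L])
        (fun t => [tuple w l t | l < L]) (fun t => [tuple z l t | l < L])].

Definition gaussian_sensing : Prop :=
  independent_family P A /\ (forall l, iid_normal_entries P 1 (A l)).

Definition observation (x : 'cV[R]_n) (l : 'I_L) (t : T) : 'cV[R]_m :=
  A l t *m diag_mx x^T *m w l t + z l t.

Definition data (x : 'cV[R]_n) (t : T) :
    (L.-tuple 'cV[R]_m * L.-tuple 'M[R]_(m, n))%type :=
  ([tuple observation x l t | l < L], [tuple A l t | l < L]).

Definition estimator : Type :=
  {mfun (L.-tuple 'cV[R]_m * L.-tuple 'M[R]_(m, n))%type >-> 'cV[R]_n}.

Definition risk (xhat : estimator) (x : 'cV[R]_n) : \bar R :=
  ('E_P[(fun t => l2norm (xhat (data x t) - x) ^+ 2 / n%:R)%R])%E.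

Definition minimax_risk (C : set 'cV[R]_n) : \bar R :=
  ereal_inf [set ereal_sup [set risk xhat x | x in C] |
    xhat in [set: estimator]].

End SpeckleModel.

(* Main.v *)
Require Import Defs.
From HB Require Import structures.
From mathcomp Require Import all_boot all_order all_algebra.
From mathcomp Require Import all_classical all_reals all_analysis.
From mathcomp Require Import measurable_realfun.
From mathcomp Require Import zify ring lra.

Set Implicit Arguments.
Unset Strict Implicit.
Unset Printing Implicit Defensive.
Import Order.TTheory GRing.Theory Num.Theory.
Import numFieldNormedType.Exports.

Local Open Scope classical_set_scope.
Local Open Scope ring_scope.

(** The estimator is a least squares fit of second moments. Given the sensing
    matrices, [y_l] is centred Gaussian with covariance
    [A_l diag(xo^2) A_l^T + sigmaz^2 1], which is linear in the entrywise square
    of the signal [xo]. Up to a term independent of the candidate [x],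
    [contrast] is the sum over [l] of the squared Frobenius distances between
    [y_l y_l^T] and the covariance under [x]; [least_squares] minimizes it over
    a finite net of the class, of radius [2 / n^2] and with [exp(O(k ln n))]
    points ([class_net]).

    Let [x0] be a point of the net close to [xo]. A candidate [x1] is preferred
    to [x0] only if the centred quadratic forms of the observations with
    matrices [B_l = A_l diag(x1^2 - x0^2) A_l^T] exceed a fixed fraction of the
    energy [sum_l |B_l|^2], up to a small drift because [xo] is off the net
    ([contrast_diff_le]). Two exponential moment bounds make this unlikely
    ([pairwise_bound]).
    - Over the noises, for fixed sensing matrices: the exponential moment of a
      Gaussian quadratic form of small operator norm is at most the exponential
      of its mean plus a multiple of its squared Frobenius norm ([quad_mgf]).
      Integrating one coordinate replaces the matrix by a Schur complement,
      [pivot_out], which satisfies the same bounds. With a Chernoff parameter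
      [lam] of order [1 / max(sigmaz^4, m^2, n^2)] there remains
      [exp(- lam / 2 * energy)].
    - Over the sensing matrices: the energy is of order
      [L m^2 |x1^2 - x0^2|^2] in the sense of [lower_tail]. The products of the
      rows in one half of a matrix with those in the other half are, given the
      latter, positive quadratic forms in the former, so [neg_quad_mgf] applies
      to one half and then to the other. A matrix with one row has no such
      products; its energy is the square of a diagonal form, handled by second
      and fourth moments ([diag_energy]).
    Both steps assume operator norms at most of order [sqrt (m + n)]. This fails
    with probability at most [L exp(- 12 n)], by a union bound over the points
    of an integer lattice in a ball ([lattice_ok_tail]).

    A union bound over the net then eliminates the candidates for which
    [|x1^2 - x0^2|^2] exceeds a multiple of
    [max(sigmaz^4, m^2, n^2) k ln n / (m^2 L)]. Squaring is bi-Lipschitz on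
    [[xmin, xmax]], so the surviving candidates are within the announced rate.
    The net radius and the exceptional events contribute [O(n^-5)], and the
    rate is at least [n^-5] because [m L <= n^4 k ln n].

    All expectations are over the scalar entries of the [A_l], [w_l] and [z_l],
    which form one independent family ([box_indep_entry]); [integral_mix]
    integrates over its parts one after the other. *)

(** * Random vectors indexed by a finite type *)

Definition boxes (R : realType) (K : Type) : set (set (K -> R)) :=
  [set E | exists2 B : K -> set R, (forall k, measurable (B k)) &
    E = [set x | forall k, B k (x k)]].

Notation vec R K := (g_sigma_algebraType (@boxes R K)).

Section vec_measurability.
Context {R : realType} {K : finType}.

Lemma setI_closed_boxes : setI_closed (@boxes R K).
Proof.
move=> _ _ [B mB ->] [C mC ->]; exists (fun k => B k `&` C k).
  by move=> k; exact: measurableI.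
by apply/seteqP; split => [x [Bx Cx] k|x BCx]; split=> // k; have [] := BCx k.
Qed.

Lemma boxesT : @boxes R K setT.
Proof. by exists (fun=> setT) => //; apply/seteqP; split. Qed.

Lemma measurable_box (B : K -> set R) : (forall k, measurable (B k)) ->
  measurable ([set x | forall k, B k (x k)] : set (vec R K)).
Proof. by move=> mB; apply: (@sub_sigma_algebra _ setT (@boxes R K)); exists B. Qed.

Lemma measurable_coord (k : K) : measurable_fun setT (fun x : vec R K => x k).
Proof.
move=> _ B mB; rewrite setTI.
rewrite (_ : _ @^-1` _ =
    [set x | forall j, (if j == k then B else setT) (x j)]).
  by apply: (measurable_box (B := fun j => if j == k then B else setT)) => j;
    case: ifP.
apply/seteqP; split => [x Bx j|x /(_ k)]; last by rewrite eqxx.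
by case: eqP => // ->.
Qed.

Lemma measurable_vec d (T : measurableType d) (f : T -> vec R K) :
  (forall k, measurable_fun setT (fun t => f t k)) -> measurable_fun setT f.
Proof.
move=> mf; apply: (@measurability _ _ _ (vec R K) _ _ (@boxes R K)) => //.
move=> _ [_ [B mB ->] <-].
rewrite setTI (_ : _ @^-1` _ = \bigcap_(k in [set: K]) ((f^~ k) @^-1` B k)).
  apply: fin_bigcap_measurable => // k _.
  by rewrite -[X in measurable X]setTI; exact: mf.
by apply/seteqP; split => [t Bt k _|t Bt k]; [exact: Bt|exact: (Bt k)].
Qed.

End vec_measurability.

(** Replacing the coordinates outside [S] of one vector by those of another is
    how a function of independent blocks is integrated block by block. *)
Definition mix (R : realType) (K : finType) (S : {pred K}) (x y : K -> R) :
  vec R K := fun k => if k \in S then x k else y k.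

Section box_independence.
Context d (T : measurableType d) (R : realType) (P : probability T R).

(** Independence of a whole finite family of real random variables; taking
    some of the [B k] to be [setT] gives the subfamilies. *)
Definition box_indep (K : finType) (X : K -> T -> R) : Prop :=
  forall B : K -> set R, (forall k, measurable (B k)) ->
    P [set t | forall k, B k (X k t)] = (\prod_k P (X k @^-1` B k))%E.

Definition joint (K : finType) (X : K -> T -> R) (t : T) : vec R K :=
  fun k => X k t.

Context (K : finType) (X : K -> T -> R).
Hypothesis mX : forall k, measurable_fun setT (X k).
Hypothesis iX : box_indep X.

Lemma measurable_joint : measurable_fun setT (joint X).
Proof. by apply: measurable_vec => k; exact: mX. Qed.

Lemma measurable_mix1 (S : {pred K}) (y : K -> R) :
  measurable_fun setT (fun x : vec R K => mix S x y).
Proof.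
by apply: measurable_vec => k; rewrite /mix; case: (k \in S) => //;
  exact: measurable_coord.
Qed.

Lemma measurable_mix2 (S : {pred K}) (x : K -> R) :
  measurable_fun setT (fun y : vec R K => mix S x y).
Proof.
by apply: measurable_vec => k; rewrite /mix; case: (k \in S) => //;
  exact: measurable_coord.
Qed.

Lemma measurable_mix (S : {pred K}) :
  measurable_fun setT (fun xy : vec R K * vec R K => mix S xy.1 xy.2).
Proof.
apply: measurable_vec => k; rewrite /mix; case: (k \in S).
  exact: (measurableT_comp (measurable_coord k) measurable_fst).
exact: (measurableT_comp (measurable_coord k) measurable_snd).
Qed.

Section blocks.
Variable S : {pred K}.

Let Z1 (t : T) : vec R K := mix S (joint X t) (fun=> 0).
Let Z2 (t : T) : vec R K := mix S (fun=> 0) (joint X t).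

Let mZ1 : measurable_fun setT Z1.
Proof. exact: (measurableT_comp (measurable_mix1 S _) measurable_joint). Qed.
Let mZ2 : measurable_fun setT Z2.
Proof. exact: (measurableT_comp (measurable_mix2 S _) measurable_joint). Qed.

Let mpre d' (T' : measurableType d') (f : T -> T') A :
  measurable_fun setT f -> measurable A -> measurable (f @^-1` A).
Proof. by move=> mf mA; rewrite -[X in measurable X]setTI; exact: mf. Qed.

(* A coordinate frozen at 0 contributes an event of probability 0 or 1. *)
Let box_rect (A B : set (vec R K)) : boxes A -> boxes B ->
  P (Z1 @^-1` A `&` Z2 @^-1` B) = (P (Z1 @^-1` A) * P (Z2 @^-1` B))%E.
Proof.
move=> [a ma ->] [b mb ->].
pose a' k := if k \in S then a k else [set _ | a k 0].
pose b' k := if k \in S then [set _ | b k 0] else b k.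
have mcst (Q : Prop) : measurable ([set _ | Q] : set R).
  case: (pselect Q) => q.
    by rewrite (_ : [set _ | _] = setT)//; apply/seteqP; split.
  by rewrite (_ : [set _ | _] = set0)//; apply/seteqP; split.
have ma' k : measurable (a' k) by rewrite /a'; case: ifP.
have mb' k : measurable (b' k) by rewrite /b'; case: ifP.
have e1 : Z1 @^-1` [set x | forall k, a k (x k)] =
    [set t | forall k, a' k (X k t)].
  by apply/seteqP; split => t /= H k; have := H k; rewrite /Z1 /mix /a' /joint;
    case: ifP.
have e2 : Z2 @^-1` [set x | forall k, b k (x k)] =
    [set t | forall k, b' k (X k t)].
  by apply/seteqP; split => t /= H k; have := H k; rewrite /Z2 /mix /b' /joint;
    case: ifP.
have e3 : [set t | forall k, a' k (X k t)] `&` [set t | forall k, b' k (X k t)]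
    = [set t | forall k, (a' k `&` b' k) (X k t)].
  apply/seteqP; split => [t [H1 H2] k|t H]; first by split.
  by split=> k; have [] := H k.
rewrite e1 e2 e3 (iX ma') (iX mb').
have -> := iX (B := fun k => a' k `&` b' k) (fun k => measurableI _ _ (ma' k) (mb' k)).
rewrite -big_split/=; apply: eq_bigr => k _; rewrite /a' /b'.
have cstE (Q : Prop) : X k @^-1` [set _ | Q] = if `[< Q >] then setT else set0.
  by case: ifPn => /asboolP q; apply/seteqP; split.
case: ifP => _; rewrite preimage_setI cstE; case: ifP => _.
- by rewrite setIT probability_setT mule1.
- by rewrite setI0 measure0 mule0.
- by rewrite setTI probability_setT mul1e.
- by rewrite set0I measure0 mul0e.
Qed.

Let sub_boxes : @boxes R K `<=` @measurable _ (vec R K).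
Proof. by move=> A bA; exact: sub_sigma_algebra. Qed.

(* Boxes are stable under intersection and generate the sigma-algebra. *)
Let ext_boxes (m1 m2 : {measure set (vec R K) -> \bar R}) :
  (m1 setT < +oo)%E -> (forall A, boxes A -> m1 A = m2 A) ->
  forall A, measurable A -> m1 A = m2 A.
Proof.
move=> fin1 e12 A mA.
apply: (@measure_unique _ R (vec R K) (@boxes R K) (fun=> setT)) => //.
- exact: setI_closed_boxes.
- by move=> _; exact: boxesT.
- by apply/seteqP; split => // x _; exists 0%N.
Qed.

Let meas_rect (A B : set (vec R K)) : measurable A -> measurable B ->
  P (Z1 @^-1` A `&` Z2 @^-1` B) = (P (Z1 @^-1` A) * P (Z2 @^-1` B))%E.
Proof.
have half C : boxes C -> forall A, measurable A ->
    P (Z1 @^-1` A `&` Z2 @^-1` C) = (P (Z1 @^-1` A) * P (Z2 @^-1` C))%E.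
  move=> bC; have mC := mpre mZ2 (sub_boxes bC).
  have fC : P (Z2 @^-1` C) \is a fin_num by exact: fin_num_measure.
  pose c : {nonneg R} := NngNum (fine_ge0 (measure_ge0 P (Z2 @^-1` C))).
  move=> A' mA'.
  have := @ext_boxes (pushforward (mrestr P mC) Z1)
    (mscale c (pushforward P Z1)) _ _ A' mA'.
  rewrite /= /mscale /pushforward /mrestr/= => -> //.
  - by rewrite fineK// muleC.
  - apply: (le_lt_trans (probability_le1 P _) (ltry _)).
    exact: (measurableI _ _ (mpre mZ1 measurableT) mC).
  - move=> A'' bA''; rewrite box_rect//= fineK//; exact: muleC.
move=> mA mB.
have mA' := mpre mZ1 mA.
have fA : P (Z1 @^-1` A) \is a fin_num by exact: fin_num_measure.
pose c : {nonneg R} := NngNum (fine_ge0 (measure_ge0 P (Z1 @^-1` A))).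
rewrite setIC; have := @ext_boxes (pushforward (mrestr P mA') Z2)
    (mscale c (pushforward P Z2)) _ _ B mB.
rewrite /= /mscale /pushforward /mrestr/= => -> //.
- by rewrite fineK.
- apply: (le_lt_trans (probability_le1 P _) (ltry _)).
  exact: (measurableI _ _ (mpre mZ2 measurableT) mA').
- by move=> B' bB'; rewrite setIC half//= fineK.
Qed.

(** Fubini's theorem: the joint law of the coordinates in [S] and of the others
    is a product, first on boxes and then, one factor at a time, on all
    rectangles. *)
Lemma integral_mix (f : vec R K -> \bar R) :
  measurable_fun [set: vec R K] f -> (forall x, 0 <= f x)%E ->
  (\int[P]_t f (joint X t) =
   \int[P]_s \int[P]_t f (mix S (joint X s) (joint X t)))%E.
Proof.
move=> mf f0.
pose Z t := (Z1 t, Z2 t).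
have mZ : measurable_fun setT Z by exact: measurable_fun_pair.
pose Y1 : {mfun T >-> vec R K} := HB.pack Z1 (isMeasurableFun.Build _ _ _ _ Z1 mZ1).
pose Y2 : {mfun T >-> vec R K} := HB.pack Z2 (isMeasurableFun.Build _ _ _ _ Z2 mZ2).
pose Y : {mfun T >-> (vec R K * vec R K)%type} :=
  HB.pack Z (isMeasurableFun.Build _ _ _ _ Z mZ).
pose g (xy : vec R K * vec R K) := f (mix S xy.1 xy.2).
have mg : measurable_fun setT g by exact: (measurableT_comp mf (measurable_mix S)).
have g0 xy : (0 <= g xy)%E by exact: f0.
have lawE A : measurable A ->
    (distribution P Y1 \x distribution P Y2)%E A = distribution P Y A.
  by apply: product_measure_unique => A' B' mA' mB'; exact: meas_rect.
transitivity (\int[P]_t g (Z t))%E.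
  apply: eq_integral => t _; rewrite /g/=; congr f.
  by apply/funext => k; rewrite /Z1 /Z2 /mix; case: (k \in S).
transitivity (\int[distribution P Y]_xy g xy)%E.
  by rewrite (ge0_integral_distribution Y mg g0).
transitivity (\int[distribution P Y1 \x distribution P Y2]_xy g xy)%E.
  apply: (eq_measure_integral (distribution P Y1 \x distribution P Y2)%E).
  by move=> A mA _; exact/esym/lawE.
rewrite fubini_tonelli1// ge0_integral_distribution/=; last 2 first.
- exact: measurable_fun_fubini_tonelli_F.
- by move=> x; apply: integral_ge0 => y _.
apply: eq_integral => s _ /=; rewrite /fubini_F.
rewrite ge0_integral_distribution//=; last exact: (measurable_fun_pair2 _ mg).
apply: eq_integral => t _ /=; rewrite /g/=; congr f.
by apply/funext => k; rewrite /Z1 /Z2 /mix; case: (k \in S).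
Qed.

End blocks.

End box_independence.

(** * One-dimensional Gaussian integrals *)

Section gauss1.
Context {R : realType}.
Local Notation mu := (@lebesgue_measure R).

Lemma ge0_integral_normal_prob (s : R) (f : R -> \bar R) : s != 0 ->
  measurable_fun setT f -> (forall x, 0 <= f x)%E ->
  (\int[normal_prob 0 s]_x f x = \int[mu]_x (f x * (normal_pdf 0 s x)%:E))%E.
Proof.
move=> s0 mf f0; have dom := normal_prob_dominates (0 : R) s.
have fint := Radon_Nikodym_SigmaFinite.f_integrable dom.
rewrite -(Radon_Nikodym_SigmaFinite.change_of_variables dom f0)//.
have mpdf : measurable_fun setT (EFin \o normal_pdf (0 : R) s).
  by apply/measurable_EFinP; exact: measurable_normal_pdf.
apply: ae_eq_integral => //.
- by apply: emeasurable_funM => //; exact: measurable_int fint.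
- exact: emeasurable_funM.
apply: ae_eqe_mul2l; apply: integral_ae_eq => //= A _ mA.
by rewrite -Radon_Nikodym_SigmaFinite.f_integral.
Qed.

Section mgf.
Context d (T : measurableType d) (P : probability T R) (X : T -> R) (s : R).
Hypothesis mX : measurable_fun setT X.
Hypothesis lawX : forall B, measurable B -> P (X @^-1` B) = centered_normal s B.

(** Completing the square: the exponential times a centred normal density is a
    multiple of another normal density. *)
Lemma gauss_mgf (a b : R) : 2 * a * s ^+ 2 < 1 ->
  (\int[P]_t (expR (a * X t ^+ 2 + b * X t))%:E =
   ((Num.sqrt (1 - 2 * a * s ^+ 2))^-1 *
     expR (s ^+ 2 * b ^+ 2 / (2 * (1 - 2 * a * s ^+ 2))))%:E)%E.
Proof.
move=> as1.
pose f (x : R) := (expR (a * x ^+ 2 + b * x))%:E.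
have mf : measurable_fun setT f.
  apply/measurable_EFinP/measurableT_comp => //.
  apply: measurable_funD; apply: measurable_funM => //.
have f0 x : (0 <= f x)%E by rewrite lee_fin expR_ge0.
pose Y : {mfun T >-> R} := HB.pack X (isMeasurableFun.Build _ _ _ _ X mX).
transitivity (\int[distribution P Y]_x f x)%E.
  by rewrite ge0_integral_distribution.
have [s0|s0] := eqVneq s 0.
  rewrite (eq_measure_integral (\d_(0:R))); last first.
    move=> A mA _; have := lawX mA.
    by rewrite /centered_normal s0 eqxx.
  rewrite integral_dirac// diracT mul1e /f s0 !(expr0n,mulr0,mul0r,addr0)/=.
  by rewrite subr0 sqrtr1 invr1 mul1r.
(* [normal_prob] lives on [measurableTypeR R], a copy of [R]. *)
pose idR : measurableTypeR R -> R := idfun.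
have midR : measurable_fun setT idR := @measurable_id _ _ setT.
pose Z : {mfun measurableTypeR R >-> R} :=
  HB.pack idR (isMeasurableFun.Build _ _ _ _ idR midR).
transitivity (\int[distribution (normal_prob 0 s) Z]_x f x)%E.
  apply: eq_measure_integral => A mA _; have := lawX mA.
  by rewrite /centered_normal (negbTE s0).
rewrite ge0_integral_distribution// ge0_integral_normal_prob//.
set v := 1 - _ in as1 *.
have v0 : 0 < v by rewrite subr_gt0.
have sv0 : 0 < Num.sqrt v by rewrite sqrtr_gt0.
pose s' := s / Num.sqrt v.
have s'0 : s' != 0 by rewrite mulf_neq0// invr_eq0 gt_eqF.
have s'2 : s' ^+ 2 = s ^+ 2 / v by rewrite exprMn exprVn sqr_sqrtr// ltW.
pose c := (Num.sqrt v)^-1 * expR (s ^+ 2 * b ^+ 2 / (2 * v)).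
have c0 : 0 <= c by rewrite mulr_ge0 ?expR_ge0// invr_ge0 ltW.
transitivity (\int[mu]_x (c%:E * (normal_pdf (s' ^+ 2 * b) s' x)%:E))%E.
  apply: eq_integral => x _; rewrite /f -!EFinM; congr EFin.
  rewrite !normal_pdfE// /normal_peak /normal_fun s'2.
  have -> : s ^+ 2 / v * pi *+ 2 = (s ^+ 2 * pi *+ 2) / v.
    by ring.
  rewrite sqrtrM; last first.
    by rewrite mulrn_wge0// mulr_ge0 ?sqr_ge0// pi_ge0.
  rewrite sqrtrV ?ltW// invfM invrK /c.
  have -> : (Num.sqrt v)^-1 * expR (s ^+ 2 * b ^+ 2 / (2 * v)) *
      ((Num.sqrt (s ^+ 2 * pi *+ 2))^-1 * Num.sqrt v *
      expR (- (x - s ^+ 2 / v * b) ^+ 2 / (s ^+ 2 / v *+ 2))) =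
    (Num.sqrt (s ^+ 2 * pi *+ 2))^-1 * (Num.sqrt v / Num.sqrt v) *
     (expR (s ^+ 2 * b ^+ 2 / (2 * v)) *
      expR (- (x - s ^+ 2 / v * b) ^+ 2 / (s ^+ 2 / v *+ 2))) by ring.
  rewrite divff ?gt_eqF// mulr1 mulrCA -!expRD; congr (_ * expR _).
  rewrite subr0 /v; suff H (y : R) : a * y ^+ 2 + b * y + - y ^+ 2 / (s ^+ 2 *+ 2) =
      s ^+ 2 * b ^+ 2 / (2 * v) +
      - (y - s ^+ 2 / v * b) ^+ 2 / (s ^+ 2 / v *+ 2) by exact: H.
  by have := gt_eqF v0; rewrite /v => vn0; field; rewrite s0/= vn0.
by rewrite ge0_integralZl_EFin// ?integral_normal_pdf ?mule1//;
  [move=> x _; rewrite lee_fin normal_pdf_ge0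
  |apply/measurable_EFinP; exact: measurable_normal_pdf].
Qed.

End mgf.
End gauss1.

(** * Exponential moments of Gaussian quadratic forms *)

Section quadratic_form.
Context {R : realType} {K : finType}.
Implicit Types (M N : K -> K -> R) (x u : K -> R).

Definition qf M x : R := \sum_i \sum_j M i j * x i * x j.

Definition mxtr M : R := \sum_i M i i.

Definition frob2 M : R := \sum_i \sum_j M i j ^+ 2.

Definition form_bounded (c : R) M : Prop :=
  forall x, `|qf M x| <= c * \sum_i x i ^+ 2.

Lemma measurable_qf M : measurable_fun setT (fun x : vec R K => qf M x).
Proof.
apply: measurable_sum => i; apply: measurable_sum => j.
apply: measurable_funM; last exact: measurable_coord.
by apply: measurable_funM => //; exact: measurable_coord.
Qed.

Lemma frob2_ge0 M : 0 <= frob2 M.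
Proof. by do 2![apply: sumr_ge0 => ? _]; exact: sqr_ge0. Qed.

Section pivot.
Variables (N : K -> K -> R) (i0 : K).
Hypothesis symN : forall i j, N i j = N j i.

Definition pivot_row j : R := if j == i0 then 0 else N i0 j.
Definition pivot_minor i j : R := if (i == i0) || (j == i0) then 0 else N i j.

(** What a Gaussian integration over the coordinate [i0] turns [N] into: in the
    other coordinates, [1 - 2 pivot_out] is the Schur complement of
    [1 - 2 N]. *)
Definition pivot_out i j : R :=
  pivot_minor i j + 2 * pivot_row i * pivot_row j / (1 - 2 * N i0 i0).

Let sum_pivot (f : K -> R) : \sum_j f j = f i0 + \sum_(j | j != i0) f j.
Proof. by rewrite (bigD1 i0). Qed.

Let row0 : pivot_row i0 = 0. Proof. by rewrite /pivot_row eqxx. Qed.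

Let sum_row (f : K -> R -> R) : (forall j, f j 0 = 0) ->
  \sum_j f j (pivot_row j) = \sum_(j | j != i0) f j (N i0 j).
Proof.
move=> f0; rewrite sum_pivot row0 f0 add0r; apply: eq_bigr => j ji.
by rewrite /pivot_row (negbTE ji).
Qed.

Let sum_minor (f : K -> K -> R -> R) : (forall i j, f i j 0 = 0) ->
  \sum_i \sum_j f i j (pivot_minor i j) =
  \sum_(i | i != i0) \sum_(j | j != i0) f i j (N i j).
Proof.
move=> f0; rewrite sum_pivot big1 ?add0r; last first.
  by move=> j _; rewrite /pivot_minor eqxx.
apply: eq_bigr => i ii; rewrite sum_pivot {1}/pivot_minor eqxx orbT f0 add0r.
by apply: eq_bigr => j ji; rewrite /pivot_minor (negbTE ii) (negbTE ji).
Qed.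

Lemma qf_pivot x : qf N x =
  N i0 i0 * x i0 ^+ 2 + 2 * x i0 * (\sum_j pivot_row j * x j) + qf pivot_minor x.
Proof.
rewrite (sum_row (f := fun j y => y * x j)); last by move=> j; rewrite mul0r.
rewrite {2}/qf (sum_minor (f := fun i j y => y * x i * x j)); last first.
  by move=> i j; rewrite !mul0r.
rewrite /qf sum_pivot sum_pivot.
under [X in _ + X = _]eq_bigr do rewrite sum_pivot.
rewrite big_split/=; set S := \sum_(j | _) N i0 j * x j.
have -> : \sum_(j | j != i0) N i0 j * x i0 * x j = x i0 * S.
  by rewrite mulr_sumr; apply: eq_bigr => j _; ring.
have -> : \sum_(j | j != i0) N j i0 * x j * x i0 = x i0 * S.
  by rewrite mulr_sumr; apply: eq_bigr => j _; rewrite symN; ring.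
by ring.
Qed.

Lemma mxtr_pivot_minor : mxtr N = N i0 i0 + mxtr pivot_minor.
Proof.
rewrite /mxtr sum_pivot; congr (_ + _).
rewrite sum_pivot {1}/pivot_minor eqxx add0r; apply: eq_bigr => j ji.
by rewrite /pivot_minor (negbTE ji).
Qed.

Lemma frob2_pivot_minor :
  frob2 N = N i0 i0 ^+ 2 + 2 * (\sum_j pivot_row j ^+ 2) + frob2 pivot_minor.
Proof.
rewrite (sum_row (f := fun j y => y ^+ 2)); last by move=> j; rewrite expr0n.
rewrite {2}/frob2 (sum_minor (f := fun i j y => y ^+ 2)); last first.
  by move=> i j; rewrite expr0n.
rewrite /frob2 sum_pivot sum_pivot.
under [X in _ + X = _]eq_bigr do rewrite sum_pivot.
rewrite big_split/=.
have -> : \sum_(j | j != i0) N j i0 ^+ 2 = \sum_(j | j != i0) N i0 j ^+ 2.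
  by apply: eq_bigr => j _; rewrite symN.
by ring.
Qed.

Let g := (1 - 2 * N i0 i0)^-1.

Lemma qf_pivot_out x : qf pivot_out x =
  qf pivot_minor x + 2 * g * (\sum_j pivot_row j * x j) ^+ 2.
Proof.
rewrite expr2 mulr_suml mulr_sumr /qf -big_split/=; apply: eq_bigr => i _.
rewrite mulr_sumr mulr_sumr -big_split/=; apply: eq_bigr => j _.
by rewrite /pivot_out -/g; ring.
Qed.

Lemma mxtr_pivot_out : mxtr pivot_out =
  mxtr pivot_minor + 2 * g * (\sum_j pivot_row j ^+ 2).
Proof.
rewrite mulr_sumr /mxtr -big_split/=; apply: eq_bigr => i _.
by rewrite /pivot_out -/g; ring.
Qed.

Lemma frob2_pivot_out : frob2 pivot_out = frob2 pivot_minor +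
  4 * g * qf pivot_minor pivot_row + 4 * g ^+ 2 * (\sum_j pivot_row j ^+ 2) ^+ 2.
Proof.
rewrite (expr2 (\sum_j _)) mulr_suml /frob2 /qf !mulr_sumr -!big_split/=.
apply: eq_bigr => i _; rewrite !mulr_sumr -!big_split/=; apply: eq_bigr => j _.
by rewrite /pivot_out -/g; ring.
Qed.

Hypothesis bN : form_bounded (16^-1) N.

Let bt (t : R) u : `|N i0 i0 * t ^+ 2 + 2 * t * (\sum_j pivot_row j * u j) +
   qf pivot_minor u| <= 16^-1 * (t ^+ 2 + \sum_j u j ^+ 2).
Proof.
pose v j := if j == i0 then t else u j.
have vi : v i0 = t by rewrite /v eqxx.
have vj j : j != i0 -> v j = u j by move=> ji; rewrite /v (negbTE ji).
have := bN v; rewrite qf_pivot vi.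
rewrite (sum_row (f := fun j y => y * v j)); last by move=> j; rewrite mul0r.
rewrite (sum_row (f := fun j y => y * u j)); last by move=> j; rewrite mul0r.
rewrite {1}/qf (sum_minor (f := fun i j y => y * v i * v j)); last first.
  by move=> i j; rewrite !mul0r.
rewrite /qf (sum_minor (f := fun i j y => y * u i * u j)); last first.
  by move=> i j; rewrite !mul0r.
rewrite sum_pivot vi (sum_pivot (fun j => u j ^+ 2)).
have -> : \sum_(j | j != i0) N i0 j * v j = \sum_(j | j != i0) N i0 j * u j.
  by apply: eq_bigr => j ji; rewrite vj.
have -> : \sum_(j | j != i0) v j ^+ 2 = \sum_(j | j != i0) u j ^+ 2.
  by apply: eq_bigr => j ji; rewrite vj.
have -> : \sum_(i | i != i0) \sum_(j | j != i0) N i j * v i * v j =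
    \sum_(i | i != i0) \sum_(j | j != i0) N i j * u i * u j.
  by apply: eq_bigr => i ii; apply: eq_bigr => j ji; rewrite !vj.
move=> /le_trans; apply; have := sqr_ge0 (u i0); lra.
Qed.

Lemma pivot_small : `|N i0 i0| <= 16^-1.
Proof.
have := bt 1 (fun=> 0); rewrite expr1n !mulr1 big1; last by move=> j _; rewrite mulr0.
rewrite mulr0 addr0 /qf big1; last by move=> i _; rewrite big1// => j _; rewrite mulr0.
by rewrite addr0 big1 ?addr0 ?mulr1//; move=> j _; rewrite expr0n.
Qed.

Let g_bound : 0 < 1 - 2 * N i0 i0 /\ 0 < g <= 8 / 7.
Proof.
have := pivot_small; rewrite ler_norml => /andP[h1 h2].
have v0 : 0 < 1 - 2 * N i0 i0 by lra.
split=> //; rewrite /g invr_gt0 v0/= -[leLHS]div1r ler_pdivrMr//; lra.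
Qed.

(** The lower bound is that of [N] at the value 0 of the eliminated coordinate,
    since a square is added; the upper bound is that of [N] at the value [4 b],
    large enough for the linear term to outweigh the added square. *)
Lemma pivot_out_bounded : form_bounded (16^-1) pivot_out.
Proof.
move=> u; rewrite qf_pivot_out; set b := \sum_j _.
set q := qf _ u; set U := \sum_i _.
have [_ /andP[g0 g1]] := g_bound.
have := pivot_small; rewrite ler_norml => /andP[r1 r2].
have := bt (4 * b) u; rewrite -/b -/q -/U ler_norml => /andP[_ h1].
have := bt 0 u; rewrite -/b -/q -/U ler_norml => /andP[h2 _].
have b2 := sqr_ge0 b.
have gb : g * b ^+ 2 <= 8 / 7 * b ^+ 2 by exact: ler_wpM2r.
have gb0 : 0 <= g * b ^+ 2 by rewrite mulr_ge0// ltW.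
have rb : - 16^-1 * b ^+ 2 <= N i0 i0 * b ^+ 2 by exact: ler_wpM2r.
rewrite ler_norml; apply/andP; split; nra.
Qed.

(** The deleted row accounts for [8 |row|^2] on the right. This pays for the
    terms that it creates in [pivot_out], because the bound on the form, applied
    to the row itself, gives [|row|^2 <= 1 / 31]. *)
Lemma pivot_out_budget : N i0 i0 + 4 * N i0 i0 ^+ 2 +
  mxtr pivot_out + 4 * frob2 pivot_out <= mxtr N + 4 * frob2 N.
Proof.
rewrite mxtr_pivot_minor frob2_pivot_minor mxtr_pivot_out frob2_pivot_out.
set B := \sum_j _ ^+ 2; set q := qf pivot_minor pivot_row.
have [_ /andP[g0 g1]] := g_bound.
have B0 : 0 <= B by apply: sumr_ge0 => j _; exact: sqr_ge0.
have BE : \sum_j pivot_row j * pivot_row j = B.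
  by apply: eq_bigr => j _; rewrite expr2.
have := bt 1 pivot_row; rewrite BE -/B -/q ler_norml => /andP[_ h1].
have := bt (-1) pivot_row; rewrite BE -/B -/q ler_norml => /andP[h2 _].
have := bt 0 pivot_row; rewrite BE -/B -/q ler_norml => /andP[_ h3].
have B1 : B <= 31^-1 by lra.
have q1 : g * q <= 14^-1 * B.
  have q0 : q <= 16^-1 * B by lra.
  apply: (le_trans (ler_wpM2l (ltW g0) q0)).
  apply: (le_trans (y := 8 / 7 * (16^-1 * B))); last by lra.
  by apply: ler_wpM2r => //; rewrite mulr_ge0.
have gB : g * B <= 8 / 7 * B by exact: ler_wpM2r.
have gB0 : 0 <= g * B by rewrite mulr_ge0// ltW.
have gB2 : g ^+ 2 * B ^+ 2 <= 8 / 7 * B * (8 / 7 * 31^-1).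
  have -> : g ^+ 2 * B ^+ 2 = g * B * (g * B) by ring.
  apply: ler_pM => //; apply: (le_trans gB); lra.
lra.
Qed.

End pivot.

End quadratic_form.

Lemma invsqrt_le_expR (R : realType) (r : R) : `|r| <= 16^-1 ->
  (Num.sqrt (1 - 2 * r))^-1 <= expR (r + 4 * r ^+ 2).
Proof.
rewrite ler_norml => /andP[r1 r2].
have v0 : 0 < 1 - 2 * r by lra.
have s0 : 0 < Num.sqrt (1 - 2 * r) by rewrite sqrtr_gt0.
rewrite -(@ler_pXn2r _ 2)// ?nnegrE ?invr_ge0 ?expR_ge0 ?(ltW s0)//.
rewrite exprVn sqr_sqrtr ?(ltW v0)// -expRM_natl -[leLHS]div1r ler_pdivrMr//.
apply: (le_trans (y := (1 + 2%:R * (r + 4 * r ^+ 2)) * (1 - 2 * r))).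
  nra.
by rewrite ler_pM2r// expR_ge1Dx.
Qed.

Section quad_mgf.
Context d (T : measurableType d) (R : realType) (P : probability T R).
Context (K : finType) (X : K -> T -> R) (s : K -> R).
Hypothesis mX : forall k, measurable_fun setT (X k).
Hypothesis iX : box_indep P X.
Hypothesis lawX : forall k B, measurable B ->
  P (X k @^-1` B) = centered_normal (s k) B.

Lemma measurable_expR_qf (M : K -> K -> R) :
  measurable_fun setT (fun x : vec R K => (expR (qf M x))%:E).
Proof.
by apply/measurable_EFinP/measurableT_comp => //; exact: measurable_qf.
Qed.

(** By [gauss_mgf] in the coordinate [i]: the diagonal entry gives the factor,
    and the square of the linear term joins the form in the other coordinates.
    In the standardized variables the new form is [pivot_out]. *)
Lemma quad_mgf_elim (M : K -> K -> R) (i : K) :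
  (forall j k, M j k = M k j) ->
  let v := 1 - 2 * (s i ^+ 2 * M i i) in 0 < v ->
  (\int[P]_t (expR (qf M (joint X t)))%:E =
   ((Num.sqrt v)^-1)%:E *
   \int[P]_t (expR (qf (fun j k => pivot_minor M i j k +
      2 * s i ^+ 2 * pivot_row M i j * pivot_row M i k / v) (joint X t)))%:E)%E.
Proof.
move=> symM v v0.
have mE M' := measurable_expR_qf M'.
have mEX M' : measurable_fun setT (fun t => (expR (qf M' (joint X t)))%:E).
  exact: (measurableT_comp (mE M') (measurable_joint mX)).
rewrite (integral_mix mX iX (predC1 i) (f := fun x => (expR (qf M x))%:E)); last 2 first.
- exact: mE.
- by move=> x; rewrite lee_fin expR_ge0.
rewrite -ge0_integralZl_EFin//.
apply: eq_integral => t0 _.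
pose x := joint X t0.
pose b := \sum_j pivot_row M i j * x j.
have mixi t : mix (predC1 i) x (joint X t) i = X i t.
  by rewrite /mix inE eqxx.
have mixj t j : j != i -> mix (predC1 i) x (joint X t) j = x j.
  by move=> ji; rewrite /mix inE ji.
have bE t : \sum_j pivot_row M i j * mix (predC1 i) x (joint X t) j = b.
  apply: eq_bigr => j _; rewrite /pivot_row; case: eqVneq => [_|ji].
    by rewrite !mul0r.
  by rewrite mixj.
have qE t : qf (pivot_minor M i) (mix (predC1 i) x (joint X t)) =
    qf (pivot_minor M i) x.
  apply: eq_bigr => j _; apply: eq_bigr => k _; rewrite /pivot_minor.
  case: (eqVneq j i) => [_|ji]; first by rewrite !mul0r.
  by case: (eqVneq k i) => [_|ki]; rewrite ?mul0r// !mixj.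
transitivity (\int[P]_t ((expR (qf (pivot_minor M i) x))%:E *
    (expR (M i i * X i t ^+ 2 + (2 * b) * X i t))%:E))%E.
  apply: eq_integral => t _; rewrite -EFinM -expRD (qf_pivot i symM) bE qE mixi.
  by congr (expR _)%:E; ring.
rewrite ge0_integralZl_EFin//; last first.
- apply/measurable_EFinP/measurableT_comp => //.
  apply: measurable_funD; apply: measurable_funM => //.
  exact: measurable_funX.
rewrite (gauss_mgf (mX i) (@lawX i)); last first.
  by rewrite -subr_gt0 (_ : 1 - _ = v)// /v; ring.
have -> : 1 - 2 * M i i * s i ^+ 2 = v by rewrite /v; ring.
rewrite -!EFinM mulrCA -expRD; congr (_ * expR _)%:E.
transitivity (qf (pivot_minor M i) x + 2 * s i ^+ 2 / v * b ^+ 2).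
  by congr (_ + _); field; rewrite gt_eqF.
rewrite /b (expr2 (\sum_j _)) mulr_suml mulr_sumr /qf -big_split/=; apply: eq_bigr => j _.
rewrite mulr_sumr mulr_sumr -big_split/=; apply: eq_bigr => k _.
by rewrite -/x; ring.
Qed.

Let scaled (M : K -> K -> R) j k := s j * s k * M j k.

(** The coordinates are eliminated one by one: [pivot_out_bounded] preserves the
    bound on the form, and by [pivot_out_budget] the exponent never exceeds its
    initial value, the mean of the form plus twice its variance. *)
Lemma quad_mgf (M : K -> K -> R) :
  (forall j k, M j k = M k j) ->
  form_bounded 16^-1 (fun j k => s j * s k * M j k) ->
  (\int[P]_t (expR (qf M (joint X t)))%:E <=
   (expR (mxtr (fun j k => s j * s k * M j k) +
      4 * frob2 (fun j k => s j * s k * M j k)))%:E)%E.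
Proof.
pose supp (S : {set K}) (M : K -> K -> R) := forall j k,
  (j \notin S) || (k \notin S) -> M j k = 0.
suff H n (S : {set K}) : #|S| = n -> forall M : K -> K -> R, supp S M ->
    (forall j k, M j k = M k j) -> form_bounded 16^-1 (scaled M) ->
    (\int[P]_t (expR (qf M (joint X t)))%:E <=
    (expR (mxtr (scaled M) + 4 * frob2 (scaled M)))%:E)%E.
  move=> sM bM; apply: (H _ [set: K]%SET erefl M _ sM bM) => j k.
  by rewrite !inE.
elim: n S => [|n IH] S cardS {}M suppM symM bM.
  have M0 j k : M j k = 0.
    by rewrite suppM// (cards0_eq cardS) inE.
  under eq_integral.
    move=> t _; rewrite /qf big1; last first.
      by move=> j _; rewrite big1// => k _; rewrite M0 !mul0r.
    rewrite expR0; over.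
  rewrite integral_cst// mul1e [X in (X <= _)%E]probability_setT lee_fin.
  rewrite /mxtr big1; last by move=> j _; rewrite /scaled M0 mulr0.
  by rewrite add0r -[leLHS]expR0 ler_expR mulr_ge0// frob2_ge0.
have [i iS] : exists i, i \in S.
  by apply/finset.set0Pn; rewrite -card_gt0 cardS.
have symN j k : scaled M j k = scaled M k j.
  by rewrite /scaled symM (mulrC (s j)).
have rE : s i ^+ 2 * M i i = scaled M i i by rewrite /scaled expr2.
have rsmall := pivot_small i symN bM.
have v0 : 0 < 1 - 2 * (s i ^+ 2 * M i i).
  by rewrite rE; move: rsmall; rewrite ler_norml => /andP[h1 h2]; lra.
rewrite (quad_mgf_elim symM v0).
set M' := fun j k => _ + _.
have sM' j k : scaled M' j k = pivot_out (scaled M) i j k.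
  rewrite /scaled /M' /pivot_out /pivot_minor /pivot_row /= rE.
  case: (eqVneq j i) => [_|ji]; case: (eqVneq k i) => [_|ki] /=;
    rewrite ?(mulr0, mul0r, addr0)//.
  by set w := (1 - _)^-1; rewrite /scaled; ring.
have sM'E : scaled M' = pivot_out (scaled M) i.
  by apply/funext => j; apply/funext => k.
have IHM' : (\int[P]_t (expR (qf M' (joint X t)))%:E <=
    (expR (mxtr (scaled M') + 4 * frob2 (scaled M')))%:E)%E.
  apply: (IH (S :\ i)).
  - by move: cardS; rewrite (cardsD1 i) iS => -[].
  - move=> j k; rewrite !inE !negb_and !negbK /M' /pivot_minor /pivot_row.
    case: (eqVneq j i) => [_|ji] /=; first by rewrite ?(mulr0, mul0r, addr0).
    case: (eqVneq k i) => [_|ki] /=; first by rewrite ?(mulr0, mul0r, addr0).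
    move=> /orP[jS|kS]; rewrite (@suppM j k) ?jS ?kS ?orbT//.
      by rewrite (@suppM i j) ?jS ?orbT// ?(mulr0, mul0r, addr0).
    by rewrite (@suppM i k) ?kS ?orbT// ?(mulr0, mul0r, addr0).
  - move=> j k; rewrite /M' /pivot_minor orbC symM; congr (_ + _ / _).
    by rewrite mulrAC.
  - by rewrite sM'E; exact: pivot_out_bounded.
apply: (le_trans (lee_wpmul2l _ IHM')).
  by rewrite lee_fin invr_ge0 sqrtr_ge0.
rewrite -EFinM lee_fin sM'E.
apply: (le_trans (ler_wpM2r (expR_ge0 _) (invsqrt_le_expR _))).
  by rewrite rE.
rewrite -expRD ler_expR addrA rE; exact: pivot_out_budget.
Qed.

End quad_mgf.

(** * Independent blocks *)

Section subfamily.
Context d (T : measurableType d) (R : realType) (P : probability T R).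

Lemma box_indep_sub (K K0 : finType) (X : K -> T -> R) (h : K0 -> K) :
  injective h -> box_indep P X -> box_indep P (fun k => X (h k)).
Proof.
move=> hI iX B mB.
pose B' k := if [pick k0 | h k0 == k] is Some k0 then B k0 else setT.
have B'h k : B' (h k) = B k.
  rewrite /B'; case: pickP => [k0 /eqP/hI -> //|/(_ k)].
  by rewrite eqxx.
have mB' k : measurable (B' k) by rewrite /B'; case: pickP => // k0 _; exact: mB.
have := iX B' mB'.
rewrite (_ : [set t | _] = [set t | forall k, B k (X (h k) t)]); last first.
  apply/seteqP; split => t /= H k; first by rewrite -B'h.
  by rewrite /B'; case: pickP => // k0 /eqP <-.
move=> ->; rewrite (bigID (mem (h @: [set: K0])%SET))/= [X in (_ * X)%E]big1 ?mule1.
  rewrite big_imset/=; last by move=> k k' _ _; exact: hI.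
  by apply: eq_big => [k|k _]; rewrite ?inE// B'h.
move=> k kh; rewrite /B'; case: pickP => [k0 /eqP e|_].
  by rewrite -e imset_f ?inE in kh.
by rewrite preimage_setT probability_setT.
Qed.

End subfamily.

Section blocks.
Context d (T : measurableType d) (R : realType) (P : probability T R).
Context (B K : finType) (X : B * K -> T -> R).
Hypothesis mX : forall k, measurable_fun setT (X k).
Hypothesis iX : box_indep P X.

Definition block (b : B) (x : B * K -> R) : vec R K := fun k => x (b, k).

Lemma measurable_block (b : B) :
  measurable_fun setT (fun x : vec R (B * K)%type => block b x).
Proof. by apply: measurable_vec => k; exact: measurable_coord. Qed.

Lemma measurable_prod_blocks (f : B -> vec R K -> R) (r : seq B) :
  (forall b, measurable_fun setT (f b)) ->
  measurable_fun setT (fun x : vec R (B * K)%type => \prod_(b <- r) f b (block b x)).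
Proof.
move=> mf; apply: measurable_prod => b _.
exact: (measurableT_comp (mf b) (measurable_block b)).
Qed.

(** One block is split off at a time by [integral_mix]. *)
Lemma integral_prod_blocks (f : B -> vec R K -> R) (c : B -> R) :
  (forall b, measurable_fun setT (f b)) -> (forall b x, 0 <= f b x) ->
  (forall b, \int[P]_t (f b (block b (joint X t)))%:E <= (c b)%:E)%E ->
  (\int[P]_t (\prod_b f b (block b (joint X t)))%:E <= (\prod_b c b)%:E)%E.
Proof.
move=> mf f0 fc.
have c0 b : 0 <= c b.
  rewrite -lee_fin; apply: le_trans (fc b).
  by apply: integral_ge0 => t _; rewrite lee_fin.
have mfb b : measurable_fun setT (fun t => (f b (block b (joint X t)))%:E).
  apply/measurable_EFinP.
  exact: (measurableT_comp (mf b) (measurableT_comp (measurable_block b)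
    (measurable_joint mX))).
have main (r : seq B) : uniq r ->
    (\int[P]_t (\prod_(b <- r) f b (block b (joint X t)))%:E <=
     (\prod_(b <- r) c b)%:E)%E.
  elim: r => [_|b r IH /= /andP[br ur]].
    under eq_integral do rewrite big_nil.
    by rewrite integral_cst// mul1e big_nil [X in (X <= _)%E]probability_setT.
  rewrite big_cons.
  under eq_integral do rewrite big_cons.
  pose F (x : vec R (B * K)%type) :=
    (f b (block b x) * \prod_(b' <- r) f b' (block b' x))%:E.
  have F0 x : (0 <= F x)%E by rewrite lee_fin mulr_ge0// prodr_ge0.
  have mF : measurable_fun setT F.
    apply/measurable_EFinP/measurable_funM; last exact: measurable_prod_blocks.
    exact: (measurableT_comp (mf b) (measurable_block b)).
  rewrite (integral_mix mX iX [pred k : B * K | k.1 == b] mF F0).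
  pose I := (\int[P]_t (\prod_(b' <- r) f b' (block b' (joint X t)))%:E)%E.
  have I0 : (0 <= I)%E.
    by apply: integral_ge0 => t _; rewrite lee_fin prodr_ge0.
  have -> : (\int[P]_s \int[P]_t
      F (mix [pred k : B * K | k.1 == b] (joint X s) (joint X t)) =
      \int[P]_s ((f b (block b (joint X s)))%:E * I))%E.
    apply: eq_integral => s _; rewrite -ge0_integralZl_EFin//; last 2 first.
    - by move=> t _; rewrite lee_fin prodr_ge0.
    - apply/measurable_EFinP.
      exact: (measurableT_comp (measurable_prod_blocks r mf) (measurable_joint mX)).
    apply: eq_integral => t _; rewrite /F -EFinM; congr (_ * _)%:E.
      by congr (f b _); apply/funext => k; rewrite /block /mix !inE/= eqxx.
    rewrite !big_seq; apply: eq_bigr => b' b'r.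
    congr (f b' _); apply/funext => k; rewrite /block /mix !inE/=.
    by rewrite (negbTE (memPn br _ b'r)).
  rewrite ge0_integralZr//; last by move=> s _; rewrite lee_fin.
  rewrite EFinM; apply: lee_pmul => //; last exact: IH.
  by apply: integral_ge0 => s _; rewrite lee_fin.
exact: main (index_enum_uniq _).
Qed.

(** Block diagonal forms, whose exponential is a product over the blocks. *)
Lemma quad_mgf_blocks (s : B * K -> R) (M : B -> K -> K -> R) :
  (forall k A, measurable A -> P (X k @^-1` A) = centered_normal (s k) A) ->
  (forall b j k, M b j k = M b k j) ->
  (forall b, form_bounded 16^-1 (fun j k => s (b, j) * s (b, k) * M b j k)) ->
  (\int[P]_t (expR (\sum_b qf (M b) (block b (joint X t))))%:E <=
   (expR (\sum_b (mxtr (fun j k => s (b, j) * s (b, k) * M b j k) +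
      4 * frob2 (fun j k => s (b, j) * s (b, k) * M b j k))))%:E)%E.
Proof.
move=> lawX sM bM.
under eq_integral do rewrite expR_sum.
rewrite expR_sum; apply: (integral_prod_blocks (f := fun b x => expR (qf (M b) x))).
- by move=> b; apply: measurableT_comp => //; exact: measurable_qf.
- by move=> b x; exact: expR_ge0.
move=> b.
have iXb : box_indep P (fun k => X (b, k)).
  by apply: (box_indep_sub (h := fun k => (b, k))) => // k k' [].
exact: (quad_mgf (X := fun k => X (b, k)) (s := fun k => s (b, k))
  (fun k => mX (b, k)) iXb (fun k => lawX (b, k)) (sM b) (bM b)).
Qed.

End blocks.

(** * The scalar entries of the model form one independent family *)

Lemma measurable_entry d (T : measurableType d) m n (i : 'I_m) (j : 'I_n) :
  measurable_fun setT (fun A : 'M[T]_(m, n) => A i j).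
Proof.
move=> _ B mB; rewrite setTI; apply: sub_sigma_algebra.
by exists (i, j) => //; exists B => //; rewrite setTI.
Qed.

Lemma measurable_matrix d (T : measurableType d) d' (U : measurableType d') m n
    (f : U -> 'M[T]_(m, n)) :
  (forall i j, measurable_fun setT (fun u => f u i j)) -> measurable_fun setT f.
Proof.
move=> mf; apply: (@measurability _ _ _ _ _ _ (\bigcup_(p in [set: 'I_m * 'I_n])
  preimage_set_system setT (fun A : 'M[T]_(m, n) => A p.1 p.2) measurable)) => //.
move=> _ [_ [[i j] _ [B mB <-]] <-]; rewrite !setTI -comp_preimage.
by rewrite -[X in measurable X]setTI; exact: mf.
Qed.

Section independence.
Context d (T : measurableType d) (R : realType) (P : probability T R).

Lemma mutually_independentT (I : finType) (F : I -> set (set T))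
    (E : I -> set T) :
  mutually_independent P F -> (forall i, F i (E i)) ->
  P [set t | forall i, E i t] = (\prod_i P (E i))%E.
Proof.
move=> iF FE; have := iF [set: I]%SET E (fun i _ => FE i).
rewrite (_ : \bigcap_(i in _) _ = [set t | forall i, E i t]); last first.
  by apply/seteqP; split => [t H i|t H i _]; [apply: H; rewrite /= inE|exact: H].
by move=> ->; apply: eq_bigl => i; rewrite inE.
Qed.

Lemma independent_familyT d' (T' : measurableType d') (I : finType)
    (X : I -> T -> T') (B : I -> set T') :
  independent_family P X -> (forall i, measurable (B i)) ->
  P [set t | forall i, B i (X i t)] = (\prod_i P (X i @^-1` B i))%E.
Proof.
move=> iX mB; apply: (mutually_independentT (E := fun i => X i @^-1` B i) iX).
by move=> i; exists (B i) => //; rewrite setTI.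
Qed.

Lemma iid_normal_box m n (s : R) (X : T -> 'M[R]_(m, n))
    (B : 'I_m -> 'I_n -> set R) :
  iid_normal_entries P s X -> (forall i j, measurable (B i j)) ->
  P [set t | forall i j, B i j (X t i j)] =
  (\prod_(p : 'I_m * 'I_n) P [set t | B p.1 p.2 (X t p.1 p.2)])%E.
Proof.
move=> [iX _] mB.
rewrite -(independent_familyT (B := fun p => B p.1 p.2) iX); last by case.
by congr (P _); apply/seteqP; split => t /= H => [[i j]|i j];
  [exact: H|exact: (H (i, j))].
Qed.

Lemma iid_normal_family_box m n L (s : R) (X : 'I_L -> {RV P >-> 'M[R]_(m, n)})
    (B : 'I_L -> 'I_m -> 'I_n -> set R) :
  independent_family P X -> (forall l, iid_normal_entries P s (X l)) ->
  (forall l i j, measurable (B l i j)) ->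
  P [set t | forall l i j, B l i j (X l t i j)] =
  (\prod_l \prod_(p : 'I_m * 'I_n) P [set t | B l p.1 p.2 (X l t p.1 p.2)])%E.
Proof.
move=> iX nX mB.
pose C l : set 'M[R]_(m, n) := [set M | forall i j, B l i j (M i j)].
have mC l : measurable (C l).
  rewrite (_ : C l = \bigcap_(p in [set: 'I_m * 'I_n])
      ((fun M : 'M[R]_(m, n) => M p.1 p.2) @^-1` B l p.1 p.2)).
    apply: fin_bigcap_measurable => // -[i j] _.
    by rewrite -[X in measurable X]setTI; exact: measurable_entry.
  by apply/seteqP; split => M /= H => [[i j] _|i j]; [exact: H|exact: (H (i, j))].
rewrite (independent_familyT (B := C) iX)//; apply: eq_bigr => l _.
exact: (iid_normal_box (nX l) (mB l)).
Qed.

Lemma measurable_tuple_box m n L (B : 'I_L -> 'I_m -> 'I_n -> set R) :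
  (forall l i j, measurable (B l i j)) ->
  measurable [set u : L.-tuple 'M[R]_(m, n) | forall l i j, B l i j (tnth u l i j)].
Proof.
move=> mB.
rewrite (_ : [set u | _] = \bigcap_(p in [set: 'I_L * ('I_m * 'I_n)])
   ((fun u : L.-tuple 'M[R]_(m, n) => tnth u p.1 p.2.1 p.2.2) @^-1`
     B p.1 p.2.1 p.2.2)).
  apply: fin_bigcap_measurable => // -[l [i j]] _ /=.
  rewrite -[X in measurable X]setTI;
  apply: (measurableT_comp (f := fun M : 'M[R]_(m, n) => M i j)) => //.
    exact: measurable_entry.
  exact: measurable_tnth.
apply/seteqP; split => M /= H => [[l [i j]] _|l i j]; first exact: H.
exact: (H (l, (i, j))).
Qed.

End independence.

Section flatten.
Context d (T : measurableType d) (R : realType) (P : probability T R).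
Variables (m n L : nat) (sigmaz : R).
Variables (A : 'I_L -> {RV P >-> 'M[R]_(m, n)})
  (w : 'I_L -> {RV P >-> 'cV[R]_n}) (z : 'I_L -> {RV P >-> 'cV[R]_m}).

(** The shape makes two kinds of blocks available: the rows [(l, i)] of the
    sensing matrices, and for each [l] the pair of noises of the observation. *)
Definition entry_index : finType :=
  (('I_L * 'I_m) * 'I_n + 'I_L * ('I_n + 'I_m))%type.

Definition entry (k : entry_index) (t : T) : R :=
  match k with
  | inl (li, j) => A li.1 t li.2 j
  | inr (l, inl j) => w l t j ord0
  | inr (l, inr i) => z l t i ord0
  end.

Definition entry_std (k : entry_index) : R :=
  if k is inr (_, inr _) then sigmaz else 1.

Lemma measurable_model_entry (k : entry_index) : measurable_fun setT (entry k).
Proof.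
have me m' n' (Y : {RV P >-> 'M[R]_(m', n')}) i j :
    measurable_fun setT (fun t => Y t i j).
  exact: (measurableT_comp (measurable_entry i j) (measurable_funP Y)).
by case: k => [[[l i] j]|[l [j|i]]] /=; exact: me.
Qed.

Hypothesis noise : noise_model A w z sigmaz.
Hypothesis sensing : gaussian_sensing A.

Lemma entry_law (k : entry_index) (B : set R) : measurable B ->
  P (entry k @^-1` B) = centered_normal (entry_std k) B.
Proof.
move: noise sensing => [[_ nw] [_ nz] _] [_ nA] mB.
case: k => [[[l i] j]|[l [j|i]]] /=.
- exact: (proj2 (nA l) i j B mB).
- exact: (proj2 (nw l) j ord0 B mB).
- exact: (proj2 (nz l) i ord0 B mB).
Qed.

Lemma box_indep_entry : box_indep P entry.
Proof.
move=> B mB.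
move: noise sensing => [[iw nw] [iz nz] i3] [iA nA].
pose BA l i j := B (inl ((l, i), j)).
pose Bw l j (_ : 'I_1) := B (inr (l, inl j)).
pose Bz l i (_ : 'I_1) := B (inr (l, inr i)).
have mBA l i j : measurable (BA l i j) by exact: mB.
have mBw l i j : measurable (Bw l i j) by exact: mB.
have mBz l i j : measurable (Bz l i j) by exact: mB.
pose EA := [set t | forall l i j, BA l i j (A l t i j)].
pose Ew := [set t | forall l i j, Bw l i j (w l t i j)].
pose Ez := [set t | forall l i j, Bz l i j (z l t i j)].
pose E := tnth [tuple EA; Ew; Ez].
have := mutually_independentT (E := E) i3.
rewrite (_ : [set t | _] = [set t | forall k, B k (entry k t)]); last first.
  apply/seteqP; split => t /= H.
    case=> [[[l i] j]|[l [j|i]]] /=.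
    - by have := H ord0; rewrite /E/= => /(_ l i j).
    - by have := H (@Ordinal 3 1 isT); rewrite /E/= => /(_ l j ord0).
    - by have := H (@Ordinal 3 2 isT); rewrite /E/= => /(_ l i ord0).
  case=> [[|[|[|//]]]] lt3; rewrite /E (tnth_nth EA)/= => l i j.
  - exact: (H (inl ((l, i), j))).
  - by rewrite (ord1 j); exact: (H (inr (l, inl i))).
  - by rewrite (ord1 j); exact: (H (inr (l, inr i))).
move=> ->.
  rewrite !big_ord_recl big_ord0 mule1 /E !(tnth_nth EA)/=.
  rewrite (iid_normal_family_box iA nA mBA) (iid_normal_family_box iw nw mBw).
  rewrite (iid_normal_family_box iz nz mBz).
  have prodE (I J : finType) (F : I -> J -> \bar R) :
      (\prod_i \prod_j F i j = \prod_(p : I * J) F p.1 p.2)%E.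
    by rewrite pair_big.
  rewrite big_sumType/=; congr (_ * _)%E.
    rewrite prodE.
    rewrite (reindex (fun q : ('I_L * 'I_m) * 'I_n => (q.1.1, (q.1.2, q.2))))/=.
      by apply: eq_bigr => -[[l i] j].
    by exists (fun q => ((q.1, q.2.1), q.2.2)) => [[[l i] j]|[l [i j]]].
  rewrite -big_split/=.
  have -> : (\prod_(q : 'I_L * ('I_n + 'I_m)) P (entry (inr q) @^-1` B (inr q)) =
      \prod_l \prod_(q : 'I_n + 'I_m) P (entry (inr (l, q)) @^-1` B (inr (l, q))))%E.
    by rewrite prodE; apply: eq_bigr => -[l q].
  apply: eq_bigr => l _; rewrite big_sumType/=; congr (_ * _)%E.
    rewrite (reindex (fun j : 'I_n => (j, ord0 : 'I_1)))//=.
    by exists fst => [//|[j k] _]; rewrite (ord1 k).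
  rewrite (reindex (fun j : 'I_m => (j, ord0 : 'I_1)))//=.
  by exists fst => [//|[j k] _]; rewrite (ord1 k).
have pre m' n' (Y : 'I_L -> {RV P >-> 'M[R]_(m', n')}) D :
    (forall l i j, measurable (D l i j)) ->
    sigma_of (fun t => [tuple Y l t | l < L])
      [set t | forall l i j, D l i j (Y l t i j)].
  move=> mD; exists [set u : L.-tuple 'M[R]_(m', n') | forall l i j, D l i j (tnth u l i j)].
    exact: measurable_tuple_box.
  rewrite setTI; apply/seteqP; split => t /= H l i j; have := H l i j;
    by rewrite tnth_mktuple.
case=> [[|[|[|//]]]] lt3; rewrite /E /tnth/=; exact: pre.
Qed.

End flatten.

(** * Deterministic linear algebra *)

Section linear_algebra.
Context {R : realType}.

Definition nsq (I : finType) (u : I -> R) : R := \sum_i u i ^+ 2.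

Lemma nsq_ge0 (I : finType) (u : I -> R) : 0 <= nsq u.
Proof. by apply: sumr_ge0 => i _; exact: sqr_ge0. Qed.

Lemma coord_le_nsq (I : finType) (u : I -> R) i : u i ^+ 2 <= nsq u.
Proof.
by rewrite /nsq (bigD1 i)//= lerDl; apply: sumr_ge0 => j _; exact: sqr_ge0.
Qed.

Lemma nsqZ (I : finType) (c : R) (u : I -> R) :
  nsq (fun i => c * u i) = c ^+ 2 * nsq u.
Proof. by rewrite /nsq mulr_sumr; apply: eq_bigr => i _; rewrite exprMn. Qed.

Lemma nsq_delta (I : finType) (i : I) : nsq (fun j => (j == i)%:R) = 1.
Proof.
rewrite /nsq (bigD1 i)//= eqxx expr1n big1 ?addr0// => j /negbTE ->.
by rewrite expr0n.
Qed.

Lemma dot_young (I : finType) (c : R) (u v : I -> R) : 0 < c ->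
  2 * (\sum_i u i * v i) <= c * nsq u + c^-1 * nsq v.
Proof.
move=> c0; rewrite /nsq !mulr_sumr -big_split/=; apply: ler_sum => i _.
have := sqr_ge0 (c * u i - v i); rewrite -subr_ge0 => h.
have -> : c * u i ^+ 2 + c^-1 * v i ^+ 2 - 2 * (u i * v i) =
    c^-1 * (c * u i - v i) ^+ 2 by field; rewrite gt_eqF.
by rewrite mulr_ge0// ?invr_ge0 ?ltW// sqr_ge0.
Qed.

Lemma cauchy_schwarz (I : finType) (u v : I -> R) :
  (\sum_i u i * v i) ^+ 2 <= nsq u * nsq v.
Proof.
have [u0|u0] := eqVneq (nsq u) 0.
  rewrite u0 mul0r big1 ?expr0n// => i _.
  have := coord_le_nsq u i; rewrite u0 => ui.
  have /eqP : u i ^+ 2 = 0 by apply/le_anti; rewrite ui sqr_ge0.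
  by rewrite sqrf_eq0 => /eqP ->; rewrite mul0r.
have up : 0 < nsq u by rewrite lt_def u0 nsq_ge0.
set S := \sum_i _.
have : 0 <= nsq (fun i => S * u i - nsq u * v i) by exact: nsq_ge0.
have -> : nsq (fun i => S * u i - nsq u * v i) =
    nsq u * (nsq u * nsq v - S ^+ 2).
  have e (s c : R) : nsq (fun i => s * u i - c * v i) =
      s ^+ 2 * nsq u - 2 * s * c * S + c ^+ 2 * nsq v.
    rewrite /nsq /S !mulr_sumr -sumrN -!big_split/=.
    by apply: eq_bigr => i _; ring.
  by rewrite e; ring.
by rewrite pmulr_rge0// subr_ge0.
Qed.

(** The squared operator norm of the matrix [a] is at most [c]; the bound is
    stated for the transpose, and [opbT] gives it for [a] itself. *)
Definition opb (I J : finType) (c : R) (a : I -> J -> R) : Prop :=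
  forall v : I -> R, nsq (fun j => \sum_i a i j * v i) <= c * nsq v.

Lemma opbT (I J : finType) (c : R) (a : I -> J -> R) : 0 < c -> opb c a ->
  forall u : J -> R, nsq (fun i => \sum_j a i j * u j) <= c * nsq u.
Proof.
move=> c0 ba u; set y := fun i => \sum_j a i j * u j.
have e : nsq y = \sum_j u j * (\sum_i a i j * y i).
  rewrite /nsq; under eq_bigr => i _ do rewrite expr2 {1}/y mulr_suml.
  rewrite exchange_big/=; apply: eq_bigr => j _.
  by rewrite mulr_sumr; apply: eq_bigr => i _; ring.
have h := dot_young u (fun j => \sum_i a i j * y i) c0.
have h2 : c^-1 * nsq (fun j => \sum_i a i j * y i) <= nsq y.
  by rewrite ler_pdivrMl//; exact: ba.
rewrite -e in h; lra.
Qed.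

Lemma opb_col (I J : finType) (c : R) (a : I -> J -> R) j : 0 < c -> opb c a ->
  nsq (a^~ j) <= c.
Proof.
move=> c0 ba; have := opbT c0 ba (fun k => (k == j)%:R).
rewrite nsq_delta mulr1; apply: le_trans.
rewrite /nsq; apply: ler_sum => i _; rewrite (bigD1 j)//= eqxx mulr1 big1 ?addr0//.
by move=> k /negbTE ->; rewrite mulr0.
Qed.

(** The entries of [a diag(d) a^T]. *)
Definition sandwich (I J : finType) (d : J -> R) (a : I -> J -> R) : I -> I -> R :=
  fun i i' => \sum_j d j * a i j * a i' j.

Lemma sandwich_sym (I J : finType) (d : J -> R) (a : I -> J -> R) i i' :
  sandwich d a i i' = sandwich d a i' i.
Proof. by apply: eq_bigr => j _; ring. Qed.

Lemma sandwichB (I J : finType) (d e : J -> R) (a : I -> J -> R) i i' :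
  sandwich (fun j => d j - e j) a i i' = sandwich d a i i' - sandwich e a i i'.
Proof. by rewrite /sandwich -sumrB; apply: eq_bigr => j _; ring. Qed.

Lemma qf_sandwich (I J : finType) (d : J -> R) (a : I -> J -> R) (y : I -> R) :
  qf (sandwich d a) y = \sum_j d j * (\sum_i a i j * y i) ^+ 2.
Proof.
rewrite /qf /sandwich.
transitivity (\sum_i \sum_i' \sum_j d j * ((a i j * y i) * (a i' j * y i'))).
  apply: eq_bigr => i _; apply: eq_bigr => i' _.
  by rewrite !mulr_suml; apply: eq_bigr => j _; ring.
under eq_bigr do rewrite exchange_big/=.
rewrite exchange_big/=; apply: eq_bigr => j _.
rewrite expr2 mulr_suml mulr_sumr; apply: eq_bigr => i _.
by rewrite !mulr_sumr.
Qed.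

Lemma frob2_sandwich_le (I J : finType) (c : R) (d : J -> R) (a : I -> J -> R) :
  0 < c -> opb c a -> frob2 (sandwich d a) <= c ^+ 2 * nsq d.
Proof.
move=> c0 ba; rewrite /frob2 exchange_big/=.
apply: (le_trans (y := \sum_i' c * (\sum_j d j ^+ 2 * a i' j ^+ 2))).
  apply: ler_sum => i' _.
  have := opbT c0 ba (fun j => d j * a i' j).
  rewrite /nsq; under [X in _ <= c * X -> _]eq_bigr do rewrite exprMn.
  move=> h; apply: (le_trans _ h); apply: ler_sum => i _.
  rewrite /sandwich (eq_bigr (fun j => a i j * (d j * a i' j)))// => j _; ring.
rewrite -mulr_sumr exchange_big/= expr2 -mulrA ler_pM2l// /nsq mulr_sumr.
apply: ler_sum => j _; rewrite -mulr_sumr mulrC.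
by apply: ler_wpM2r; [exact: sqr_ge0|exact: opb_col].
Qed.

(** The entries of [k^T B k], the matrix of [B] after a linear substitution. *)
Definition congruent (I Q : finType) (B : I -> I -> R) (k : I -> Q -> R) :
    Q -> Q -> R :=
  fun p q => \sum_i \sum_i' B i i' * k i p * k i' q.

Lemma congruent_sym (I Q : finType) (B : I -> I -> R) (k : I -> Q -> R) :
  (forall i i', B i i' = B i' i) ->
  forall p q, congruent B k p q = congruent B k q p.
Proof.
move=> sB p q; rewrite /congruent exchange_big/=; apply: eq_bigr => i _.
by apply: eq_bigr => i' _; rewrite sB; ring.
Qed.

Lemma qf_congruent (I Q : finType) (B : I -> I -> R) (k : I -> Q -> R) u :
  qf (congruent B k) u = qf B (fun i => \sum_q k i q * u q).
Proof.
rewrite /qf /congruent.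
transitivity (\sum_p \sum_q \sum_i \sum_i' B i i' * (k i p * u p) * (k i' q * u q)).
  apply: eq_bigr => p _; apply: eq_bigr => q _; rewrite !mulr_suml.
  apply: eq_bigr => i _; rewrite !mulr_suml; apply: eq_bigr => i' _; ring.
under eq_bigr do rewrite exchange_big/=.
rewrite exchange_big/=; apply: eq_bigr => i _.
under eq_bigr do rewrite exchange_big/=.
rewrite exchange_big/=; apply: eq_bigr => i' _.
rewrite -mulrA mulr_suml mulr_sumr; apply: eq_bigr => p _.
by rewrite !mulr_sumr; apply: eq_bigr => q _; ring.
Qed.

Lemma mxtr_congruent (I Q : finType) (B : I -> I -> R) (k : I -> Q -> R) :
  mxtr (congruent B k) = \sum_i \sum_i' B i i' * (\sum_q k i q * k i' q).
Proof.
rewrite /mxtr /congruent exchange_big/=; apply: eq_bigr => i _.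
rewrite exchange_big/=; apply: eq_bigr => i' _.
by rewrite mulr_sumr; apply: eq_bigr => q _; ring.
Qed.

Lemma congruent_bounded (I Q : finType) (B : I -> I -> R) (k : I -> Q -> R)
    (b c : R) : 0 <= b -> 0 < c -> form_bounded b B -> opb c k ->
  form_bounded (b * c) (congruent B k).
Proof.
move=> b0 c0 bB bk u; rewrite qf_congruent; apply: (le_trans (bB _)).
by rewrite -mulrA ler_wpM2l//; exact: opbT.
Qed.

Lemma frob2_congruent_le (I Q : finType) (B : I -> I -> R) (k : I -> Q -> R)
    (c : R) : 0 < c -> opb c k ->
  frob2 (congruent B k) <= c ^+ 2 * frob2 B.
Proof.
move=> c0 bk; rewrite /frob2.
have -> : \sum_p \sum_q congruent B k p q ^+ 2 =
    \sum_p nsq (fun q => \sum_i' k i' q * (\sum_i k i p * B i i')).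
  apply: eq_bigr => p _; apply: eq_bigr => q _; congr (_ ^+ 2).
  rewrite /congruent exchange_big/=; apply: eq_bigr => i' _.
  by rewrite mulr_sumr; apply: eq_bigr => i _; ring.
apply: (le_trans (y := \sum_p c * nsq (fun i' => \sum_i k i p * B i i'))).
  by apply: ler_sum => p _; exact: bk.
rewrite -mulr_sumr expr2 -mulrA ler_pM2l// exchange_big/= [X in _ <= c * X]exchange_big/=.
rewrite mulr_sumr; apply: ler_sum => i' _.
exact: (bk (fun i => B i i')).
Qed.

End linear_algebra.

(** * Operator norm of a Gaussian matrix *)

Lemma expR1_ge2 (R : realType) : 2 <= expR (1 : R).
Proof. by have := expR_ge1Dx (1 : R); lra. Qed.

Section lattice_net.
Context {R : realType} {I : finType}.

(** Integer vectors written in sign-magnitude form; the magnitudes up to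
    [2 * #|I|] are all that occur in the ball of squared radius [4 * #|I|]. *)
Definition lattice : finType := {ffun I -> bool * 'I_(2 * #|I|).+1}.

Definition latpt (f : lattice) (i : I) : R := (-1) ^+ (f i).1 * (f i).2%:R.

Lemma latpt_sqr f i : latpt f i ^+ 2 = (f i).2%:R ^+ 2.
Proof. by rewrite /latpt exprMn sqrr_sign mul1r. Qed.

(** A Gaussian weight makes the number of lattice points in the ball
    exponential in the dimension. *)
Lemma lattice_weight : \sum_f expR (- nsq (latpt f)) <= expR (2 * #|I|%:R) :> R.
Proof.
pose h (k : bool * 'I_(2 * #|I|).+1) : R := expR (- (k.2%:R ^+ 2)).
have -> : \sum_f expR (- nsq (latpt f)) = \prod_(i : I) \sum_k h k.
  rewrite bigA_distr_bigA; apply: eq_bigr => f _.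
  rewrite /nsq -sumrN expR_sum; apply: eq_bigr => i _.
  by rewrite latpt_sqr.
have -> : \prod_(i : I) \sum_k h k = (\sum_k h k) ^+ #|I| by rewrite prodr_const.
have hb : \sum_k h k <= expR 2%:R.
  rewrite -(pair_bigA _ (fun (b : bool) (k : 'I_(2 * #|I|).+1) => h (b, k)))/=.
  rewrite big_bool/= /h/=.
  suff H : \sum_(k < (2 * #|I|).+1) expR (- (k%:R ^+ 2)) <= 2 :> R.
    apply: (le_trans (lerD H H)).
    have e2 := expR1_ge2 R.
    have -> : expR 2 = expR 1 * expR 1 :> R by rewrite -expRD; congr expR; ring.
    nra.
  apply: (le_trans (y := \sum_(k < (2 * #|I|).+1) 2^-1 ^+ k)).
    apply: ler_sum => k _; rewrite exprVn expRN lef_pV2 ?posrE ?exprn_gt0 ?expR_gt0//.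
    apply: (le_trans (y := expR 1 ^+ k)).
      by rewrite lerXn2r ?nnegrE ?expR_ge0// expR1_ge2.
    rewrite -expRM_natl mulr1 ler_expR.
    by rewrite -natrX ler_nat; case: (nat_of_ord k) => // k'; rewrite leq_pmull.
  have geo N : \sum_(k < N) 2^-1 ^+ k = 2 - 2 * 2^-1 ^+ N :> R.
    elim: N => [|N IH]; first by rewrite big_ord0 expr0; ring.
    by rewrite big_ord_recr/= IH exprS; field.
  by rewrite geo gerBl mulr_ge0// exprn_ge0// invr_ge0.
rewrite expRM_natr lerXn2r ?nnegrE ?expR_ge0//.
by apply: sumr_ge0 => k _; exact: expR_ge0.
Qed.

(** Rounding towards zero keeps the lattice point in the ball. *)
Lemma lattice_round (v : I -> R) : nsq v <= 4 * #|I|%:R ->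
  exists f, nsq (latpt f) <= nsq v /\ nsq (fun i => v i - latpt f i) <= #|I|%:R.
Proof.
move=> hv.
have cardI (i : I) : (0 < #|I|)%N by apply/card_gt0P; exists i.
have tr i : (Num.truncn `|v i| < (2 * #|I|).+1)%N.
  rewrite truncn_lt_nat// (le_lt_trans (y := (2 * #|I|)%:R)) ?ltr_nat//.
  rewrite -(@ler_pXn2r _ 2)// ?nnegrE//.
  rewrite -normrX ger0_norm ?sqr_ge0//.
  apply: (le_trans (coord_le_nsq v i)); apply: (le_trans hv).
  rewrite -natrX -natrM ler_nat expnMn leq_mul//.
  by rewrite expnS expn1 leq_pmull// (cardI i).
pose f : lattice := [ffun i => (v i < 0, Ordinal (tr i))].
exists f.
have tb i : (Num.truncn `|v i|)%:R <= `|v i| < (Num.truncn `|v i|).+1%:R.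
  exact: truncn_itv.
split.
  apply: ler_sum => i _; rewrite latpt_sqr ffunE/= -[leRHS]real_normK ?num_real//.
  by rewrite lerXn2r ?nnegrE//; have /andP[] := tb i.
rewrite /nsq -sum1_card natr_sum; apply: ler_sum => i _.
have -> : (v i - latpt f i) ^+ 2 = (`|v i| - (Num.truncn `|v i|)%:R) ^+ 2.
  rewrite /latpt ffunE/=; case: ltP => vi.
    by rewrite (ltr0_norm vi)/= expr1; ring.
  by rewrite (ger0_norm vi)/= expr0; ring.
have /andP[h1 h2] := tb i; rewrite -natr1 in h2.
by rewrite expr_le1 ?subr_ge0// lerBlDl ltW.
Qed.

(** Up to scaling, the rounding error has at most half the norm of the vector,
    so the supremum over the ball bounds itself with a factor 1/2. *)
Lemma opb_lattice (J : finType) (q : R) (a : I -> J -> R) : 0 <= q ->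
  (forall f, nsq (latpt f) <= 4 * #|I|%:R ->
    nsq (fun j => \sum_i a i j * latpt f i) <= q * (4 * #|I|%:R)) ->
  opb (4 * q) a.
Proof.
move=> q0 Hf; set mI : R := #|I|%:R in Hf *.
pose at_ (v : I -> R) (j : J) := \sum_i a i j * v i.
pose S := [set nsq (at_ v) | v in [set v | nsq v <= 4 * mI]].
have mI0 : 0 <= mI by rewrite ler0n.
have S0 : S !=set0.
  exists (nsq (at_ (fun=> 0))); exists (fun=> 0) => //=.
  by rewrite /nsq big1 ?mulr_ge0// => i _; rewrite expr0n.
have Sub : has_ubound S.
  exists (\sum_j nsq (a^~ j) * (4 * mI)) => _ [v /= hv <-].
  rewrite /nsq; apply: ler_sum => j _; apply: (le_trans (cauchy_schwarz _ _)).
  by apply: ler_wpM2l => //; exact: nsq_ge0.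
have atZ c v : nsq (at_ (fun i => c * v i)) = c ^+ 2 * nsq (at_ v).
  rewrite -nsqZ /nsq; apply: eq_bigr => j _; congr (_ ^+ 2).
  by rewrite /at_ mulr_sumr; apply: eq_bigr => i _; ring.
have step : sup S <= 8 * q * mI + sup S / 2.
  apply: ge_sup => // _ [v /= hv <-].
  have [f [f1 f2]] := lattice_round hv.
  have hu := Hf f (le_trans f1 hv).
  pose e i := 2 * (v i - latpt f i).
  have he : nsq (at_ e) <= sup S.
    apply: ub_le_sup => //; exists e => //=.
    by rewrite /e nsqZ (_ : 2 ^+ 2 = 4)//; [rewrite ler_pM2l|ring].
  have : nsq (at_ v) <= 2 * nsq (at_ (latpt f)) + 2^-1 * nsq (at_ e).
    rewrite /nsq !mulr_sumr -big_split/=; apply: ler_sum => j _.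
    have -> : at_ v j = at_ (latpt f) j + 2^-1 * at_ e j.
      rewrite /at_ mulr_sumr -big_split/=; apply: eq_bigr => i _.
      by rewrite /e; field.
    set x := at_ _ j; set y := at_ e j.
    have := sqr_ge0 (x - 2^-1 * y); nra.
  move=> /le_trans; apply; move: hu he; rewrite -/(at_ _) => hu he; lra.
have supS : sup S <= 16 * q * mI by lra.
move=> v; have [v0|v0] := eqVneq (nsq v) 0.
  have vi i : v i = 0.
    have := coord_le_nsq v i; rewrite v0 => vi.
    by apply/eqP; rewrite -sqrf_eq0; apply/eqP/le_anti; rewrite vi sqr_ge0.
  rewrite v0 mulr0 /nsq big1// => j _; rewrite big1 ?expr0n// => i _.
  by rewrite vi mulr0.
have vp : 0 < nsq v by rewrite lt_def v0 nsq_ge0.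
pose c := Num.sqrt (4 * mI / nsq v).
have c2 : c ^+ 2 = 4 * mI / nsq v.
  by rewrite sqr_sqrtr// divr_ge0 ?mulr_ge0// ltW.
have : nsq (at_ (fun i => c * v i)) <= 16 * q * mI.
  apply: le_trans supS; apply: ub_le_sup => //; exists (fun i => c * v i) => //=.
  by rewrite nsqZ c2 divfK.
rewrite atZ c2 -/(at_ v).
have mIp : 0 < mI.
  rewrite ltr0n lt0n; apply/eqP => I0.
  move/eqP: v0; apply; rewrite /nsq big1// => i _.
  by have := fintype0 i I0.
rewrite mulrAC ler_pdivrMr// => h.
have : 4 * mI * nsq (at_ v) <= 4 * mI * (4 * q * nsq v) by lra.
by rewrite ler_pM2l// mulr_gt0.
Qed.

Definition lattice_ok (J : finType) (q : R) (a : I -> J -> R) : bool :=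
  [forall f : lattice, (nsq (latpt f) <= 4 * #|I|%:R) ==>
    (nsq (fun j => \sum_i a i j * latpt f i) <= q * (4 * #|I|%:R))].

Lemma lattice_ok_opb (J : finType) (q : R) (a : I -> J -> R) : 0 <= q ->
  lattice_ok q a -> opb (4 * q) a.
Proof. by move=> q0 /forallP H; apply: opb_lattice => // f; apply/implyP. Qed.

End lattice_net.

Lemma measurable_forall d (T : measurableType d) (F : finType)
    (p : F -> T -> bool) :
  (forall f, measurable_fun setT (p f)) ->
  measurable_fun setT (fun t => [forall f, p f t]).
Proof.
move=> mp; apply: (measurable_fun_bool true); rewrite setTI.
rewrite (_ : _ @^-1` _ = \bigcap_(f in [set: F]) (p f @^-1` [set true])).
  apply: fin_bigcap_measurable => // f _.
  by rewrite -[X in measurable X]setTI; exact: mp.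
apply/seteqP; split => t /=; first by move=> /forallP H f _; exact: H.
by move=> H; apply/forallP => f; exact: H.
Qed.

Lemma measurable_fun_natr d (T : measurableType d) (R : realType) (g : T -> bool) :
  measurable_fun setT g -> measurable_fun setT (fun t => (g t)%:R : R).
Proof.
move=> mg; rewrite (_ : (fun t => _) = fun t => if g t then 1 else 0).
  exact: measurable_fun_ifT.
by apply/funext => t; case: (g t).
Qed.

Section opnorm_tail.
Context d (T : measurableType d) (R : realType) (P : probability T R).
Context (I J : finType) (X : J * I -> T -> R).
Hypothesis mX : forall k, measurable_fun setT (X k).
Hypothesis iX : box_indep P X.
Hypothesis lawX : forall k B, measurable B ->
  P (X k @^-1` B) = centered_normal 1 B.

(** The coordinates of [X u] are independent, and each square is a form of rank
    one. *)
Lemma column_mgf (theta : R) (u : I -> R) : 0 <= theta ->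
  theta * nsq u <= 16^-1 ->
  (\int[P]_t (expR (theta * nsq (fun j => \sum_i X (j, i) t * u i)))%:E <=
   (expR (#|J|%:R / 8))%:E)%E.
Proof.
move=> t0 tu; pose M (j : J) (i i' : I) := theta * u i * u i'.
have qE j x : qf (M j) x = theta * (\sum_i x i * u i) ^+ 2.
  rewrite /qf /M expr2 mulr_suml mulr_sumr; apply: eq_bigr => i _.
  by rewrite !mulr_sumr; apply: eq_bigr => i' _; ring.
have ME j : (fun i i' => 1 * 1 * M j i i') = M j.
  by apply/funext => i; apply/funext => i'; rewrite !mul1r.
have := quad_mgf_blocks mX iX (s := fun=> 1) (M := M) lawX.
rewrite (_ : (fun t => _) = (fun t => (expR (theta *
   nsq (fun j => \sum_i X (j, i) t * u i)))%:E)); last first.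
  apply/funext => t; congr (expR _)%:E; rewrite /nsq mulr_sumr.
  by apply: eq_bigr => j _; rewrite qE.
move=> h; apply: (le_trans (h _ _)) => {h}.
- by move=> j i i'; rewrite /M; ring.
- move=> j x; rewrite ME qE ger0_norm; last exact: mulr_ge0 t0 (sqr_ge0 _).
  apply: (le_trans (ler_wpM2l t0 (cauchy_schwarz _ _))).
  by rewrite mulrCA mulrC ler_wpM2r// nsq_ge0.
rewrite lee_fin ler_expR.
have -> : #|J|%:R / 8 = \sum_(j : J) 8^-1 :> R.
  by rewrite sumr_const -[RHS]mulr_natl.
apply: ler_sum => j _; rewrite ME.
have -> : mxtr (M j) = theta * nsq u.
  by rewrite /mxtr /nsq mulr_sumr; apply: eq_bigr => i _; rewrite /M; ring.
have -> : frob2 (M j) = (theta * nsq u) ^+ 2.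
  rewrite /frob2 /nsq expr2 mulrACA mulr_suml mulr_sumr; apply: eq_bigr => i _.
  by rewrite !mulr_sumr; apply: eq_bigr => i' _; rewrite /M; ring.
have : 0 <= theta * nsq u by rewrite mulr_ge0// nsq_ge0.
nra.
Qed.

(** Union bound over the lattice points [f] of the ball, where the weight
    [exp (4 #|I| - nsq (latpt f)) >= 1] replaces the count by
    [lattice_weight]. *)
Lemma lattice_ok_tail (q : R) : (0 < #|I|)%N ->
  (\int[P]_t (~~ lattice_ok q (fun i j => X (j, i) t))%:R%:E <=
   (expR (6 * #|I|%:R + #|J|%:R / 8 - q / 16))%:E)%E.
Proof.
move=> I0; have mI0 : (0 : R) < #|I|%:R by rewrite ltr0n.
pose theta : R := (64 * #|I|%:R)^-1.
have t0 : 0 <= theta by rewrite invr_ge0 mulr_ge0// ltW.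
pose F (f : lattice (I := I)) t :=
  nsq (fun j => \sum_i X (j, i) t * latpt f i : R).
pose c (f : lattice (I := I)) : R := if nsq (latpt f) <= 4 * #|I|%:R :> R then
   expR (4 * #|I|%:R - nsq (latpt f)) * expR (- (q / 16)) else (0 : R).
have c0 f : 0 <= c f by rewrite /c; case: ifP => // _; rewrite mulr_ge0 ?expR_ge0.
have mF f : measurable_fun setT (F f).
  apply: measurable_sum => j; apply: measurable_funX; apply: measurable_sum => i.
  exact: measurable_funM.
have mE f : measurable_fun setT (fun t => (expR (theta * F f t))%:E).
  by apply/measurable_EFinP/measurableT_comp => //; exact: measurable_funM.
apply: (@le_trans _ _ (\int[P]_t (\sum_f (c f)%:E * (expR (theta * F f t))%:E))%E).
  apply: ge0_le_integral => //.
  - apply/measurable_EFinP/measurable_fun_natr/measurable_neg.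
    apply: measurable_forall => f.
    case: (nsq (latpt f) <= _ :> R) => /=; last exact: measurable_cst.
    by apply: measurable_fun_ler => //; exact: mF.
  - apply: emeasurable_sum => f; exact: emeasurable_funM.
  - move=> t _; have [ok|/forallPn[f]] := boolP (lattice_ok q (fun i j => X (j, i) t)).
      by rewrite sume_ge0// => f _; rewrite mule_ge0// lee_fin ?c0 ?expR_ge0.
    rewrite negb_imply -ltNge => /andP[f1 f2].
    rewrite (bigD1 f)//=; apply: lee_paddr.
      by rewrite sume_ge0// => f' _; rewrite mule_ge0// lee_fin ?c0 ?expR_ge0.
    rewrite -EFinM lee_fin /c f1 -!expRD -[leLHS]expR0 ler_expR.
    have -> : q / 16 = theta * (q * (4 * #|I|%:R)).
      by rewrite /theta; field; rewrite gt_eqF.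
    rewrite -addrA addr_ge0 ?subr_ge0// addrC subr_ge0 ler_wpM2l//; exact: ltW.
rewrite ge0_integral_sum//; last 2 first.
- by move=> f; exact: emeasurable_funM.
- by move=> f t _; rewrite mule_ge0// lee_fin ?c0 ?expR_ge0.
apply: (@le_trans _ _ (\sum_f (c f * expR (#|J|%:R / 8))%:E)%E).
  apply: lee_sum => f _; rewrite ge0_integralZl_EFin//.
  rewrite EFinM /c; case: ifP => [f1|_]; last by rewrite !mul0e.
  apply: lee_wpmul2l; first by rewrite lee_fin mulr_ge0 ?expR_ge0.
  apply: column_mgf => //; rewrite /theta invfM mulrAC -ler_pdivlMr ?invr_gt0//.
  rewrite invrK; apply: (le_trans (ler_wpM2l _ f1)) => //; lra.
rewrite sumEFin lee_fin.
apply: (le_trans (y := \sum_(f : lattice (I := I)) expR (4 * #|I|%:R - q / 16 + #|J|%:R / 8) *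
    expR (- nsq (latpt f)))).
  apply: ler_sum => f _; rewrite /c; case: ifP => _; last first.
    by rewrite mul0r mulr_ge0 ?expR_ge0.
  by rewrite -!expRD ler_expR; lra.
rewrite -mulr_sumr; apply: (le_trans (ler_wpM2l (expR_ge0 _) lattice_weight)).
by rewrite -expRD ler_expR; lra.
Qed.

End opnorm_tail.

(** * Lower tail of the energy of a Gaussian sandwich *)

Lemma sum_pairE (V : nmodType) (B I : finType) (F : B * I -> V) :
  \sum_k F k = \sum_l \sum_i F (l, i).
Proof. by rewrite pair_bigA/=; apply: eq_bigr => -[]. Qed.

Section psd_form.
Context {R : realType} {J Q : finType}.
Variables (e : Q -> R) (b : J -> Q -> R).
Hypothesis e0 : forall q, 0 <= e q.

Definition sandwich_tr : R := \sum_q e q * nsq (b^~ q).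

Lemma sandwich_tr_ge0 : 0 <= sandwich_tr.
Proof. by apply: sumr_ge0 => q _; rewrite mulr_ge0// nsq_ge0. Qed.

Lemma mxtr_sandwich : mxtr (sandwich e b) = sandwich_tr.
Proof.
rewrite /mxtr /sandwich exchange_big/=; apply: eq_bigr => q _.
by rewrite /nsq mulr_sumr; apply: eq_bigr => j _; ring.
Qed.

Lemma qf_sandwich_ge0 x : 0 <= qf (sandwich e b) x.
Proof.
by rewrite qf_sandwich; apply: sumr_ge0 => q _; rewrite mulr_ge0// sqr_ge0.
Qed.

Lemma qf_sandwich_le x : qf (sandwich e b) x <= sandwich_tr * nsq x.
Proof.
rewrite qf_sandwich /sandwich_tr mulr_suml; apply: ler_sum => q _.
by rewrite -mulrA ler_wpM2l//; exact: cauchy_schwarz.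
Qed.

Lemma frob2_sandwich_le_tr : frob2 (sandwich e b) <= sandwich_tr ^+ 2.
Proof.
rewrite -mxtr_sandwich /mxtr expr2 mulr_suml; apply: ler_sum => j _.
rewrite mulr_sumr; apply: ler_sum => j' _.
pose c k q := Num.sqrt (e q) * b k q.
have cE k k' : sandwich e b k k' = \sum_q c k q * c k' q.
  apply: eq_bigr => q _; rewrite /c mulrACA -expr2 sqr_sqrtr//; ring.
rewrite !cE; apply: le_trans (cauchy_schwarz _ _) _.
by rewrite /nsq le_eqVlt; apply/orP; left; apply/eqP; congr (_ * _);
  apply: eq_bigr => q _; rewrite expr2.
Qed.

End psd_form.

Section neg_quad_mgf.
Context d (T : measurableType d) (R : realType) (P : probability T R).
Context (B J Q : finType) (X : B * J -> T -> R).
Hypothesis mX : forall k, measurable_fun setT (X k).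
Hypothesis iX : box_indep P X.
Hypothesis lawX : forall k A, measurable A ->
  P (X k @^-1` A) = centered_normal 1 A.

(** For a positive form the negative exponential moment is governed by the
    mean, as long as the mean is small. *)
Lemma neg_quad_mgf (e : B -> Q -> R) (b : B -> J -> Q -> R) (c : B -> R) :
  (forall k q, 0 <= e k q) -> (forall k, 0 <= c k) ->
  (forall k, c k * sandwich_tr (e k) (b k) <= 16^-1) ->
  (\int[P]_t (expR (- \sum_k c k * qf (sandwich (e k) (b k))
      (block k (joint X t))))%:E <=
   (expR (- \sum_k c k * sandwich_tr (e k) (b k) / 2))%:E)%E.
Proof.
move=> e0 c0 ce; pose M k i j := - c k * sandwich (e k) (b k) i j.
have qM k x : qf (M k) x = - c k * qf (sandwich (e k) (b k)) x.
  rewrite /qf !mulr_sumr; apply: eq_bigr => i _.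
  by rewrite !mulr_sumr; apply: eq_bigr => j _; rewrite /M; ring.
have ME k : (fun i j => 1 * 1 * M k i j) = M k.
  by apply/funext => i; apply/funext => j; rewrite !mul1r.
have := quad_mgf_blocks mX iX (s := fun=> 1) (M := M) lawX.
rewrite (_ : (fun t => _) = (fun t => (expR (- \sum_k c k *
   qf (sandwich (e k) (b k)) (block k (joint X t))))%:E)); last first.
  apply/funext => t; congr (expR _)%:E; rewrite -sumrN.
  by apply: eq_bigr => k _; rewrite qM mulNr.
move=> h; apply: (le_trans (h _ _)) => {h}.
- by move=> k i j; rewrite /M sandwich_sym.
- move=> k x; rewrite ME qM mulNr normrN ger0_norm; last first.
    exact: mulr_ge0 (c0 k) (qf_sandwich_ge0 _ (e0 k) x).
  apply: (le_trans (ler_wpM2l (c0 k) (qf_sandwich_le _ (e0 k) x))).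
  by rewrite mulrA ler_wpM2r//; exact: nsq_ge0.
rewrite lee_fin ler_expR -sumrN; apply: ler_sum => k _; rewrite ME.
have -> : mxtr (M k) = - (c k * sandwich_tr (e k) (b k)).
  by rewrite -mxtr_sandwich /mxtr mulr_sumr -sumrN; apply: eq_bigr => i _; rewrite /M mulNr.
have -> : frob2 (M k) = c k ^+ 2 * frob2 (sandwich (e k) (b k)).
  rewrite /frob2 mulr_sumr; apply: eq_bigr => i _; rewrite mulr_sumr.
  by apply: eq_bigr => j _; rewrite /M; ring.
have h1 : c k ^+ 2 * frob2 (sandwich (e k) (b k)) <=
    (c k * sandwich_tr (e k) (b k)) ^+ 2.
  by rewrite exprMn ler_wpM2l ?sqr_ge0//; exact: frob2_sandwich_le_tr.
have h2 := ce k.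
have h3 : 0 <= c k * sandwich_tr (e k) (b k).
  by rewrite mulr_ge0// sandwich_tr_ge0.
nra.
Qed.

End neg_quad_mgf.

Lemma exists_subset_card (I : finType) h : (h <= #|I|)%N ->
  exists S : {set I}, #|S| = h.
Proof.
move=> hI; exists [set i in take h (enum I)]%SET.
rewrite cardsE; have /card_uniqP -> : uniq (take h (enum I)).
  by rewrite take_uniq// enum_uniq.
by rewrite size_takel// -cardE.
Qed.

Section lower_tail.
Context d (T : measurableType d) (R : realType) (P : probability T R).
Context (B I J : finType) (X : (B * I) * J -> T -> R).
Hypothesis mX : forall k, measurable_fun setT (X k).
Hypothesis iX : box_indep P X.
Hypothesis lawX : forall k A, measurable A ->
  P (X k @^-1` A) = centered_normal 1 A.

Definition mxblk (x : (B * I) * J -> R) (l : B) (i : I) (j : J) : R :=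
  x ((l, i), j).

Lemma measurable_mxblk l i j :
  measurable_fun setT (fun x : vec R ((B * I) * J)%type => mxblk x l i j).
Proof. exact: measurable_coord. Qed.

Lemma measurable_frob2_sandwich (dd : J -> R) l :
  measurable_fun setT (fun x : vec R ((B * I) * J)%type =>
    frob2 (sandwich dd (mxblk x l))).
Proof.
apply: measurable_sum => i; apply: measurable_sum => i'; apply: measurable_funX.
apply: measurable_sum => j; apply: measurable_funM; last exact: measurable_mxblk.
by apply: measurable_funM => //; exact: measurable_mxblk.
Qed.

Section split_rows.
Variables (S : {set I}) (dd : J -> R) (s : R).
Hypothesis s0 : 0 <= s.

Let e (i : I) : R := (i \notin S)%:R.
Let bb (x : (B * I) * J -> R) (l : B) (j : J) (i : I) : R := dd j * mxblk x l i j.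

(* The mass of the rows outside S, and the energy between the rows of S and
   those rows. *)
Let tau x l : R := sandwich_tr e (bb x l).
Let cross x (l : B) (i : I) : R := qf (sandwich e (bb x l)) (mxblk x l i).

Let e_ge0 i : 0 <= e i. Proof. exact: ler0n. Qed.

(* The two off-diagonal blocks of the symmetric matrix are equal in norm. *)
Lemma cross_le_frob2 x l :
  2 * \sum_(i in S) cross x l i <= frob2 (sandwich dd (mxblk x l)).
Proof.
have crossE i : cross x l i = \sum_(i' | i' \notin S) sandwich dd (mxblk x l) i i' ^+ 2.
  rewrite /cross qf_sandwich [RHS]big_mkcond/=; apply: eq_bigr => i' _.
  rewrite /e; case: ifP => _; rewrite ?mul0r// mul1r; congr (_ ^+ 2).
  by apply: eq_bigr => j _; rewrite /bb; ring.
under eq_bigr do rewrite crossE.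
rewrite /frob2 [leRHS](bigID (mem S))/=.
rewrite mulr_natl mulr2n; apply: lerD.
  apply: ler_sum => i _; rewrite [leRHS](bigID (mem S))/= lerDr.
  by apply: sumr_ge0 => i' _; exact: sqr_ge0.
rewrite exchange_big/=; apply: ler_sum => i' _.
rewrite [leRHS](bigID (mem S))/=.
have -> : \sum_(i in S) sandwich dd (mxblk x l) i i' ^+ 2 =
    \sum_(i in S) sandwich dd (mxblk x l) i' i ^+ 2.
  by apply: eq_bigr => i _; rewrite sandwich_sym.
by rewrite lerDl; apply: sumr_ge0 => i _; exact: sqr_ge0.
Qed.

Let measurable_tau l :
  measurable_fun setT (fun x : vec R ((B * I) * J)%type => tau x l).
Proof.
apply: measurable_sum => i; apply: measurable_funM => //.
apply: measurable_sum => j; apply: measurable_funX; apply: measurable_funM => //.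
exact: measurable_mxblk.
Qed.

Let measurable_cross l i :
  measurable_fun setT (fun x : vec R ((B * I) * J)%type => cross x l i).
Proof.
rewrite (_ : (fun x => _) = fun x : vec R ((B * I) * J)%type =>
    \sum_q e q * (\sum_j (bb x l j q) * mxblk x l i j) ^+ 2); last first.
  by apply/funext => x; rewrite /cross qf_sandwich.
apply: measurable_sum => i'; apply: measurable_funM => //; apply: measurable_funX.
apply: measurable_sum => j; apply: measurable_funM; last exact: measurable_mxblk.
by apply: measurable_funM => //; exact: measurable_mxblk.
Qed.

(** Given the rows outside [S], the cross energies are independent positive
    forms in the rows of [S], with mean [tau]; and [tau] is itself a positive
    form in the rows outside [S]. *)
Lemma split_rows_bound (good : vec R ((B * I) * J)%type -> bool) :
  measurable_fun setT good ->
  (forall x, good x -> forall l, 32 * s * tau x l <= 1) ->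
  16 * (s * #|S|%:R * nsq dd) <= 1 ->
  (\int[P]_t ((good (joint X t))%:R *
      expR (- (s * \sum_l frob2 (sandwich dd (mxblk (joint X t) l)))))%:E <=
   (expR (- (s * #|S|%:R * #|~: S|%:R * #|B|%:R * nsq dd / 2)))%:E)%E.
Proof.
move=> mgood hgood hs.
pose cond (x : vec R ((B * I) * J)%type) := [forall l, 32 * s * tau x l <= 1].
have mcond : measurable_fun setT cond.
  apply: measurable_forall => l; apply: measurable_fun_ler => //.
  exact: measurable_funM.
pose F (x : vec R ((B * I) * J)%type) :=
  ((cond x)%:R * expR (- (2 * s * \sum_l \sum_(i in S) cross x l i)))%:E.
have F0 x : (0 <= F x)%E by rewrite lee_fin mulr_ge0 ?expR_ge0.
have mF : measurable_fun setT F.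
  apply/measurable_EFinP/measurable_funM; first exact: measurable_fun_natr.
  apply: measurableT_comp => //; apply: measurableT_comp => //.
  apply: measurable_funM => //; apply: measurable_sum => l.
  rewrite (_ : (fun x => _) = fun x => \sum_i (if i \in S then cross x l i else 0)).
    by apply: measurable_sum => i; case: (i \in S).
  by apply/funext => x; rewrite big_mkcond.
have mJ := measurable_joint mX.
apply: (@le_trans _ _ (\int[P]_t F (joint X t))%E).
  apply: ge0_le_integral => //.
  - apply/measurable_EFinP/measurable_funM.
      by apply: measurable_fun_natr; exact: (measurableT_comp mgood mJ).
    apply: measurableT_comp => //; apply: measurableT_comp => //.
    apply: measurable_funM => //; apply: measurable_sum => l.
    exact: (measurableT_comp (measurable_frob2_sandwich dd l) mJ).
  - exact: (measurableT_comp mF mJ).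
  - move=> t _; rewrite lee_fin; case: (boolP (good _)) => gx; last first.
      by rewrite mul0r mulr_ge0 ?expR_ge0.
    have -> : cond (joint X t) by apply/forallP => l; exact: hgood.
    rewrite !mul1r ler_expR lerN2 (mulrC 2) -mulrA ler_wpM2l// mulr_sumr.
    by apply: ler_sum => l _; exact: cross_le_frob2.
pose outer := [pred k : (B * I) * J | k.1.2 \notin S].
rewrite (integral_mix mX iX outer mF F0).
pose H (x : vec R ((B * I) * J)%type) :=
  (expR (- (s * #|S|%:R * \sum_l tau x l)))%:E.
have mH : measurable_fun setT H.
  apply/measurable_EFinP/measurableT_comp => //; apply: measurableT_comp => //.
  by apply: measurable_funM => //; exact: measurable_sum.
apply: (@le_trans _ _ (\int[P]_t H (joint X t))%E).
  apply: ge0_le_integral => //.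
  - move=> t _; apply: integral_ge0 => u _; exact: F0.
  - pose G (ts : T * T) := F (mix outer (joint X ts.1) (joint X ts.2)).
    have mG : measurable_fun setT G.
      apply: (measurableT_comp mF).
      apply: (measurableT_comp (measurable_mix outer)
        (g := fun ts : T * T => (joint X ts.1, joint X ts.2))).
      apply: measurable_fun_pair.
        exact: (measurableT_comp mJ measurable_fst).
      exact: (measurableT_comp mJ measurable_snd).
    by apply: (measurable_fun_fubini_tonelli_F G) => // ts; exact: F0.
  - exact: (measurableT_comp mH mJ).
  - move=> t0 _; set x0 := joint X t0.
    have bbE t l : forall i, i \notin S -> forall j,
        bb (mix outer x0 (joint X t)) l j i = bb x0 l j i.
      by move=> i iS j; rewrite /bb /mxblk /mix inE/= iS.
    have ebb t l : sandwich e (bb (mix outer x0 (joint X t)) l) = sandwich e (bb x0 l).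
      apply/funext => j; apply/funext => j'; apply: eq_bigr => i _; rewrite /e.
      by case: (boolP (i \in S)) => iS; rewrite ?mul0r//= !bbE.
    have tauE t l : tau (mix outer x0 (joint X t)) l = tau x0 l.
      by rewrite /tau -!mxtr_sandwich ebb.
    have condE t : cond (mix outer x0 (joint X t)) = cond x0.
      by apply: eq_forallb => l; rewrite tauE.
    have [cx|cx] := boolP (cond x0); last first.
      rewrite integral0_eq; last by move=> t _; rewrite /F condE (negbTE cx) mul0r.
      by rewrite lee_fin expR_ge0.
    pose c (li : B * I) := 2 * s * (li.2 \in S)%:R.
    have := @neg_quad_mgf _ _ _ P _ _ _ X mX iX lawX (fun=> e)
      (fun li => bb x0 li.1) c.
    rewrite (_ : (fun t => _) = (fun t => F (mix outer x0 (joint X t)))); last first.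
      apply/funext => t; rewrite /F condE cx mul1r; congr (expR (- _))%:E.
      rewrite sum_pairE/= mulr_sumr; apply: eq_bigr => l _.
      rewrite mulr_sumr [RHS]big_mkcond/=; apply: eq_bigr => i _.
      rewrite /c/=; case: (boolP (i \in S)) => iS; last by rewrite mulr0 mul0r.
      rewrite mulr1 /cross ebb; congr (_ * qf _ _); apply/funext => j.
      by rewrite /block /mxblk /mix inE/= iS.
    move=> h; apply: (le_trans (h _ _ _)) => {h}.
    + by [].
    + by move=> li; rewrite /c !mulr_ge0.
    + move=> [l i]; rewrite /c/=; have := forallP cx l; rewrite -/(tau x0 l).
      have t0' : 0 <= s * tau x0 l by rewrite mulr_ge0// sandwich_tr_ge0.
      case: (i \in S) => /=; lra.
    rewrite lee_fin ler_expR lerN2 le_eqVlt; apply/orP; left; apply/eqP.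
    rewrite sum_pairE/=.
    rewrite mulr_sumr; apply: eq_bigr => l _; rewrite -/(tau x0 l).
    transitivity (\sum_(i in S) s * tau x0 l).
      by rewrite sumr_const -mulr_natl; ring.
    rewrite big_mkcond/=; apply: eq_bigr => i _; rewrite /c/=.
    by case: (i \in S) => /=; field.
(* The remaining form is diagonal. *)
pose c (li : B * I) := s * #|S|%:R * (li.2 \notin S)%:R.
have := @neg_quad_mgf _ _ _ P _ _ _ X mX iX lawX (fun=> fun j => dd j ^+ 2)
  (fun=> fun j q => (j == q)%:R) c.
have trE : sandwich_tr (fun j => dd j ^+ 2) (fun j q => (j == q)%:R) = nsq dd.
  by apply: eq_bigr => j _; rewrite nsq_delta mulr1.
rewrite (_ : (fun t => _) = (fun t => H (joint X t))); last first.
  apply/funext => t; rewrite /H; congr (expR (- _))%:E.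
  rewrite sum_pairE/= mulr_sumr; apply: eq_bigr => l _.
  rewrite /tau /sandwich_tr mulr_sumr; apply: eq_bigr => i _.
  rewrite /c/= mulrA; congr (_ * _); rewrite qf_sandwich; apply: eq_bigr => j _.
  rewrite /bb exprMn; congr (_ * _ ^+ 2); rewrite (bigD1 j)//= eqxx mul1r big1 ?addr0//.
  by move=> k /negbTE ->; rewrite mul0r.
move=> h; apply: (le_trans (h _ _ _)) => {h}.
- by move=> _ q; exact: sqr_ge0.
- by move=> li; rewrite /c !mulr_ge0.
- move=> [l i]; rewrite trE /c/=; case: (i \notin S) => /=; lra.
rewrite lee_fin ler_expR lerN2 le_eqVlt; apply/orP; left; apply/eqP.
rewrite sum_pairE/= trE.
transitivity (\sum_(l : B) s * #|S|%:R * #|~: S|%:R * nsq dd / 2).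
  by rewrite sumr_const -[RHS]mulr_natl; ring.
apply: eq_bigr => l _.
transitivity (\sum_(i in ~: S) s * #|S|%:R * nsq dd / 2).
  by rewrite sumr_const -[RHS]mulr_natl; ring.
rewrite big_mkcond/=; apply: eq_bigr => i _; rewrite /c/= inE.
by case: (i \notin S) => /=; rewrite ?mulr1 ?mulr0 ?mul0r.
Qed.

End split_rows.

(** [split_rows_bound] for a half of the rows. *)
Lemma lower_tail_many (dd : J -> R) (s kappa : R)
    (good : vec R ((B * I) * J)%type -> bool) :
  (1 < #|I|)%N -> 0 <= s -> #|I|%:R <= kappa -> 32 * (s * kappa * nsq dd) <= 1 ->
  measurable_fun setT good ->
  (forall x, good x -> forall l, opb kappa (mxblk x l)) ->
  (\int[P]_t ((good (joint X t))%:R *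
      expR (- (s * \sum_l frob2 (sandwich dd (mxblk (joint X t) l)))))%:E <=
   (expR (- (s * #|B|%:R * #|I|%:R ^+ 2 * nsq dd / 16)))%:E)%E.
Proof.
move=> I1 s0 mk hs mgood hgood.
have k0 : 0 < kappa by apply: lt_le_trans mk; rewrite ltr0n (ltn_trans _ I1).
have [S cardS] : exists S : {set I}, #|S| = #|I|./2.
  by apply: exists_subset_card; rewrite -divn2 leq_div.
have h1 : (3 * #|S| >= #|I|)%N.
  by rewrite cardS; lia.
have cardSC : (#|S| + #|~: S| = #|I|)%N by rewrite cardsC.
have h2 : (2 * #|~: S| >= #|I|)%N.
  by move: cardSC; rewrite cardS; lia.
have d0 := nsq_ge0 dd.
apply: (le_trans (split_rows_bound (S := S) s0 mgood _ _)).
- move=> x gx l; apply: le_trans hs.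
  rewrite -mulrA ler_pM2l// -mulrA ler_wpM2l// /sandwich_tr.
  apply: (le_trans (y := \sum_j dd j ^+ 2 * nsq ((mxblk x l)^~ j))); last first.
    rewrite /nsq mulr_sumr; apply: ler_sum => j _; rewrite mulrC.
    by apply: ler_wpM2r; [exact: sqr_ge0|exact: opb_col (hgood _ gx l)].
  apply: (le_trans (y := \sum_i nsq (fun j => dd j * mxblk x l i j))).
    apply: ler_sum => i _; case: (i \notin S); rewrite ?mul1r ?mul0r//.
    exact: nsq_ge0.
  rewrite /nsq exchange_big/= le_eqVlt; apply/orP; left; apply/eqP.
  by apply: eq_bigr => j _; rewrite mulr_sumr; apply: eq_bigr => i _; rewrite exprMn.
- apply: le_trans hs; rewrite mulrAC.
  have : s * nsq dd * #|S|%:R <= s * nsq dd * kappa.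
    apply: ler_wpM2l; first by rewrite mulr_ge0.
    apply: le_trans mk; rewrite ler_nat -cardSC; exact: leq_addr.
  have : 0 <= s * nsq dd * #|S|%:R by rewrite !mulr_ge0.
  lra.
rewrite lee_fin ler_expR lerN2.
have -> : s * #|B|%:R * #|I|%:R ^+ 2 * nsq dd / 16 =
  s * #|B|%:R * nsq dd * (#|I|%:R ^+ 2 / 16) by ring.
have -> : s * #|S|%:R * #|~: S|%:R * #|B|%:R * nsq dd / 2 =
  s * #|B|%:R * nsq dd * (#|S|%:R * #|~: S|%:R / 2) by ring.
apply: ler_wpM2l; first by rewrite !mulr_ge0.
have h3 : #|I|%:R <= 3 * #|S|%:R :> R by rewrite -natrM ler_nat.
have h4 : #|I|%:R <= 2 * #|~: S|%:R :> R by rewrite -natrM ler_nat.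
have : #|I|%:R * #|I|%:R <= 3 * #|S|%:R * (2 * #|~: S|%:R) :> R by exact: ler_pM.
have : 0 <= #|I|%:R * #|I|%:R :> R by rewrite mulr_ge0.
rewrite expr2; lra.
Qed.

End lower_tail.

(** * Matrices with a single row *)

Section law_transfer.
Context {R : realType}.

Lemma ge0_integral_same_law d (T : measurableType d) (P : probability T R)
    (X Y : T -> R) (f : R -> \bar R) :
  measurable_fun setT X -> measurable_fun setT Y ->
  (forall B, measurable B -> P (X @^-1` B) = P (Y @^-1` B)) ->
  measurable_fun setT f -> (forall x, 0 <= f x)%E ->
  (\int[P]_t f (X t) = \int[P]_t f (Y t))%E.
Proof.
move=> mX mY e mf f0.
pose X' : {mfun T >-> R} := HB.pack X (isMeasurableFun.Build _ _ _ _ X mX).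
pose Y' : {mfun T >-> R} := HB.pack Y (isMeasurableFun.Build _ _ _ _ Y mY).
transitivity (\int[distribution P X']_x f x)%E.
  by rewrite ge0_integral_distribution.
transitivity (\int[distribution P Y']_x f x)%E.
  by apply: eq_measure_integral => A mA _; exact: e.
by rewrite ge0_integral_distribution.
Qed.

End law_transfer.

Section gauss_moments.
Context d (T : measurableType d) (R : realType) (P : probability T R).
Variable X : T -> R.
Hypothesis mX : measurable_fun setT X.
Hypothesis lawX : forall B, measurable B -> P (X @^-1` B) = centered_normal 1 B.

Let mgf (a : R) : 2 * a < 1 ->
  (\int[P]_t (expR (a * X t ^+ 2))%:E = ((Num.sqrt (1 - 2 * a))^-1)%:E)%E.
Proof.
move=> a1; have := gauss_mgf mX lawX (a := a) 0.
rewrite !expr1n !mulr1 expr0n/= mulr0 mul0r expR0 mulr1 => <- //.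
by apply: eq_integral => t _; rewrite mul0r addr0.
Qed.

Lemma integrable_gauss_pow (k : nat) :
  P.-integrable setT (fun t => (X t ^+ (2 * k))%:E).
Proof.
have mXk : measurable_fun setT (fun t => (X t ^+ (2 * k))%:E).
  by apply/measurable_EFinP; exact: measurable_funX.
apply/integrableP; split=> //.
pose c : R := 8 ^+ k * (k`!)%:R.
apply: (@le_lt_trans _ _ (\int[P]_t (c%:E * (expR (8^-1 * X t ^+ 2))%:E))%E).
  apply: ge0_le_integral => //.
  - exact: measurableT_comp.
  - apply: emeasurable_funM => //; apply/measurable_EFinP/measurableT_comp => //.
    by apply: measurable_funM => //; exact: measurable_funX.
  - move=> t _; rewrite -EFinM abse_EFin lee_fin exprM.
    rewrite ger0_norm; last by rewrite exprn_ge0// sqr_ge0.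
    set y := 8^-1 * _.
    have y0 : 0 <= y by rewrite mulr_ge0// sqr_ge0.
    have -> : X t ^+ 2 = 8 * y by rewrite /y mulVKf.
    rewrite exprMn /c -mulrA ler_wpM2l ?exprn_ge0//.
    case: (k) => [|k']; first by rewrite expr0 fact0 mul1r -[leLHS]expR0 ler_expR.
    have := expR_ge1Dxn k' y0.
    have f0 : (0 : R) < (k'.+1)`!%:R by rewrite ltr0n fact_gt0.
    move=> h; rewrite mulrC -ler_pdivrMr//; apply: le_trans h; lra.
rewrite ge0_integralZl_EFin//.
- by rewrite mgf ?ltry//; lra.
- apply/measurable_EFinP/measurableT_comp => //.
  by apply: measurable_funM => //; exact: measurable_funX.
- by rewrite mulr_ge0// exprn_ge0.
Qed.

Definition mom (k : nat) : R := fine (\int[P]_t (X t ^+ (2 * k))%:E).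

Lemma momE k : (\int[P]_t (X t ^+ (2 * k))%:E = (mom k)%:E)%E.
Proof. by rewrite fineK//; exact: integrable_fin_num (integrable_gauss_pow k). Qed.

Lemma mom0 : mom 0 = 1.
Proof.
rewrite /mom; under eq_integral do rewrite muln0 expr0.
by rewrite integral_cst// mul1e [X in fine X]probability_setT.
Qed.

Let poly2 (a b c : R) :
  P.-integrable setT (fun t => (a + b * X t ^+ 2 + c * X t ^+ 4)%:E) /\
  (\int[P]_t (a + b * X t ^+ 2 + c * X t ^+ 4)%:E =
    (a + b * mom 1 + c * mom 2)%:E)%E.
Proof.
pose f k t := (X t ^+ (2 * k))%:E.
have i1 k (e : R) : P.-integrable setT (fun t => e%:E * f k t)%E.
  by apply: integrableZl => //; exact: integrable_gauss_pow.
have e1 k (e : R) : (\int[P]_t (e%:E * f k t) = (e * mom k)%:E)%E.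
  by rewrite integralZl ?momE//; exact: integrable_gauss_pow.
have E : (fun t => (a + b * X t ^+ 2 + c * X t ^+ 4)%:E) =
    (fun t => (a%:E * f 0%N t + b%:E * f 1%N t) + c%:E * f 2%N t)%E.
  by apply/funext => t; rewrite /f expr0 -!EFinM -!EFinD mulr1.
rewrite E; split.
  by apply: integrableD => //; exact: integrableD.
rewrite integralD//; last exact: integrableD.
by rewrite integralD// !e1 -!EFinD mom0 mulr1.
Qed.

Lemma integral_sq_poly (c b : R) :
  (\int[P]_t ((c + b * X t ^+ 2) ^+ 2)%:E =
   ((c + b * mom 1) ^+ 2 + (mom 2 - mom 1 ^+ 2) * b ^+ 2)%:E)%E.
Proof.
have [_ h] := poly2 (c ^+ 2) (2 * c * b) (b ^+ 2).
transitivity (\int[P]_t (c ^+ 2 + 2 * c * b * X t ^+ 2 + b ^+ 2 * X t ^+ 4)%:E)%E.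
  by apply: eq_integral => t _; congr EFin; ring.
by rewrite h; congr EFin; ring.
Qed.

Let expR_neg_le (y : R) : 0 <= y -> expR (- y) <= 1 - y + 5 / 8 * y ^+ 2.
Proof.
move=> y0; rewrite expRN -[leLHS]div1r ler_pdivrMr ?expR_gt0//.
have h : (1 + y / 4) ^+ 4 <= expR y.
  have -> : expR y = expR (y / 4) ^+ 4.
    by rewrite -expRM_natl; congr expR; field.
  by rewrite lerXn2r ?nnegrE ?expR_ge0 ?expR_ge1Dx//; lra.
have p0 : 0 <= 1 - y + 5 / 8 * y ^+ 2.
  by have := sqr_ge0 (y - 4 / 5); nra.
apply: le_trans (ler_wpM2l p0 h).
have -> : (1 - y + 5 / 8 * y ^+ 2) * (1 + y / 4) ^+ 4 =
  1 + y ^+ 3 * (5 / 16 + 45 / 256 * y + 9 / 256 * y ^+ 2 + 5 / 2048 * y ^+ 3).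
  by field.
have y2 : 0 <= y ^+ 2 := exprn_ge0 2 y0.
have y3 : 0 <= y ^+ 3 := exprn_ge0 3 y0.
have q0 : 0 <= 5 / 16 + 45 / 256 * y + 9 / 256 * y ^+ 2 + 5 / 2048 * y ^+ 3 by lra.
by have := mulr_ge0 y3 q0; lra.
Qed.

Let sqrt_inv_le (x y : R) : 0 < y -> y ^+ 2 <= x -> (Num.sqrt x)^-1 <= y^-1.
Proof.
move=> y0 yx; have x0 : 0 < x by apply: lt_le_trans yx; rewrite exprn_gt0.
rewrite lef_pV2 ?posrE ?sqrtr_gt0// -(ger0_norm (ltW y0)) -sqrtr_sqr.
by rewrite ler_wsqrtr.
Qed.

Let sqrt_inv_ge (x y : R) : 0 < y -> 0 < x -> x <= y ^+ 2 ->
  y^-1 <= (Num.sqrt x)^-1.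
Proof.
move=> y0 x0 yx.
rewrite lef_pV2 ?posrE ?sqrtr_gt0// -[leRHS](ger0_norm (ltW y0)) -sqrtr_sqr.
by rewrite ler_wsqrtr.
Qed.

Let mE (a : R) : measurable_fun setT (fun t => (expR (a * X t ^+ 2))%:E).
Proof.
apply/measurable_EFinP/measurableT_comp => //.
by apply: measurable_funM => //; exact: measurable_funX.
Qed.

(** The second moment is 1 and the variance of the square is 2, but lower bounds
    suffice. They come from comparing the exponential moments at 1/8, -1/8 and
    -1/2 with polynomials of degree at most two in [X ^+ 2]. *)
Lemma mom_bounds : 4 / 5 <= mom 1 /\ 1 / 10 <= mom 2 - mom 1 ^+ 2.
Proof.
have mP a b c : measurable_fun setT (fun t => (a + b * X t ^+ 2 + c * X t ^+ 4)%:E).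
  by have [/integrableP[]] := poly2 a b c.
have X0 t : 0 <= X t ^+ 2 by exact: sqr_ge0.
have up : mom 1 <= 62 / 50.
  have [_ h] := poly2 1 (8^-1) 0.
  have : (\int[P]_t (1 + 8^-1 * X t ^+ 2 + 0 * X t ^+ 4)%:E <=
      \int[P]_t (expR (8^-1 * X t ^+ 2))%:E)%E.
    apply: ge0_le_integral => //.
    - by move=> t _; rewrite lee_fin mul0r addr0 addr_ge0// mulr_ge0.
    - by move=> t _; rewrite lee_fin mul0r addr0 expR_ge1Dx.
  rewrite h mgf ?lee_fin; last by lra.
  have := @sqrt_inv_le (1 - 2 * 8^-1) (866 / 1000) ltac:(lra) ltac:(lra).
  lra.
have low : 844 / 1000 <= mom 1.
  have [_ h] := poly2 0 (8^-1) 0.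
  have : (1%:E <= \int[P]_t ((expR (- 8^-1 * X t ^+ 2))%:E +
      (0 + 8^-1 * X t ^+ 2 + 0 * X t ^+ 4)%:E))%E.
    apply: (@le_trans _ _ (\int[P]_t 1%:E)%E).
      by rewrite integral_cst// mul1e [X in (_ <= X)%E]probability_setT.
    apply: ge0_le_integral => //.
    - by apply: emeasurable_funD.
    - move=> t _; rewrite -EFinD lee_fin mul0r add0r addr0.
      by have := expR_ge1Dx (- 8^-1 * X t ^+ 2); lra.
  rewrite ge0_integralD//; last first.
    by move=> t _; rewrite lee_fin mul0r addr0 add0r mulr_ge0.
  rewrite h mgf; last by lra.
  rewrite -EFinD lee_fin.
  have := @sqrt_inv_le (1 - 2 * - 8^-1) (1118 / 1000) ltac:(lra) ltac:(lra).
  lra.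
have four : 320 / 100 * mom 1 - 1876 / 1000 <= mom 2.
  have [_ h] := poly2 1 0 (5 / 32).
  have [_ h'] := poly2 0 (1 / 2) 0.
  have : (\int[P]_t ((expR (- (1 / 2) * X t ^+ 2))%:E +
       (0 + 1 / 2 * X t ^+ 2 + 0 * X t ^+ 4)%:E) <=
      \int[P]_t (1 + 0 * X t ^+ 2 + 5 / 32 * X t ^+ 4)%:E)%E.
    apply: ge0_le_integral => //.
    - move=> t _; rewrite -EFinD lee_fin mul0r addr0 add0r addr_ge0 ?expR_ge0//.
      by rewrite mulr_ge0.
    - by apply: emeasurable_funD.
    - move=> t _; rewrite -EFinD lee_fin.
      have := @expR_neg_le (1 / 2 * X t ^+ 2) ltac:(by rewrite mulr_ge0).
      rewrite (_ : - (1 / 2 * X t ^+ 2) = - (1 / 2) * X t ^+ 2); last by ring.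
      rewrite (_ : X t ^+ 4 = (X t ^+ 2) ^+ 2); last by ring.
      nra.
  rewrite ge0_integralD//; last first.
    by move=> t _; rewrite lee_fin mul0r addr0 add0r mulr_ge0.
  rewrite h h' mgf; last by lra.
  rewrite -EFinD lee_fin.
  have := @sqrt_inv_ge (1 - 2 * - (1 / 2)) (14143 / 10000) ltac:(lra) ltac:(lra) ltac:(lra).
  lra.
split; first by lra.
nra.
Qed.

End gauss_moments.

Section diagonal_form.
Context d (T : measurableType d) (R : realType) (P : probability T R).
Context (J : finType) (X : J -> T -> R).
Hypothesis mX : forall j, measurable_fun setT (X j).
Hypothesis iX : box_indep P X.
Hypothesis lawX : forall j A, measurable A ->
  P (X j @^-1` A) = centered_normal 1 A.

Let dq (dd : J -> R) (x : J -> R) : R := \sum_j dd j * x j ^+ 2.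

Let measurable_dq (dd : J -> R) : measurable_fun setT (fun x : vec R J => dq dd x).
Proof.
apply: measurable_sum => j; apply: measurable_funM => //.
by apply: measurable_funX; exact: measurable_coord.
Qed.

Let mJ : measurable_fun setT (joint X) := measurable_joint mX.

(** One coordinate is integrated at a time, which is why a shift [c] is carried
    along. The coordinates have the same law; [j0] names its moments. *)
Lemma second_moment_diag (j0 : J) (dd : J -> R) (c : R) :
  (\int[P]_t ((c + dq dd (joint X t)) ^+ 2)%:E =
   ((c + mom P (X j0) 1 * \sum_j dd j) ^+ 2 +
     (mom P (X j0) 2 - mom P (X j0) 1 ^+ 2) * nsq dd)%:E)%E.
Proof.
set e := mom P (X j0) 1; set v := mom P (X j0) 2 - _.
pose part (r : seq J) (x : vec R J) := \sum_(j <- r) dd j * x j ^+ 2.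
have mpart r c' : measurable_fun setT (fun x => ((c' + part r x) ^+ 2)%:E).
  apply/measurable_EFinP; apply: measurable_funX; apply: measurable_funD => //.
  apply: measurable_sum => j; apply: measurable_funM => //.
  by apply: measurable_funX; exact: measurable_coord.
suff main r : uniq r -> forall c, (\int[P]_t ((c + part r (joint X t)) ^+ 2)%:E =
    ((c + e * \sum_(j <- r) dd j) ^+ 2 + v * (\sum_(j <- r) dd j ^+ 2))%:E)%E.
  exact: main (index_enum_uniq _) c.
elim: r => [_|j r IH /= /andP[jr ur]] {}c.
  rewrite !big_nil !mulr0 !addr0.
  under eq_integral do rewrite /part big_nil addr0.
  by rewrite integral_cst// [X in (_ * X)%E]probability_setT mule1.
rewrite (integral_mix mX iX (predC1 j) (f := fun x => ((c + part (j :: r) x) ^+ 2)%:E)); last 2 first.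
- exact: mpart.
- by move=> x; rewrite lee_fin sqr_ge0.
have sq x : measurable_fun setT (fun y : R => ((x + dd j * y ^+ 2) ^+ 2)%:E).
  apply/measurable_EFinP; apply: measurable_funX; apply: measurable_funD => //.
  by apply: measurable_funM => //; exact: exprn_measurable.
have -> : (\int[P]_s \int[P]_t
    ((c + part (j :: r) (mix (predC1 j) (joint X s) (joint X t))) ^+ 2)%:E =
    \int[P]_s (((c + dd j * e) + part r (joint X s)) ^+ 2 + v * dd j ^+ 2)%:E)%E.
  apply: eq_integral => s _.
  pose C := c + part r (joint X s).
  transitivity (\int[P]_t ((C + dd j * X j t ^+ 2) ^+ 2)%:E)%E.
    apply: eq_integral => t _; congr ((_ ^+ 2)%:E).
    rewrite /C /part big_cons /mix inE eqxx/= addrA addrAC; congr (_ + _ + _).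
    rewrite !big_seq; apply: eq_bigr => k kr; rewrite inE.
    by rewrite (memPn jr _ kr).
  transitivity (\int[P]_t ((C + dd j * X j0 t ^+ 2) ^+ 2)%:E)%E.
    apply: (ge0_integral_same_law (mX j) (mX j0) _ (sq C)).
      by move=> B mB; rewrite !lawX.
    by move=> x; rewrite lee_fin sqr_ge0.
  rewrite (integral_sq_poly (mX j0) (@lawX j0)) -/e -/v.
  by congr EFin; rewrite /C; ring.
under eq_integral do rewrite EFinD.
have vj : 0 <= v * dd j ^+ 2.
  have [_ h] := mom_bounds (mX j0) (@lawX j0).
  by rewrite mulr_ge0 ?sqr_ge0// /v /e; lra.
rewrite ge0_integralD//; last 2 first.
- by move=> s _; rewrite lee_fin sqr_ge0.
- exact: (measurableT_comp (mpart r (c + dd j * e)) mJ).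
rewrite IH// integral_cst// [X in (_ * X)%E]probability_setT mule1 -EFinD.
by rewrite !big_cons; congr EFin; ring.
Qed.

Let diag_mx_form (th : R) (dd : J -> R) (i j : J) : R :=
  if i == j then th * dd i else 0.

Let qf_diag th dd x : qf (diag_mx_form th dd) x = th * dq dd x.
Proof.
rewrite /qf /dq mulr_sumr; apply: eq_bigr => i _.
rewrite (bigD1 i)//= /diag_mx_form eqxx big1 ?addr0; first by ring.
by move=> j ji; rewrite eq_sym (negbTE ji) !mul0r.
Qed.

Lemma mgf_diag (dd : J -> R) (th W : R) :
  nsq dd + (\sum_j dd j) ^+ 2 <= W -> th ^+ 2 * W <= 256^-1 ->
  (\int[P]_t (expR (th * dq dd (joint X t)))%:E <= (3 / 2)%:E)%E.
Proof.
move=> hW hth.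
have thV : th ^+ 2 * nsq dd <= 256^-1.
  apply: le_trans hth; rewrite ler_wpM2l ?sqr_ge0//.
  by apply: le_trans hW; rewrite lerDl sqr_ge0.
have tht : th ^+ 2 * (\sum_j dd j) ^+ 2 <= 256^-1.
  apply: le_trans hth; rewrite ler_wpM2l ?sqr_ge0//.
  by apply: le_trans hW; rewrite lerDr nsq_ge0.
have ME : (fun i j => 1 * 1 * diag_mx_form th dd i j) = diag_mx_form th dd.
  by apply/funext => i; apply/funext => j; rewrite !mul1r.
have := quad_mgf mX iX (s := fun=> 1) lawX (M := diag_mx_form th dd).
under eq_integral do rewrite qf_diag.
move=> h; apply: (le_trans (h _ _)) => {h}.
- by move=> i j; rewrite /diag_mx_form eq_sym; case: eqP => [->|].
- move=> x; rewrite ME qf_diag /dq mulr_sumr; apply: (le_trans (ler_norm_sum _ _ _)).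
  rewrite mulr_sumr; apply: ler_sum => j _; rewrite mulrA normrM.
  rewrite [X in _ * X]ger0_norm ?sqr_ge0// ler_wpM2r ?sqr_ge0//.
  rewrite -(@ler_pXn2r _ 2)// ?nnegrE//.
  rewrite -normrX ger0_norm ?sqr_ge0// exprMn.
  have := ler_wpM2l (sqr_ge0 th) (coord_le_nsq dd j); lra.
rewrite lee_fin ME.
have -> : mxtr (diag_mx_form th dd) = th * \sum_j dd j.
  by rewrite /mxtr mulr_sumr; apply: eq_bigr => j _; rewrite /diag_mx_form eqxx.
have -> : frob2 (diag_mx_form th dd) = th ^+ 2 * nsq dd.
  rewrite /frob2 /nsq mulr_sumr; apply: eq_bigr => i _.
  rewrite (bigD1 i)//= /diag_mx_form eqxx exprMn big1 ?addr0// => j ji.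
  by rewrite eq_sym (negbTE ji) expr0n.
have t1 : th * (\sum_j dd j) <= 16^-1.
  rewrite -exprMn in tht; nra.
have x1 : th * (\sum_j dd j) + 4 * (th ^+ 2 * nsq dd) <= 1 / 4 by lra.
set x := _ + _ in x1 *.
have := expR_ge1Dx (- x); rewrite expRN => h.
have e0 := expR_gt0 x.
have : (1 - x) * expR x <= 1 by rewrite -ler_pdivlMr// div1r.
nra.
Qed.

(** From [y ^+ 4 <= 24 (exp y + exp (- y))], at the largest multiple [y] of the
    form to which [mgf_diag] applies. *)
Lemma fourth_moment_diag (dd : J -> R) (W : R) : 0 < W ->
  nsq dd + (\sum_j dd j) ^+ 2 <= W ->
  (\int[P]_t (dq dd (joint X t) ^+ 4)%:E <= (10 ^+ 7 * W ^+ 2)%:E)%E.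
Proof.
move=> W0 hW; pose th : R := (16 * Num.sqrt W)^-1.
have sW : 0 < Num.sqrt W by rewrite sqrtr_gt0.
have th2 : th ^+ 2 * W = 256^-1.
  by rewrite -(sqr_sqrtr (ltW W0)) /th; field; rewrite gt_eqF.
have m1 := mgf_diag hW (th := th) ltac:(by rewrite th2).
have m2 := mgf_diag hW (th := - th) ltac:(by rewrite sqrrN th2).
have mE a : measurable_fun setT (fun t => (expR (a * dq dd (joint X t)))%:E).
  apply/measurable_EFinP/measurableT_comp => //; apply: measurable_funM => //.
  exact: (measurableT_comp (measurable_dq dd) mJ).
pose k : R := 24 * 256 ^+ 2 * W ^+ 2.
have k0 : 0 <= k by rewrite /k; have := sqr_ge0 W; lra.
apply: (@le_trans _ _ (\int[P]_t (k%:E * ((expR (th * dq dd (joint X t)))%:E +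
   (expR (- th * dq dd (joint X t)))%:E)))%E).
  apply: ge0_le_integral => //.
  - by move=> t _; rewrite lee_fin (exprM _ 2 2) sqr_ge0.
  - apply/measurable_EFinP; apply: measurable_funX.
    exact: (measurableT_comp (measurable_dq dd) mJ).
  - by apply: emeasurable_funM => //; exact: emeasurable_funD.
  - move=> t _; rewrite -EFinD -EFinM lee_fin; set z := dq dd _.
    have -> : z ^+ 4 = 256 ^+ 2 * W ^+ 2 * (th * z) ^+ 4.
      rewrite exprMn (_ : th ^+ 4 = (th ^+ 2) ^+ 2); last by ring.
      have -> : th ^+ 2 = 256^-1 / W by rewrite -th2 mulfK// gt_eqF.
      by field; rewrite gt_eqF.
    set y := th * z; rewrite mulNr -/y.
    have h : y ^+ 4 <= 24 * (expR y + expR (- y)).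
      have e1 := expR_ge0 y; have e2 := expR_ge0 (- y).
      have [y0|y0] := leP 0 y.
        have := expR_ge1Dxn 3 y0; rewrite (_ : (4`!)%:R = 24 :> R)//; lra.
      have y0' : 0 <= - y by lra.
      have := expR_ge1Dxn 3 y0'; rewrite (_ : (4`!)%:R = 24 :> R)//.
      have -> : (- y) ^+ 4 = y ^+ 4 by ring.
      lra.
    have W2 := sqr_ge0 W; rewrite /k.
    have -> : 24 * 256 ^+ 2 * W ^+ 2 * (expR y + expR (- y)) =
      256 ^+ 2 * W ^+ 2 * (24 * (expR y + expR (- y))) by ring.
    by apply: ler_wpM2l => //; lra.
rewrite ge0_integralZl_EFin//; last 2 first.
- by move=> t _; rewrite -EFinD lee_fin addr_ge0 ?expR_ge0.
- exact: emeasurable_funD.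
rewrite ge0_integralD//.
apply: (le_trans (lee_wpmul2l _ (leeD m1 m2))); first by rewrite lee_fin.
rewrite -EFinD -EFinM lee_fin /k; have := sqr_ge0 W; lra.
Qed.

(** Second order expansion of the exponential, by the second and fourth moments
    of the form; the smallness hypothesis makes the quadratic term negligible. *)
Lemma diag_energy (dd : J -> R) (s : R) : 0 <= s ->
  10 ^+ 9 * (s * (#|J|%:R + 1) * nsq dd) <= 1 ->
  (\int[P]_t (expR (- (s * dq dd (joint X t) ^+ 2)))%:E <=
   (expR (- (s * nsq dd / 16)))%:E)%E.
Proof.
move=> s0 hs.
pose W := nsq dd + (\sum_j dd j) ^+ 2.
have V0 := nsq_ge0 dd.
have WV : W <= (#|J|%:R + 1) * nsq dd.
  rewrite /W mulrDl mul1r addrC lerD2r.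
  have := cauchy_schwarz (fun=> 1) dd.
  rewrite (eq_bigr dd) => [|j _]; last by rewrite mul1r.
  have -> // : nsq (fun _ : J => 1 : R) = #|J|%:R.
  by rewrite /nsq -sum1_card natr_sum; apply: eq_bigr => j _; rewrite expr1n.
have mE : measurable_fun setT (fun t => (expR (- (s * dq dd (joint X t) ^+ 2)))%:E).
  apply/measurable_EFinP/measurableT_comp => //; apply: measurableT_comp => //.
  apply: measurable_funM => //; apply: measurable_funX.
  exact: (measurableT_comp (measurable_dq dd) mJ).
have [V00|Vn0] := eqVneq (nsq dd) 0.
  rewrite V00 mulr0 mul0r oppr0 expR0.
  apply: (@le_trans _ _ (\int[P]_t 1%:E)%E); last first.
    by rewrite integral_cst// mul1e [X in (X <= _)%E]probability_setT.
  apply: ge0_le_integral => // t _; rewrite lee_fin -expR0 ler_expR oppr_le0.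
  by rewrite mulr_ge0// sqr_ge0.
have Vp : 0 < nsq dd by rewrite lt_def Vn0.
have W0 : 0 < W by rewrite /W; have := sqr_ge0 (\sum_j dd j); lra.
have [j0 _] : exists j0 : J, true.
  apply/existsP; rewrite -[X in is_true X]negbK; apply/negP => /existsPn J0.
  by move: Vn0; rewrite /nsq big1 ?eqxx// => j; have := J0 j.
have [e1 v1] := mom_bounds (mX j0) (@lawX j0).
have m4 := fourth_moment_diag W0 (lexx W).
have := second_moment_diag j0 dd 0; rewrite add0r.
set M2 := _ + _ => m2.
have M2W : 1 / 10 * W <= M2.
  rewrite /M2 exprMn /W.
  have e2 : 1 / 10 <= mom P (X j0) 1 ^+ 2.
    by move: e1; set e := mom _ _ _ => e1; nra.
  have h1 := ler_wpM2r (sqr_ge0 (\sum_j dd j)) e2.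
  have h2 := ler_wpM2r V0 v1.
  by rewrite mulrDr addrC lerD.
have mD2 : measurable_fun setT (fun t => (s * dq dd (joint X t) ^+ 2)%:E).
  apply/measurable_EFinP/measurable_funM => //; apply: measurable_funX.
  exact: (measurableT_comp (measurable_dq dd) mJ).
have mD4 : measurable_fun setT (fun t => (dq dd (joint X t) ^+ 4)%:E).
  apply/measurable_EFinP; apply: measurable_funX.
  exact: (measurableT_comp (measurable_dq dd) mJ).
have key : (\int[P]_t (expR (- (s * dq dd (joint X t) ^+ 2)))%:E +
    (s * M2)%:E <= (1 + s ^+ 2 * (10 ^+ 7 * W ^+ 2))%:E)%E.
  have -> : ((s * M2)%:E = \int[P]_t (s * dq dd (joint X t) ^+ 2)%:E)%E.
    under eq_integral do rewrite EFinM.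
    rewrite ge0_integralZl_EFin//.
    - by under eq_integral do rewrite -[dq _ _]add0r; rewrite m2 EFinM.
    - by move=> t _; rewrite lee_fin sqr_ge0.
    - apply/measurable_EFinP; apply: measurable_funX.
      exact: (measurableT_comp (measurable_dq dd) mJ).
  rewrite -ge0_integralD//; last by move=> t _; rewrite lee_fin mulr_ge0// sqr_ge0.
  have s2 : 0 <= s ^+ 2 := sqr_ge0 s.
  apply: (@le_trans _ _ (\int[P]_t (1 + (s ^+ 2)%:E *
      (dq dd (joint X t) ^+ 4)%:E))%E).
    apply: ge0_le_integral => //.
    - move=> t _; rewrite -EFinD lee_fin addr_ge0 ?expR_ge0//.
      by rewrite mulr_ge0// sqr_ge0.
    - exact: emeasurable_funD.
    - by apply: emeasurable_funD => //; exact: emeasurable_funM.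
    - move=> t _; rewrite -EFinM -!EFinD lee_fin; set z := dq dd _.
      have y0 : 0 <= s * z ^+ 2 by rewrite mulr_ge0// sqr_ge0.
      set y := s * z ^+ 2 in y0 *.
      have -> : s ^+ 2 * z ^+ 4 = y ^+ 2 by rewrite /y; ring.
      suff : expR (- y) <= 1 - y + y ^+ 2 by lra.
      rewrite expRN -[leLHS]div1r ler_pdivrMr ?expR_gt0//.
      have p0 : 0 <= 1 - y + y ^+ 2 by have := sqr_ge0 (y - 1); nra.
      apply: le_trans (ler_wpM2l p0 (expR_ge1Dx y)).
      have -> : (1 - y + y ^+ 2) * (1 + y) = 1 + y ^+ 3 by ring.
      by rewrite lerDl exprn_ge0.
  rewrite ge0_integralD//; last 2 first.
  - by move=> t _; rewrite mule_ge0// lee_fin (exprM _ 2 2) sqr_ge0.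
  - by apply: emeasurable_funM.
  rewrite integral_cst// mul1e [X in (X + _ <= _)%E]probability_setT EFinD leeD2l//.
  rewrite ge0_integralZl_EFin//; last first.
    by move=> t _; rewrite lee_fin (exprM _ 2 2) sqr_ge0.
  by rewrite (EFinM (s ^+ 2) (10 ^+ 7 * _)) lee_wpmul2l.
have : (\int[P]_t (expR (- (s * dq dd (joint X t) ^+ 2)))%:E <=
    (1 + s ^+ 2 * (10 ^+ 7 * W ^+ 2) - s * M2)%:E)%E.
  by rewrite EFinB leeBrDr.
move=> /le_trans; apply; rewrite lee_fin.
apply: le_trans (expR_ge1Dx _).
have sW : s * W <= 10 ^- 9.
  have : s * W <= s * (#|J|%:R + 1) * nsq dd by rewrite -mulrA ler_wpM2l.
  have -> : 10 ^- 9 = (10 ^+ 9)^-1 :> R by [].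
  by move=> h; rewrite -[leRHS]mul1r ler_pdivlMr ?exprn_gt0// mulrC; nra.
have sW0 : 0 <= s * W by rewrite mulr_ge0// ltW.
have sV : s * nsq dd <= s * W.
  by rewrite ler_wpM2l// /W lerDl sqr_ge0.
have sM : s * (1 / 10 * W) <= s * M2 by rewrite ler_wpM2l.
have -> : s ^+ 2 * (10 ^+ 7 * W ^+ 2) = 10 ^+ 7 * (s * W) * (s * W) by ring.
have : 10 ^+ 7 * (s * W) * (s * W) <= 10 ^+ 7 * 10 ^- 9 * (s * W).
  by rewrite ler_wpM2r// ler_wpM2l.
have -> : 10 ^+ 7 * 10 ^- 9 = 100^-1 :> R by field.
lra.
Qed.

End diagonal_form.

Section lower_tail_combined.
Context d (T : measurableType d) (R : realType) (P : probability T R).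
Context (B I J : finType) (X : (B * I) * J -> T -> R).
Hypothesis mX : forall k, measurable_fun setT (X k).
Hypothesis iX : box_indep P X.
Hypothesis lawX : forall k A, measurable A ->
  P (X k @^-1` A) = centered_normal 1 A.

Lemma lower_tail_one (dd : J -> R) (s : R) :
  #|I| = 1 -> 0 <= s -> 10 ^+ 9 * (s * (#|J|%:R + 1) * nsq dd) <= 1 ->
  (\int[P]_t (expR (- (s * \sum_l frob2 (sandwich dd (mxblk (joint X t) l)))))%:E <=
   (expR (- (s * #|B|%:R * nsq dd / 16)))%:E)%E.
Proof.
move=> I1 s0 hs.
have [i0 Ii0] : exists i0 : I, forall i, i = i0.
  move: (mem_card1 I1) => [i0 hi0]; exists i0 => i; apply/eqP.
  by have := hi0 i; rewrite !inE => <-.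
have sumI (F : I -> R) : \sum_i F i = F i0.
  by rewrite (bigD1 i0)//= big1 ?addr0// => i; rewrite (Ii0 i) eqxx.
pose f (b : B * I) (x : vec R J) :=
  expR (- (s * (\sum_j dd j * x j ^+ 2) ^+ 2)).
have e1 t : expR (- (s * \sum_l frob2 (sandwich dd (mxblk (joint X t) l)))) =
    \prod_b f b (block b (joint X t)).
  rewrite -expR_sum mulr_sumr -sumrN sum_pairE/=; congr expR.
  apply: eq_bigr => l _; rewrite sumI /frob2 !sumI; congr (- (s * _)).
  by congr (_ ^+ 2); apply: eq_bigr => j _; rewrite /block /mxblk -mulrA expr2.
under eq_integral do rewrite e1.
have := integral_prod_blocks mX iX (f := f) (c := fun=> expR (- (s * nsq dd / 16))).
rewrite prodr_const -expRM_natl card_prod I1 muln1.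
have -> : #|B|%:R * - (s * nsq dd / 16) = - (s * #|B|%:R * nsq dd / 16) by ring.
apply.
- move=> b; apply: measurableT_comp => //; apply: measurableT_comp => //.
  apply: measurable_funM => //; apply: measurable_funX; apply: measurable_sum => j.
  by apply: measurable_funM => //; apply: measurable_funX; exact: measurable_coord.
- by move=> b x; exact: expR_ge0.
move=> b.
have iXb : box_indep P (fun j => X (b, j)).
  by apply: (box_indep_sub (h := fun j => (b, j))) => // j j' [].
exact: (diag_energy (X := fun j => X (b, j)) (fun j => mX (b, j)) iXb
  (fun j => @lawX (b, j)) s0 hs).
Qed.

(** With two rows or more the bound comes from the products of distinct rows,
    and needs the operator norms; with one row, from the moments of diagonal
    forms. *)
Lemma lower_tail (dd : J -> R) (s kappa : R)
    (good : vec R ((B * I) * J)%type -> bool) :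
  (0 < #|I|)%N -> 0 <= s -> #|I|%:R + #|J|%:R <= kappa ->
  10 ^+ 9 * (s * kappa * nsq dd) <= 1 ->
  measurable_fun setT good ->
  (forall x, good x -> forall l, opb kappa (mxblk x l)) ->
  (\int[P]_t ((good (joint X t))%:R *
      expR (- (s * \sum_l frob2 (sandwich dd (mxblk (joint X t) l)))))%:E <=
   (expR (- (s * #|B|%:R * #|I|%:R ^+ 2 * nsq dd / 16)))%:E)%E.
Proof.
move=> I0 s0 hk hs mgood hgood.
have d0 := nsq_ge0 dd; have J0 : (0 : R) <= #|J|%:R by exact: ler0n.
have k0 : 0 <= kappa by apply: le_trans hk; rewrite addr_ge0.
have skd : 0 <= s * kappa * nsq dd by rewrite !mulr_ge0.
have [I1|I1] := ltnP 1 #|I|.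
  apply: (lower_tail_many mX iX lawX (kappa := kappa)) => //; first by lra.
  have h : 32 <= 10 ^+ 9 :> R by rewrite -natrX ler_nat.
  by apply: le_trans hs; rewrite ler_wpM2r.
have {}I1 : #|I| = 1 by apply/eqP; rewrite eqn_leq I1.
rewrite I1 expr1n mulr1.
apply: (@le_trans _ _ (\int[P]_t (expR (- (s * \sum_l frob2
    (sandwich dd (mxblk (joint X t) l)))))%:E)%E).
  have mJ := measurable_joint mX.
  have mE : measurable_fun setT (fun t => expR (- (s * \sum_l frob2
      (sandwich dd (mxblk (joint X t) l))))).
    apply: measurableT_comp => //; apply: measurableT_comp => //.
    apply: measurable_funM => //; apply: measurable_sum => l.
    exact: (measurableT_comp (measurable_frob2_sandwich dd l) mJ).
  apply: ge0_le_integral => //.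
  - apply/measurable_EFinP/measurable_funM => //; apply: measurable_fun_natr.
    exact: (measurableT_comp mgood mJ).
  - exact/measurable_EFinP.
  - move=> t _; rewrite lee_fin; case: (good _); first by rewrite mul1r.
    by rewrite mul0r expR_ge0.
apply: lower_tail_one => //; apply: le_trans hs.
rewrite ler_wpM2l ?exprn_ge0//; apply: ler_wpM2r => //; apply: ler_wpM2l => //.
by move: hk; rewrite I1; lra.
Qed.

End lower_tail_combined.

(** * Comparing two candidates *)

Section compare.
Context d (T : measurableType d) (R : realType) (P : probability T R).
Variables (m n L : nat) (sigmaz : R).
Variables (X : entry_index m n L -> T -> R).
Hypothesis mX : forall k, measurable_fun setT (X k).
Hypothesis iX : box_indep P X.
Hypothesis lawX : forall k B, measurable B ->
  P (X k @^-1` B) = centered_normal (entry_std sigmaz k) B.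

Local Notation sensed := (vec R (('I_L * 'I_m) * 'I_n)%type).
Local Notation sample := (vec R (entry_index m n L)).

Definition sensing_part (x : entry_index m n L -> R) : sensed := fun k => x (inl k).

Definition obs (xo : 'I_n -> R) (x : entry_index m n L -> R) (l : 'I_L) (i : 'I_m) : R :=
  \sum_j mxblk (sensing_part x) l i j * xo j * x (inr (l, inl j)) + x (inr (l, inr i)).

(* The inner product of B with the conditional covariance of the observation. *)
Definition cov_trace (B : 'I_m -> 'I_m -> R) (xo : 'I_n -> R)
    (a : 'I_m -> 'I_n -> R) : R :=
  \sum_i \sum_i' B i i' *
    (sandwich (fun j => xo j ^+ 2) a i i' + sigmaz ^+ 2 * (i == i')%:R).

Section conditional.
Variables (a : 'I_L -> 'I_m -> 'I_n -> R) (xo dd : 'I_n -> R) (kappa xm dm lam : R).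
Hypotheses (kappa0 : 0 < kappa) (xm0 : 0 < xm) (dm0 : 0 <= dm) (lam0 : 0 <= lam).
Hypothesis ba : forall l, opb kappa (a l).
Hypothesis bxo : forall j, xo j ^+ 2 <= xm.
Hypothesis bdd : forall j, `|dd j| <= dm.

Let c : R := xm * kappa + sigmaz ^+ 2.

Let c0 : 0 < c.
Proof. by rewrite /c; have := mulr_gt0 xm0 kappa0; have := sqr_ge0 sigmaz; lra. Qed.

Let y (l : 'I_L) (g : 'I_n + 'I_m -> R) (i : 'I_m) : R :=
  \sum_j a l i j * xo j * g (inl j) + g (inr i).

Let std (q : 'I_n + 'I_m) : R := if q is inl _ then 1 else sigmaz.

(* The observation is a linear image of the noises; its standardized matrix. *)
Let lin (l : 'I_L) (i : 'I_m) (q : 'I_n + 'I_m) : R :=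
  match q with inl j => a l i j * xo j | inr i' => (i == i')%:R end.
Let slin l i q : R := lin l i q * std q.

Let sum_delta (i : 'I_m) (f : 'I_m -> R) : \sum_i' (i == i')%:R * f i' = f i.
Proof.
rewrite (bigD1 i)//= eqxx mul1r big1 ?addr0// => i' /negbTE ii'.
by rewrite eq_sym ii' mul0r.
Qed.

Let yE l g i : y l g i = \sum_q lin l i q * g q.
Proof. by rewrite big_sumType/= sum_delta. Qed.

Let opb_slin l : opb c (slin l).
Proof.
move=> v; rewrite /nsq big_sumType/= /c mulrDl; apply: lerD.
  apply: (le_trans (y := \sum_j xm * (\sum_i a l i j * v i) ^+ 2)).
    apply: ler_sum => j _; rewrite /slin /=.
    have -> : \sum_i a l i j * xo j * 1 * v i = xo j * \sum_i a l i j * v i.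
      by rewrite mulr_sumr; apply: eq_bigr => i _; ring.
    by rewrite exprMn ler_wpM2r ?sqr_ge0.
  rewrite -mulr_sumr -mulrA; apply: ler_wpM2l; first exact: ltW.
  exact: ba.
rewrite mulr_sumr; apply: ler_sum => i' _; rewrite -exprMn le_eqVlt; apply/orP; left.
apply/eqP; congr (_ ^+ 2); rewrite /slin/=.
rewrite -(sum_delta i' (fun i => sigmaz * v i)); apply: eq_bigr => i _.
by rewrite eq_sym; ring.
Qed.

Let B l := sandwich dd (a l).

Let bounded_B l : form_bounded (dm * kappa) (B l).
Proof.
move=> v; rewrite qf_sandwich; apply: (le_trans (ler_norm_sum _ _ _)).
apply: (le_trans (y := \sum_j dm * (\sum_i a l i j * v i) ^+ 2)).
  apply: ler_sum => j _; rewrite normrM [X in _ * X]ger0_norm ?sqr_ge0//.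
  by rewrite ler_wpM2r ?sqr_ge0.
by rewrite -mulr_sumr -mulrA ler_wpM2l//; exact: ba.
Qed.

(** Given the sensing matrices, the observations are the images under [lin] of
    the noises, hence the form in the standardized noises is
    [congruent (B l) (slin l)], where the squared operator norm of [slin l] is
    at most [c]. *)
Lemma noise_mgf : 2 * lam * (dm * kappa * c) <= 16^-1 ->
  (\int[P]_t (expR (\sum_l 2 * lam * (qf (B l) (y l (fun q => X (inr (l, q)) t)) -
      cov_trace (B l) xo (a l))))%:E <=
   (expR (\sum_l 16 * lam ^+ 2 * c ^+ 2 * frob2 (B l)))%:E)%E.
Proof.
move=> hlam.
pose M l p q := 2 * lam * congruent (B l) (lin l) p q.
have qM l g : qf (M l) g = 2 * lam * qf (B l) (y l g).
  have -> : qf (B l) (y l g) = qf (congruent (B l) (lin l)) g.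
    by rewrite qf_congruent; congr qf; apply/funext => i; rewrite yE.
  rewrite /qf !mulr_sumr; apply: eq_bigr => p _; rewrite !mulr_sumr.
  by apply: eq_bigr => q _; rewrite /M; ring.
have sM l : (fun p q => std p * std q * M l p q) =
    (fun p q => 2 * lam * congruent (B l) (slin l) p q).
  apply/funext => p; apply/funext => q; rewrite /M mulrCA; congr (_ * _).
  rewrite /congruent mulr_sumr; apply: eq_bigr => i _.
  by rewrite mulr_sumr; apply: eq_bigr => i' _; rewrite /slin; ring.
have lam2 : 0 <= 2 * lam by rewrite mulr_ge0.
have iX' : box_indep P (fun k => X (inr k)).
  by apply: (box_indep_sub (h := inr)) => // k k' [].
have stdE (k : 'I_L * ('I_n + 'I_m)) : entry_std sigmaz (inr k) = std k.2 :> R.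
  by case: k => l [].
have := quad_mgf_blocks (X := fun k => X (inr k)) (s := fun k => std k.2) (M := M)
  (fun k => mX (inr k)) iX' _ _ _.
move=> h; have {h} : (\int[P]_t (expR (\sum_l 2 * lam *
      qf (B l) (y l (fun q => X (inr (l, q)) t))))%:E <=
   (expR (\sum_l (2 * lam * cov_trace (B l) xo (a l) +
       16 * lam ^+ 2 * c ^+ 2 * frob2 (B l))))%:E)%E.
  have e1 t : \sum_l 2 * lam * qf (B l) (y l (fun q => X (inr (l, q)) t)) =
    \sum_l qf (M l) (block l (joint (fun k => X (inr k)) t)).
    by apply: eq_bigr => l _; rewrite qM.
  under eq_integral do rewrite e1.
  apply: (le_trans (h _ _ _)) => {h e1}.
  - by move=> k A mA; rewrite lawX// stdE.
  - move=> l p q; rewrite /M congruent_sym// => i i'; exact: sandwich_sym.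
  - move=> l v; rewrite /= sM.
    have -> : qf (fun p q => 2 * lam * congruent (B l) (slin l) p q) v =
        2 * lam * qf (congruent (B l) (slin l)) v.
      rewrite /qf !mulr_sumr; apply: eq_bigr => p _; rewrite !mulr_sumr.
      by apply: eq_bigr => q _; ring.
    rewrite normrM (ger0_norm lam2).
    have bB0 : 0 <= dm * kappa by rewrite mulr_ge0// ltW.
    have := congruent_bounded bB0 c0 (@bounded_B l) (@opb_slin l) v.
    move=> /(ler_wpM2l lam2)/le_trans; apply; rewrite mulrA.
    by apply: ler_wpM2r => //; exact: nsq_ge0.
  rewrite lee_fin ler_expR; apply: ler_sum => l _; rewrite /= sM; apply: lerD.
    rewrite le_eqVlt; apply/orP; left; apply/eqP.
    transitivity (2 * lam * mxtr (congruent (B l) (slin l))).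
      by rewrite /mxtr mulr_sumr.
    rewrite mxtr_congruent; congr (_ * _); apply: eq_bigr => i _.
    apply: eq_bigr => i' _; congr (_ * _); rewrite big_sumType/=; congr (_ + _).
      by apply: eq_bigr => j _; rewrite /slin/=; ring.
    rewrite eq_sym -(sum_delta i (fun k => sigmaz ^+ 2 * (i' == k)%:R)).
    by apply: eq_bigr => k _; rewrite /slin/=; ring.
  have -> : frob2 (fun p q => 2 * lam * congruent (B l) (slin l) p q) =
      4 * lam ^+ 2 * frob2 (congruent (B l) (slin l)).
    rewrite /frob2 mulr_sumr; apply: eq_bigr => p _; rewrite mulr_sumr.
    by apply: eq_bigr => q _; ring.
  have := frob2_congruent_le (B l) c0 (@opb_slin l).
  have l2 : 0 <= 16 * lam ^+ 2 by rewrite mulr_ge0// sqr_ge0.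
  move=> /(ler_wpM2l l2); lra.
move=> h.
pose k := \sum_l 2 * lam * cov_trace (B l) xo (a l).
have e2 t : expR (\sum_l 2 * lam * (qf (B l) (y l (fun q => X (inr (l, q)) t)) -
      cov_trace (B l) xo (a l))) =
    expR (- k) * expR (\sum_l 2 * lam * qf (B l) (y l (fun q => X (inr (l, q)) t))).
  by rewrite -expRD; congr expR; rewrite addrC /k -sumrB; apply: eq_bigr => l _; ring.
under eq_integral do rewrite e2 EFinM.
have my l i : measurable_fun setT (fun t => y l (fun q => X (inr (l, q)) t) i).
  apply: measurable_funD => //; apply: measurable_sum => j.
  exact: measurable_funM.
rewrite ge0_integralZl_EFin//; last first.
  apply/measurable_EFinP/measurableT_comp => //; apply: measurable_sum => l.
  apply: measurable_funM => //; apply: measurable_sum => i; apply: measurable_sum => i'.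
  by apply: measurable_funM => //; exact: measurable_funM.
apply: (le_trans (lee_wpmul2l _ h)); first by rewrite lee_fin expR_ge0.
by rewrite -EFinM -expRD lee_fin ler_expR big_split/= -/k; lra.
Qed.

End conditional.

Section contrast.
Variables (a : 'I_L -> 'I_m -> 'I_n -> R) (y : 'I_L -> 'I_m -> R).

Definition signal_cov (x : 'I_n -> R) (l : 'I_L) : 'I_m -> 'I_m -> R :=
  sandwich (fun j => x j ^+ 2) (a l).

(** Up to a term independent of [x], the sum over [l] of the squared Frobenius
    distances between [y_l y_l^T] and the covariance of [y_l] under [x]. *)
Definition contrast (x : 'I_n -> R) : R := \sum_l
  (frob2 (signal_cov x l) - 2 * qf (signal_cov x l) (y l) +
   2 * sigmaz ^+ 2 * mxtr (signal_cov x l)).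

Definition signal_gap (x1 x0 : 'I_n -> R) (l : 'I_L) : 'I_m -> 'I_m -> R :=
  sandwich (fun j => x1 j ^+ 2 - x0 j ^+ 2) (a l).

(** Both covariances are compared with that of the truth [xo]. The cross term
    between the two gaps is absorbed by a square, at the price of a quarter of
    the energy of the first. *)
Lemma contrast_diff_le (x1 x0 xo : 'I_n -> R) :
  contrast x0 - contrast x1 <=
  \sum_l (2 * (qf (signal_gap x1 x0 l) (y l) -
      cov_trace (signal_gap x1 x0 l) xo (a l)) -
    3 / 4 * frob2 (signal_gap x1 x0 l) + 4 * frob2 (signal_gap x0 xo l)).
Proof.
rewrite /contrast -sumrB; apply: ler_sum => l _.
have trE (M : 'I_m -> 'I_m -> R) : mxtr M = \sum_i \sum_i' M i i' * (i == i')%:R.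
  apply: eq_bigr => i _; rewrite (bigD1 i)//= eqxx mulr1 big1 ?addr0// => i' ii'.
  by rewrite eq_sym (negbTE ii') mulr0.
pose DS (f : 'I_m -> 'I_m -> R) := \sum_i \sum_i' f i i'.
have DSZ k f : k * DS f = DS (fun i i' => k * f i i').
  by rewrite mulr_sumr; apply: eq_bigr => i _; rewrite mulr_sumr.
have DSD f g : DS f + DS g = DS (fun i i' => f i i' + g i i').
  by rewrite -big_split; apply: eq_bigr => i _; rewrite -big_split.
have DSN f : - DS f = DS (fun i i' => - f i i').
  by rewrite -sumrN; apply: eq_bigr => i _; rewrite -sumrN.
have frE M : frob2 M = DS (fun i i' => M i i' ^+ 2) by [].
have qfE M v : qf M v = DS (fun i i' => M i i' * v i * v i') by [].
have ctE M e b : cov_trace M e b = DS (fun i i' => M i i' *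
  (sandwich (fun j => e j ^+ 2) b i i' + sigmaz ^+ 2 * (i == i')%:R)) by [].
have {}trE M : mxtr M = DS (fun i i' => M i i' * (i == i')%:R) by exact: trE.
rewrite !(trE, frE, qfE, ctE) !(DSZ, DSN, DSD) /DS.
apply: ler_sum => i _; apply: ler_sum => i' _.
rewrite /signal_gap !sandwichB -/(signal_cov x1 l i i') -/(signal_cov x0 l i i').
rewrite -/(signal_cov xo l i i').
move: (signal_cov x1 l i i') (signal_cov x0 l i i') (signal_cov xo l i i').
move=> s1 s0 so; rewrite -subr_ge0.
have := sqr_ge0 ((s1 - s0) / 2 + 2 * (s0 - so)).
set de := (i == i')%:R; set u := y l i; set v := y l i'.
move=> h; apply: le_trans h _; rewrite le_eqVlt; apply/orP; left; apply/eqP.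
by field.
Qed.

End contrast.

Section pairwise.
Variables (xo x0 x1 : 'I_n -> R) (kappa xm lam : R).
Variable good : sensed -> bool.
Hypothesis mgood : measurable_fun setT good.
Hypothesis good_opb : forall a, good a -> forall l, opb kappa (mxblk a l).
Hypotheses (m0 : (0 < m)%N) (hk : m%:R + n%:R <= kappa).
Hypotheses (lam0 : 0 <= lam) (xm0 : 0 < xm).
Hypotheses (bxo : forall j, xo j ^+ 2 <= xm) (bx0 : forall j, x0 j ^+ 2 <= xm)
  (bx1 : forall j, x1 j ^+ 2 <= xm).
Let c : R := xm * kappa + sigmaz ^+ 2.
Let gap j := x1 j ^+ 2 - x0 j ^+ 2.
Hypothesis hlam : 64 * (lam * c ^+ 2) <= 1.
Hypothesis hgap : 10 ^+ 9 * (lam / 2 * kappa * nsq gap) <= 1.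

Definition sample_contrast (x : entry_index m n L -> R) (cand : 'I_n -> R) : R :=
  contrast (fun l => mxblk (sensing_part x) l) (obs xo x) cand.

Let measurable_a l i j :
  measurable_fun setT (fun x : sample => mxblk (sensing_part x) l i j).
Proof. exact: (measurable_coord (inl ((l, i), j))). Qed.

Let measurable_obs l i : measurable_fun setT (fun x : sample => obs xo x l i).
Proof.
apply: measurable_funD; last exact: (measurable_coord (inr (l, inr i))).
apply: measurable_sum => j; apply: measurable_funM.
  by apply: measurable_funM => //; exact: measurable_a.
exact: (measurable_coord (inr (l, inl j))).
Qed.

Lemma measurable_sample_contrast cand :
  measurable_fun setT (fun x : sample => sample_contrast x cand).
Proof.
have mS l i i' : measurable_fun setT (fun x : sample =>
    signal_cov (fun l => mxblk (sensing_part x) l) cand l i i').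
  apply: measurable_sum => j; apply: measurable_funM; last exact: measurable_a.
  by apply: measurable_funM => //; exact: measurable_a.
apply: measurable_sum => l; apply: measurable_funD.
  apply: measurable_funB.
    by do 2![apply: measurable_sum => ?]; exact: measurable_funX.
  apply: measurable_funM => //; do 2![apply: measurable_sum => ?].
  apply: measurable_funM; last exact: measurable_obs.
  by apply: measurable_funM => //; exact: measurable_obs.
by apply: measurable_funM => //; exact: measurable_sum.
Qed.

Let measurable_sensing : measurable_fun setT (fun x : sample => sensing_part x : sensed).
Proof. by apply: measurable_vec => k; exact: (measurable_coord (inl k)). Qed.

Let kappa0 : 0 < kappa.
Proof. by apply: lt_le_trans hk; rewrite ltr_wpDr// ltr0n. Qed.

Let gap_le j : `|gap j| <= xm.
Proof.
rewrite ler_norml /gap; have := bx0 j; have := bx1 j.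
by have := sqr_ge0 (x0 j); have := sqr_ge0 (x1 j); lra.
Qed.

(** Chernoff's bound for the event that [x1] fits the data better than [x0]
    when the truth is [xo]: the noise is integrated for fixed sensing matrices
    by [noise_mgf], the sensing matrices by [lower_tail]. *)
Lemma pairwise_bound :
  (\int[P]_t ((good (sensing_part (joint X t)))%:R *
     (sample_contrast (joint X t) x1 <= sample_contrast (joint X t) x0)%R%:R)%:E <=
   (expR (4 * lam * L%:R * kappa ^+ 2 * nsq (fun j => x0 j ^+ 2 - xo j ^+ 2) -
      lam * L%:R * m%:R ^+ 2 * nsq gap / 32))%:E)%E.
Proof.
pose drift : R := 4 * lam * L%:R * kappa ^+ 2 * nsq (fun j => x0 j ^+ 2 - xo j ^+ 2).
pose F (x : sample) := ((good (sensing_part x))%:R *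
  expR (lam * (sample_contrast x x0 - sample_contrast x x1)))%:E.
have F0 x : (0 <= F x)%E by rewrite lee_fin mulr_ge0 ?expR_ge0.
have mgoodS := measurableT_comp mgood measurable_sensing.
have mF : measurable_fun setT F.
  apply/measurable_EFinP/measurable_funM; first exact: measurable_fun_natr.
  apply: measurableT_comp => //; apply: measurable_funM => //.
  by apply: measurable_funB; exact: measurable_sample_contrast.
have mJ := measurable_joint mX.
apply: (@le_trans _ _ (\int[P]_t F (joint X t))%E).
  apply: ge0_le_integral => //.
  - apply/measurable_EFinP/measurable_funM.
      by apply: measurable_fun_natr; exact: (measurableT_comp mgoodS mJ).
    apply: measurable_fun_natr; apply: measurable_fun_ler;
      exact: (measurableT_comp (measurable_sample_contrast _) mJ).
  - exact: (measurableT_comp mF mJ).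
  - move=> t _; rewrite lee_fin; apply: ler_wpM2l => //.
    have [h|h] := leP (sample_contrast (joint X t) x1); last first.
      by rewrite mulr0n expR_ge0.
    by rewrite mulr1n -[leLHS]expR0 ler_expR mulr_ge0// subr_ge0.
pose S := [pred k : entry_index m n L | if k is inl _ then true else false].
rewrite (integral_mix mX iX S mF F0).
pose Y k := X (inl k).
have mY k : measurable_fun setT (Y k) by exact: mX.
have iY : box_indep P Y by apply: (box_indep_sub (h := inl)) => // k k' [].
have lawY k A : measurable A -> P (Y k @^-1` A) = centered_normal 1 A.
  by move=> mA; rewrite lawX//; case: k => [[]].
pose H (a : sensed) := ((good a)%:R *
  expR (- (lam / 2 * \sum_l frob2 (sandwich gap (mxblk a l)))))%:E.
have mH : measurable_fun setT H.
  apply/measurable_EFinP/measurable_funM; first exact: measurable_fun_natr.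
  apply: measurableT_comp => //; apply: measurableT_comp => //.
  apply: measurable_funM => //; apply: measurable_sum => l.
  exact: measurable_frob2_sandwich.
have mJY := measurable_joint mY.
apply: (@le_trans _ _ (\int[P]_s ((expR drift)%:E * H (joint Y s)))%E).
  apply: ge0_le_integral => //.
  - move=> s _; apply: integral_ge0 => t _; exact: F0.
  - pose G (ts : T * T) := F (mix S (joint X ts.1) (joint X ts.2)).
    have mG : measurable_fun setT G.
      apply: (measurableT_comp mF).
      apply: (measurableT_comp (measurable_mix S)
        (g := fun ts : T * T => (joint X ts.1, joint X ts.2))).
      apply: measurable_fun_pair.
        exact: (measurableT_comp mJ measurable_fst).
      exact: (measurableT_comp mJ measurable_snd).
    by apply: (measurable_fun_fubini_tonelli_F G) => // ts; exact: F0.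
  - apply: emeasurable_funM => //; exact: (measurableT_comp mH mJY).
  - move=> s _; set a0 := joint Y s.
    have sensE t : sensing_part (mix S (joint X s) (joint X t)) = a0 by [].
    have [ga|ga] := boolP (good a0); last first.
      rewrite integral0_eq; last by move=> t _; rewrite /F sensE (negbTE ga) mul0r.
      by rewrite mule_ge0// lee_fin ?expR_ge0// mulr_ge0 ?expR_ge0.
    pose a l := mxblk a0 l.
    have ba l : opb kappa (a l) by exact: good_opb.
    pose y t l i := \sum_j a l i j * xo j * X (inr (l, inl j)) t + X (inr (l, inr i)) t.
    pose B l := sandwich gap (a l).
    pose b : R := \sum_l (4 * lam * (kappa ^+ 2 * nsq (fun j => x0 j ^+ 2 - xo j ^+ 2)) -
      3 / 4 * lam * frob2 (B l)).
    pose V t := \sum_l 2 * lam * (qf (B l) (y t l) - cov_trace (B l) xo (a l)).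
    have mV : measurable_fun setT (fun t => (expR (V t))%:E).
      have my l i : measurable_fun setT (fun t => y t l i).
        apply: measurable_funD => //; apply: measurable_sum => j.
        exact: measurable_funM.
      apply/measurable_EFinP/measurableT_comp => //; apply: measurable_sum => l.
      apply: measurable_funM => //; apply: measurable_funB => //.
      do 2![apply: measurable_sum => ?].
      by apply: measurable_funM => //; exact: measurable_funM.
    apply: (@le_trans _ _ (\int[P]_t ((expR b)%:E * (expR (V t))%:E))%E).
      apply: ge0_le_integral => //.
      + have := measurable_fun_pair2 (joint X s) (measurable_mix S).
        move=> mm; exact: (measurableT_comp mF (measurableT_comp mm mJ)).
      + by apply: emeasurable_funM.
      + move=> t _; rewrite /F sensE ga mul1r -EFinM -expRD lee_fin ler_expR.
        have -> : sample_contrast (mix S (joint X s) (joint X t)) x0 -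
            sample_contrast (mix S (joint X s) (joint X t)) x1 =
            contrast a (y t) x0 - contrast a (y t) x1 by [].
        apply: (le_trans (ler_wpM2l lam0 (contrast_diff_le a (y t) x1 x0 xo))).
        rewrite mulr_sumr /b /V -big_split/=; apply: ler_sum => l _.
        rewrite -/(B l).
        have := frob2_sandwich_le (fun j => x0 j ^+ 2 - xo j ^+ 2) kappa0 (ba l).
        rewrite -/(signal_gap a x0 xo l) => /(ler_wpM2l lam0).
        rewrite /signal_gap -/(B l); lra.
    rewrite ge0_integralZl_EFin//.
    have cx : xm * kappa * c <= c ^+ 2.
      rewrite expr2 ler_wpM2r//; last by rewrite /c lerDl sqr_ge0.
      by rewrite /c addr_ge0 ?sqr_ge0// mulr_ge0// ltW.
    have cx' := ler_wpM2l lam0 cx.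
    have cx2 : 2 * lam * (xm * kappa * c) <= 16^-1.
      rewrite -mulrA; move: cx' hlam; lra.
    have noise := noise_mgf (a := a) (dd := gap) (dm := xm) kappa0 xm0 (ltW xm0) lam0
      ba bxo gap_le cx2.
    apply: (le_trans (lee_wpmul2l _ noise)); first by rewrite lee_fin expR_ge0.
    rewrite /H ga mul1r -!EFinM -!expRD lee_fin ler_expR.
    have -> : - (lam / 2 * \sum_l frob2 (sandwich gap (mxblk a0 l))) =
        \sum_l - (lam / 2 * frob2 (B l)) by rewrite sumrN mulr_sumr.
    rewrite /b -big_split/=.
    have -> : drift = \sum_(l < L) 4 * lam * (kappa ^+ 2 *
        nsq (fun j => x0 j ^+ 2 - xo j ^+ 2)).
      by rewrite sumr_const card_ord -[RHS]mulr_natl /drift; ring.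
    rewrite -big_split/=; apply: ler_sum => l _; rewrite -/c -/(B l).
    have f0 := frob2_ge0 (B l).
    have h : lam * c ^+ 2 * (lam * frob2 (B l)) <= 64^-1 * (lam * frob2 (B l)).
      by apply: ler_wpM2r; [rewrite mulr_ge0|move: hlam; lra].
    have -> : 16 * lam ^+ 2 * c ^+ 2 * frob2 (B l) =
      16 * (lam * c ^+ 2 * (lam * frob2 (B l))) by ring.
    rewrite -/(B l); lra.
rewrite ge0_integralZl_EFin//; last 2 first.
- by move=> t _; rewrite lee_fin mulr_ge0 ?expR_ge0.
- exact: (measurableT_comp mH mJY).
have lam2 : 0 <= lam / 2 by rewrite divr_ge0.
have := @lower_tail _ _ _ P _ _ _ Y mY iY lawY gap (lam / 2) kappa good _ lam2 _ hgap mgood good_opb.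
rewrite !card_ord => lt; apply: (le_trans (lee_wpmul2l _ (lt m0 hk))).
  by rewrite lee_fin expR_ge0.
by rewrite -EFinM -expRD lee_fin ler_expR -/drift; lra.
Qed.

End pairwise.

End compare.

(** * Nets and least squares estimators *)

Section nets.
Context {R : realType} {n : nat}.

Definition coords (x : 'cV[R]_n) : 'I_n -> R := fun j => x j ord0.

Lemma l2norm_sqr (x : 'cV[R]_n) : l2norm x ^+ 2 = nsq (coords x).
Proof. by rewrite /l2norm sqr_sqrtr//; exact: nsq_ge0. Qed.

Lemma nsqD_le (u v : 'I_n -> R) :
  nsq (fun j => u j + v j) <= 2 * nsq u + 2 * nsq v.
Proof.
rewrite /nsq !mulr_sumr -big_split/=; apply: ler_sum => j _.
by have := sqr_ge0 (u j - v j); nra.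
Qed.

Lemma coordsB (x y : 'cV[R]_n) : coords (x - y) = fun j => coords x j - coords y j.
Proof. by apply/funext => j; rewrite /coords !mxE. Qed.

(** The balls of a cover need not be centred in the class; moving each centre
    to a point of the class in its ball doubles the radius. *)
Lemma class_net (xmin xmax a b eps : R) (k : nat) (C : set 'cV[R]_n) :
  signal_class xmin xmax a b k C -> 0 < eps <= a * n%:R `^ b ->
  exists (c0 : 'cV[R]_n) (r : seq 'cV[R]_n),
    [/\ (size (c0 :: r))%:R <= 2 * (a * n%:R `^ b / eps) ^+ k,
        (forall c, c \in c0 :: r -> C c) &
        (forall x, C x -> exists2 c, c \in c0 :: r &
          nsq (coords (c - x)) <= 4 * eps ^+ 2)].
Proof.
move=> [[x00 Cx00] _ Ccov] heps; have /andP[e0 e1] := heps.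
set r := (_ / eps) ^+ k.
have r1 : 1 <= r.
  by rewrite /r exprn_ege1// ler_pdivlMr// mul1r.
have : (covering_number C eps < (r + 1)%:E)%E.
  by apply: le_lt_trans (Ccov _ heps) _; rewrite lte_fin ltrDl.
move=> /ereal_inf_lt[_ [N [c cov] <-]]; rewrite lte_fin => Nr.
have dist x y z : l2norm (x - z) <= eps -> l2norm (y - z) <= eps ->
    nsq (coords (x - y)) <= 4 * eps ^+ 2.
  have sq v : l2norm v <= eps -> nsq (coords v) <= eps ^+ 2.
    by rewrite -l2norm_sqr => h; rewrite lerXn2r// nnegrE ?sqrtr_ge0// ltW.
  move=> /sq h1 /sq h2.
  have -> : coords (x - y) = fun j => coords (x - z) j + coords (z - y) j.
    by apply/funext => j; rewrite /coords !mxE; ring.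
  apply: (le_trans (nsqD_le _ _)).
  have -> : nsq (coords (z - y)) = nsq (coords (y - z)).
    by apply: eq_bigr => j _; rewrite /coords !mxE; ring.
  lra.
have gP i : exists g, C g /\ ((exists2 x, C x & l2ball (c i) eps x) ->
    l2ball (c i) eps g).
  have [[x Cx bx]|h] := pselect (exists2 x, C x & l2ball (c i) eps x).
    by exists x.
  by exists x00.
pose g i := sval (cid (gP i)).
have gC i : C (g i) by have [] := svalP (cid (gP i)).
have gb i x : C x -> l2ball (c i) eps x -> l2ball (c i) eps (g i).
  move=> Cx bx; have [_] := svalP (cid (gP i)); apply; by exists x.
have [i0 _ _] := cov _ Cx00.
pose cs := [seq g i | i <- enum 'I_N].
have csi i : g i \in cs by apply: map_f; rewrite mem_enum.
have scs : size cs = N by rewrite size_map size_enum_ord.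
case ecs : cs => [|c0 r']; first by have := csi i0; rewrite ecs.
exists c0, r'; rewrite -ecs scs; split.
- by apply/ltW; lra.
- by move=> _ /mapP[i _ ->].
- move=> x Cx; have [i _ bx] := cov _ Cx; exists (g i) => //.
  by apply: (dist _ _ (c i)) => //; exact: gb bx.
Qed.

End nets.

Section argmin.
Context {U : Type} {R : realType}.

Fixpoint argmin (V : Type) (crit : V -> U -> R) (c0 : V) (r : seq V) (u : U) : V :=
  if r is c :: r' then
    if crit c u <= crit (argmin crit c0 r' u) u then c else argmin crit c0 r' u
  else c0.

Context {V : eqType} (crit : V -> U -> R).

Lemma argmin_mem c0 r u : argmin crit c0 r u \in c0 :: r.
Proof.
elim: r => [|c r IH] /=; first by rewrite mem_head.
case: ifP => _; first by rewrite !inE eqxx orbT.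
by move: IH; rewrite !inE => /orP[->//|->]; rewrite !orbT.
Qed.

Lemma argmin_le c0 r u c : c \in c0 :: r ->
  crit (argmin crit c0 r u) u <= crit c u.
Proof.
elim: r c => [c|c' r IH c] /=; first by rewrite inE => /eqP ->.
rewrite !inE; have [h|h] := leP (crit c' u) (crit (argmin crit c0 r u) u).
  case/or3P => [/eqP ->|/eqP ->//|cr].
    by apply: le_trans h _; apply: IH; rewrite mem_head.
  by apply: le_trans h _; apply: IH; rewrite inE cr orbT.
case/or3P => [/eqP ->|/eqP ->|cr].
- by apply: IH; rewrite mem_head.
- exact: ltW.
- by apply: IH; rewrite inE cr orbT.
Qed.

End argmin.

(** The induction needs the minimal value along with the minimizer. *)
Lemma measurable_argmin d d' (U : measurableType d) (V : measurableType d')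
    (R : realType) (crit : V -> U -> R) c0 r :
  (forall v, measurable_fun setT (crit v)) ->
  measurable_fun setT (argmin crit c0 r) /\
  measurable_fun setT (fun u => crit (argmin crit c0 r u) u).
Proof.
move=> mcrit; elim: r => [|c r [IH1 IH2]] /=; first by split.
have mb : measurable_fun setT (fun u => crit c u <= crit (argmin crit c0 r u) u).
  exact: measurable_fun_ler.
split; first exact: measurable_fun_ifT.
rewrite (_ : (fun u => _) = fun u => if crit c u <= crit (argmin crit c0 r u) u
    then crit c u else crit (argmin crit c0 r u) u).
  exact: measurable_fun_ifT.
by apply/funext => u; case: ifP.
Qed.

(** * Risk of the least squares estimator over a net *)

Section risk_bound.
Context d (T : measurableType d) (R : realType) (P : probability T R).
Variables (m n L : nat) (sigmaz : R).
Variables (A : 'I_L -> {RV P >-> 'M[R]_(m, n)})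
  (w : 'I_L -> {RV P >-> 'cV[R]_n}) (z : 'I_L -> {RV P >-> 'cV[R]_m}).
Hypothesis noise : noise_model A w z sigmaz.
Hypothesis sensing : gaussian_sensing A.

Local Notation sensed := (vec R (('I_L * 'I_m) * 'I_n)%type).
Local Notation E := (joint (entry A w z)).
Local Notation observed := (L.-tuple 'cV[R]_m * L.-tuple 'M[R]_(m, n))%type.

Let mE k : measurable_fun setT (entry A w z k) := measurable_model_entry A w z k.
Let iE : box_indep P (entry A w z) := box_indep_entry noise sensing.
Let lawE k B : measurable B ->
  P (entry A w z k @^-1` B) = centered_normal (entry_std sigmaz k) B.
Proof. by move=> mB; exact: (entry_law noise sensing). Qed.

Definition criterion (c : 'cV[R]_n) (u : observed) : R :=
  contrast sigmaz (fun l i j => tnth u.2 l i j) (fun l i => tnth u.1 l i ord0)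
    (coords c).

Lemma criterion_data (x c : 'cV[R]_n) t :
  criterion c (data A w z x t) = sample_contrast sigmaz (coords x) (E t) (coords c).
Proof.
rewrite /criterion /sample_contrast /data/=; congr (contrast _ _ _ _).
  by apply/funext => l; apply/funext => i; apply/funext => j; rewrite tnth_mktuple.
apply/funext => l; apply/funext => i; rewrite tnth_mktuple /observation /obs.
rewrite !mxE; congr (_ + _); apply: eq_bigr => j _.
by rewrite mul_mx_diag !mxE.
Qed.

Lemma measurable_criterion c : measurable_fun setT (criterion c).
Proof.
have mA l i j : measurable_fun setT (fun u : observed => tnth u.2 l i j).
  apply: (measurableT_comp (measurable_entry i j)).
  exact: (measurableT_comp (measurable_tnth l) measurable_snd).
have my l i : measurable_fun setT (fun u : observed => tnth u.1 l i ord0).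
  apply: (measurableT_comp (measurable_entry i ord0)).
  exact: (measurableT_comp (measurable_tnth l) measurable_fst).
have mS l i i' : measurable_fun setT (fun u : observed =>
    signal_cov (fun l i j => tnth u.2 l i j) (coords c) l i i').
  apply: measurable_sum => j; apply: measurable_funM => //.
  by apply: measurable_funM.
apply: measurable_sum => l; apply: measurable_funD.
  apply: measurable_funB.
    by do 2![apply: measurable_sum => ?]; exact: measurable_funX.
  apply: measurable_funM => //; do 2![apply: measurable_sum => ?].
  by apply: measurable_funM => //; apply: measurable_funM.
by apply: measurable_funM => //; exact: measurable_sum.
Qed.

Definition least_squares (c0 : 'cV[R]_n) (r : seq 'cV[R]_n) : estimator R m n L :=
  HB.pack (argmin criterion c0 r) (isMeasurableFun.Build _ _ _ _ _
    (measurable_argmin c0 r measurable_criterion).1).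

Lemma measurable_data (x : 'cV[R]_n) : measurable_fun setT (data A w z x).
Proof.
have mt d1 (U : measurableType d1) (f : 'I_L -> T -> U) :
    (forall l, measurable_fun setT (f l)) ->
    measurable_fun setT (fun t => [tuple f l t | l < L]).
  move=> mf; apply/measurable_fun_tnthP => l.
  rewrite (_ : _ \o _ = f l); first exact: mf.
  by apply/funext => t /=; rewrite tnth_mktuple.
apply: measurable_fun_pair; apply: mt => l; last exact: measurable_funP.
apply: measurable_matrix => i j.
rewrite (_ : (fun u => _) = fun t =>
    \sum_k A l t i k * x k ord0 * w l t k ord0 + z l t i ord0).
  apply: measurable_funD; last exact: (mE (inr (l, inr i))).
  apply: measurable_sum => k; apply: measurable_funM; last exact: (mE (inr (l, inl k))).
  by apply: measurable_funM => //; exact: (mE (inl ((l, i), k))).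
apply/funext => t; rewrite (ord1 j) /observation !mxE; congr (_ + _).
by apply: eq_bigr => k _; rewrite mul_mx_diag !mxE.
Qed.

Definition quad_loss (xhat : estimator R m n L) (x : 'cV[R]_n) (t : T) : R :=
  l2norm (xhat (data A w z x t) - x) ^+ 2 / n%:R.

Lemma measurable_quad_loss xhat x : measurable_fun setT (quad_loss xhat x).
Proof.
apply: measurable_funM => //.
rewrite (_ : (fun t => _) = fun t =>
    nsq (fun j => xhat (data A w z x t) j ord0 - x j ord0)); last first.
  by apply/funext => t; rewrite l2norm_sqr coordsB.
apply: measurable_sum => j; apply: measurable_funX; apply: measurable_funB => //.
apply: (measurableT_comp (measurable_entry j ord0)).
exact: (measurableT_comp (measurable_funP xhat) (measurable_data x)).
Qed.

Definition tame (q : R) (a : sensed) : bool := [forall l, lattice_ok q (mxblk a l)].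

Lemma measurable_tame q : measurable_fun setT (tame q).
Proof.
apply: measurable_forall => l; apply: measurable_forall => f.
case: (nsq (latpt f) <= _ :> R) => /=; last exact: measurable_cst.
apply: measurable_fun_ler => //; apply: measurable_sum => j.
apply: measurable_funX; apply: measurable_sum => i; apply: measurable_funM => //.
exact: measurable_mxblk.
Qed.

Lemma tame_opb q a : 0 <= q -> tame q a -> forall l, opb (4 * q) (mxblk a l).
Proof. by move=> q0 /forallP h l; apply: lattice_ok_opb => //; exact: h. Qed.

Lemma not_tame_le (q : R) : (0 < m)%N ->
  (\int[P]_t (~~ tame q (sensing_part (E t)))%:R%:E <=
   (L%:R * expR (6 * m%:R + n%:R / 8 - q / 16))%:E)%E.
Proof.
move=> m0.
have mbad l : measurable_fun setT (fun t =>
    (~~ lattice_ok q (mxblk (sensing_part (E t)) l))%:R%:E : \bar R).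
  apply/measurable_EFinP/measurable_fun_natr/measurable_neg.
  apply: measurable_forall => f.
  case: (nsq (latpt f) <= _ :> R) => /=; last exact: measurable_cst.
  apply: measurable_fun_ler => //; apply: measurable_sum => j.
  apply: measurable_funX; apply: measurable_sum => i; apply: measurable_funM => //.
  exact: (mE (inl ((l, i), j))).
apply: (@le_trans _ _ (\int[P]_t (\sum_(l < L)
    (~~ lattice_ok q (mxblk (sensing_part (E t)) l))%:R%:E))%E).
  apply: ge0_le_integral => //.
  - apply/measurable_EFinP/measurable_fun_natr/measurable_neg.
    apply: (measurableT_comp (measurable_tame q)).
    by apply: measurable_vec => k; exact: (mE (inl k)).
  - by apply: emeasurable_sum.
  - move=> t _; have [ok|/forallPn[l bl]] := boolP (tame q _).
      by rewrite sume_ge0// => l _; rewrite lee_fin.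
    by rewrite (bigD1 l)//= bl lee_paddr// sume_ge0// => l' _; rewrite lee_fin.
rewrite ge0_integral_sum//.
apply: (@le_trans _ _ (\sum_(l < L) (expR (6 * m%:R + n%:R / 8 - q / 16))%:E)%E).
  apply: lee_sum => l _.
  pose h (ji : 'I_n * 'I_m) : entry_index m n L := inl ((l, ji.2), ji.1).
  have hI : injective h by move=> [j i] [j' i'] [-> ->].
  have := lattice_ok_tail (X := fun k => entry A w z (h k)) (fun k => mE (h k))
    (box_indep_sub hI iE) _ q.
  by rewrite !card_ord => H; apply: H => // k B mB; rewrite lawE.
by rewrite sumEFin sumr_const card_ord -[X in X%:E]mulr_natl.
Qed.

Section fixed_net.
Variables (xmin xmax eps lam rho2 : R) (C : set 'cV[R]_n).
Variables (c0 : 'cV[R]_n) (r : seq 'cV[R]_n) (x : 'cV[R]_n).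
Let kappa : R := 1152 * (m%:R + n%:R).
Let xm := xmax ^+ 2.
Hypotheses (hmin : 0 < xmin) (hmax : xmin < xmax).
Hypothesis Cbox : forall y, C y -> forall i, xmin <= y i ord0 <= xmax.
Hypothesis netC : forall c, c \in c0 :: r -> C c.
Hypothesis netx : exists2 c, c \in c0 :: r & nsq (coords (c - x)) <= 4 * eps ^+ 2.
Hypothesis Cx : C x.
Hypotheses (m0 : (0 < m)%N) (n0 : (0 < n)%N) (lam0 : 0 <= lam) (rho0 : 0 <= rho2).
Hypothesis hlam : 64 * (lam * (xm * kappa + sigmaz ^+ 2) ^+ 2) <= 1.
Hypothesis hgap : 10 ^+ 9 * (lam / 2 * kappa * (n%:R * xm ^+ 2)) <= 1.

Let sq_le y : C y -> forall j, coords y j ^+ 2 <= xm.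
Proof.
move=> Cy j; have /andP[h1 h2] := Cbox Cy j.
by rewrite /xm /coords lerXn2r// nnegrE; move: hmin hmax; lra.
Qed.

Let dist_le y y' : C y -> C y' -> nsq (coords (y - y')) <= n%:R * xm.
Proof.
move=> Cy Cy'; have -> : n%:R * xm = \sum_(j < n) xm.
  by rewrite sumr_const card_ord -[RHS]mulr_natl.
apply: ler_sum => j _; rewrite coordsB /coords.
have /andP[h1 h2] := Cbox Cy j; have /andP[h3 h4] := Cbox Cy' j.
by rewrite /xm; move: hmin hmax; nra.
Qed.

Let loss_le y y' : C y -> C y' -> nsq (coords (y - y')) / n%:R <= xm.
Proof. by move=> Cy Cy'; rewrite ler_pdivrMr ?ltr0n// mulrC; exact: dist_le. Qed.

Let gap_le y y' : C y -> C y' ->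
  nsq (fun j => coords y j ^+ 2 - coords y' j ^+ 2) <= n%:R * xm ^+ 2.
Proof.
move=> Cy Cy'; have -> : n%:R * xm ^+ 2 = \sum_(j < n) xm ^+ 2.
  by rewrite sumr_const card_ord -[RHS]mulr_natl.
apply: ler_sum => j _.
have := sq_le Cy j; have := sq_le Cy' j.
have := sqr_ge0 (coords y j); have := sqr_ge0 (coords y' j).
by nra.
Qed.

(* The squaring map is bi-Lipschitz on [xmin, xmax]. *)
Let gap_ge y y' : C y -> C y' -> 4 * xmin ^+ 2 * nsq (coords (y - y')) <=
  nsq (fun j => coords y j ^+ 2 - coords y' j ^+ 2).
Proof.
move=> Cy Cy'; rewrite coordsB /nsq mulr_sumr; apply: ler_sum => j _.
rewrite subr_sqr exprMn mulrC; apply: ler_wpM2l; first exact: sqr_ge0.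
have /andP[h1 h2] := Cbox Cy j; have /andP[h3 h4] := Cbox Cy' j.
by rewrite /coords; move: hmin; nra.
Qed.

Let gap_lip y y' : C y -> C y' ->
  nsq (fun j => coords y j ^+ 2 - coords y' j ^+ 2) <=
  4 * xm * nsq (coords (y - y')).
Proof.
move=> Cy Cy'; rewrite coordsB /nsq mulr_sumr; apply: ler_sum => j _.
rewrite subr_sqr exprMn mulrC; apply: ler_wpM2r; first exact: sqr_ge0.
have /andP[h1 h2] := Cbox Cy j; have /andP[h3 h4] := Cbox Cy' j.
by rewrite /coords /xm; move: hmin; nra.
Qed.

Lemma risk_least_squares_le_box : (risk A w z (least_squares c0 r) x <= xm%:E)%E.
Proof.
rewrite /risk unlock.
apply: (@le_trans _ _ (\int[P]_t (cst xm%:E t))%E).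
  apply: ge0_le_integral => //.
  - by move=> t _; rewrite lee_fin divr_ge0// sqr_ge0.
  - by apply/measurable_EFinP; exact: measurable_quad_loss.
  - move=> t _; rewrite lee_fin l2norm_sqr; apply: loss_le => //.
    by apply: netC; exact: argmin_mem.
by rewrite integral_cst// [X in (_ * X <= _)%E]probability_setT mule1.
Qed.

(** If the entrywise square of the minimizer is within squared distance [rho2] of
    that of the net point close to [x], the first term bounds the loss because
    squaring is bi-Lipschitz. Otherwise [pairwise_bound] applies to the
    minimizer, and a union bound over the net to all candidates; here and when
    the sensing matrices are not tame, the loss is at most [xmax ^+ 2]. *)
Lemma risk_least_squares_le :
  (risk A w z (least_squares c0 r) x <=
   ((rho2 / (2 * xmin ^+ 2) + 8 * eps ^+ 2) / n%:R +
    xm * (L%:R * expR (- (12 * n%:R)) + (size (c0 :: r))%:R *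
      expR (4 * lam * L%:R * kappa ^+ 2 * (16 * xm * eps ^+ 2) -
        lam * L%:R * m%:R ^+ 2 * rho2 / 32)))%:E)%E.
Proof.
have [x0 x0r hx0] := netx.
have Cx0 := netC x0r.
have xm0 : 0 < xm by rewrite exprn_gt0//; move: hmin hmax; lra.
pose q : R := 288 * (m%:R + n%:R).
have q0 : 0 <= q by rewrite /q; have := ler0n R m; have := ler0n R n; lra.
have qk : kappa = 4 * q by rewrite /kappa /q; lra.
have nr0 : (0 : R) < n%:R by rewrite ltr0n.
pose good t := tame q (sensing_part (E t)).
pose gapc (c : 'cV[R]_n) j := coords c j ^+ 2 - coords x0 j ^+ 2.
pose bad c t : R := if rho2 < nsq (gapc c) then
  (good t)%:R * (sample_contrast sigmaz (coords x) (E t) (coords c) <=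
     sample_contrast sigmaz (coords x) (E t) (coords x0))%R%:R else 0.
have bad0 c t : 0 <= bad c t by rewrite /bad; case: ifP => // _; rewrite mulr_ge0.
pose base : R := (rho2 / (2 * xmin ^+ 2) + 8 * eps ^+ 2) / n%:R.
have base0 : 0 <= base.
  rewrite /base divr_ge0// addr_ge0//; last by rewrite mulr_ge0// sqr_ge0.
  by rewrite divr_ge0// mulr_ge0// sqr_ge0.
have loss0 t : 0 <= quad_loss (least_squares c0 r) x t.
  by rewrite /quad_loss l2norm_sqr divr_ge0// nsq_ge0.
have pointwise t : quad_loss (least_squares c0 r) x t <=
    base + xm * ((~~ good t)%:R + \sum_(c <- c0 :: r) bad c t).
  rewrite /quad_loss l2norm_sqr.
  set u := data A w z x t; set ch := argmin criterion c0 r u.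
  have -> : least_squares c0 r u = ch by [].
  have chr : ch \in c0 :: r by exact: argmin_mem.
  have Cch := netC chr.
  have triv := loss_le (netC chr) Cx.
  have sb0 : 0 <= \sum_(c <- c0 :: r) bad c t by apply: sumr_ge0 => c _.
  have [gt|gt] := boolP (good t); last first.
    apply: (le_trans triv); rewrite mulr1n.
    by have := mulr_ge0 (ltW xm0) sb0; lra.
  have := argmin_le criterion u x0r; rewrite -/ch !criterion_data => fit.
  have [far|near] := ltP rho2 (nsq (gapc ch)).
    have : 1 <= \sum_(c <- c0 :: r) bad c t.
      rewrite (big_rem ch)//=; apply: (le_trans (y := bad ch t)).
        by rewrite /bad far gt fit mul1r.
      by rewrite lerDl; apply: sumr_ge0 => c _.
    move=> h1; apply: (le_trans triv); rewrite mulr0n add0r.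
    by have := ler_wpM2l (ltW xm0) h1; lra.
  apply: (@le_trans _ _ base); last by rewrite lerDl mulr_ge0 ?(ltW xm0)// addr_ge0.
  rewrite /base ler_pM2r ?invr_gt0//.
  have -> : coords (ch - x) = fun j => coords (ch - x0) j + coords (x0 - x) j.
    by apply/funext => j; rewrite /coords !mxE; ring.
  apply: (le_trans (nsqD_le _ _)).
  have h1 := gap_ge Cch Cx0; rewrite -/(gapc ch) in h1.
  have xmin2 : 0 < xmin ^+ 2 by rewrite exprn_gt0.
  have : 2 * nsq (coords (ch - x0)) <= rho2 / (2 * xmin ^+ 2).
    by rewrite ler_pdivlMr ?mulr_gt0//; move: near h1; lra.
  by move: hx0; lra.
have mgood : measurable_fun setT good.
  apply: (measurableT_comp (measurable_tame q)).
  by apply: measurable_vec => k; exact: (mE (inl k)).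
have mJ := measurable_joint mE.
have mbad c : measurable_fun setT (bad c).
  rewrite /bad; case: (rho2 < _); last exact: measurable_cst.
  apply: measurable_funM; first exact: measurable_fun_natr.
  apply: measurable_fun_natr; apply: measurable_fun_ler;
    exact: (measurableT_comp (measurable_sample_contrast _ _ _) mJ).
have mng : measurable_fun setT (fun t => (~~ good t)%:R : R).
  by apply: measurable_fun_natr; exact: measurable_neg.
rewrite /risk unlock.
apply: (@le_trans _ _ (\int[P]_t (base%:E + xm%:E * ((~~ good t)%:R%:E +
    \sum_(c <- c0 :: r) (bad c t)%:E)))%E).
  apply: ge0_le_integral => //.
  - by move=> t _; rewrite lee_fin; exact: loss0.
  - by apply/measurable_EFinP; exact: measurable_quad_loss.
  - apply: emeasurable_funD => //; apply: emeasurable_funM => //.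
    apply: emeasurable_funD; first exact/measurable_EFinP.
    by apply: emeasurable_sum => c; exact/measurable_EFinP.
  - move=> t _; have := pointwise t; rewrite -lee_fin.
    by rewrite [in X in _ -> X]sumEFin.
have mS : measurable_fun setT (fun t => \sum_(c <- c0 :: r) (bad c t)%:E)%E.
  by apply: emeasurable_sum => c; exact/measurable_EFinP.
have mng' : measurable_fun setT (fun t => (~~ good t)%:R%:E : \bar R).
  exact/measurable_EFinP.
have S0 t : (0 <= \sum_(c <- c0 :: r) (bad c t)%:E)%E.
  by rewrite sume_ge0// => c _; rewrite lee_fin.
have mW : measurable_fun setT (fun t =>
    ((~~ good t)%:R%:E + \sum_(c <- c0 :: r) (bad c t)%:E : \bar R)%E).
  exact: emeasurable_funD.
have W0 t : (0 <= (~~ good t)%:R%:E + \sum_(c <- c0 :: r) (bad c t)%:E)%E.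
  by rewrite adde_ge0.
have xW0 t : (0 <= xm%:E * ((~~ good t)%:R%:E + \sum_(c <- c0 :: r) (bad c t)%:E))%E.
  by rewrite mule_ge0// lee_fin ltW.
have mxW : measurable_fun setT (fun t => (xm%:E *
    ((~~ good t)%:R%:E + \sum_(c <- c0 :: r) (bad c t)%:E))%E).
  exact: emeasurable_funM.
rewrite ge0_integralD//.
rewrite integral_cst// [X in (_ * X + _)%E]probability_setT mule1.
rewrite ge0_integralZl_EFin//; last exact: ltW.
rewrite ge0_integralD// ge0_integral_sum//; last first.
- by move=> c t _; rewrite lee_fin.
- by move=> c; exact/measurable_EFinP.
rewrite EFinD leeD2l// [X in (_ <= X)%E]EFinM; apply: lee_wpmul2l; first by rewrite lee_fin ltW.
rewrite EFinD; apply: leeD.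
  apply: (le_trans (not_tame_le q m0)); rewrite lee_fin ler_wpM2l// ler_expR.
  by rewrite /q; have := ler0n R m; have := ler0n R n; lra.
set e1 := expR _.
have -> : ((size (c0 :: r))%:R * e1)%:E = (\sum_(c <- c0 :: r) e1%:E)%E.
  by rewrite sumEFin big_const_seq count_predT iter_addr addr0 mulr_natl.
rewrite !big_seq; apply: lee_sum => c cr.
have Cc := netC cr.
rewrite /bad; have [far|_] := boolP (rho2 < nsq (gapc c)); last first.
  by rewrite integral0 lee_fin expR_ge0.
have hk : m%:R + n%:R <= kappa.
  by rewrite /kappa; have := ler0n R m; have := ler0n R n; lra.
have tameP a : tame q a -> forall l, opb kappa (mxblk a l).
  by rewrite qk; exact: tame_opb.
have hgap' : 10 ^+ 9 * (lam / 2 * kappa * nsq (gapc c)) <= 1.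
  apply: le_trans hgap; rewrite ler_wpM2l ?exprn_ge0// ler_wpM2l//.
    by rewrite mulr_ge0 ?divr_ge0// qk mulr_ge0.
  exact: gap_le.
have := pairwise_bound mE iE lawE (measurable_tame q) tameP m0 hk lam0 xm0
  (sq_le Cx) (sq_le Cx0) (sq_le Cc) hlam hgap'.
move=> /le_trans; apply; rewrite lee_fin /e1 ler_expR.
have lamL0 : 0 <= lam * L%:R by exact: mulr_ge0.
have k2 := mulr_ge0 lamL0 (sqr_ge0 kappa).
have m2 := mulr_ge0 lamL0 (sqr_ge0 (m%:R : R)).
have h1 : nsq (fun j => coords x0 j ^+ 2 - coords x j ^+ 2) <= 16 * xm * eps ^+ 2.
  apply: (le_trans (gap_lip Cx0 Cx)).
  have x4 : 0 <= 4 * xm by move: xm0; lra.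
  by have := ler_wpM2l x4 hx0; lra.
have := ler_wpM2l k2 h1; have := ler_wpM2l m2 (ltW far); rewrite /gapc; lra.
Qed.

End fixed_net.

End risk_bound.

(** * Tuning of the constants *)

Section tuning.
Context (R : realType).
Implicit Types (a b xm sigmaz : R).

Definition scale (sigmaz : R) (m n : nat) : R :=
  Num.max (sigmaz ^+ 4) (Num.max (m%:R ^+ 2) (n%:R ^+ 2)).

Section step.
Variables (u v xm sigmaz : R) (m n : nat).
Hypotheses (u0 : 0 <= u) (v0 : 0 <= v).
Local Notation M := (scale sigmaz m n).
Local Notation kappa := (u * (m%:R + n%:R)).

Lemma scale_ge : [/\ sigmaz ^+ 4 <= M, m%:R ^+ 2 <= M & n%:R ^+ 2 <= M].
Proof. by rewrite /scale !le_max !lexx !orbT. Qed.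

Lemma scale_gt0 : (0 < n)%N -> 0 < M.
Proof.
move=> n0; have [_ _] := scale_ge; apply: lt_le_trans.
by rewrite exprn_gt0// ltr0n.
Qed.

Lemma dims_sqr_le : (m%:R + n%:R) ^+ 2 <= 4 * M.
Proof.
have [_ h1 h2] := scale_ge.
by have := sqr_ge0 (m%:R - n%:R : R); move: h1 h2; nra.
Qed.

Lemma radius_sqr_le : kappa ^+ 2 <= 4 * u ^+ 2 * M.
Proof. by rewrite exprMn; have := ler_wpM2l (sqr_ge0 u) dims_sqr_le; lra. Qed.

(** The Chernoff parameter will be [step_const / M]. In the two conditions that
    it has to meet, [kappa] is a bound on squared operator norms and [v] comes
    from [lower_tail]. *)
Definition step_const : R := (128 * (4 * u ^+ 2 * xm ^+ 2 + 1) + v * u * xm ^+ 2)^-1.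

Let ux0 : 0 <= u ^+ 2 * xm ^+ 2.
Proof. by rewrite mulr_ge0 ?sqr_ge0. Qed.

Let vux0 : 0 <= v * u * xm ^+ 2.
Proof. by rewrite mulr_ge0 ?sqr_ge0// mulr_ge0. Qed.

Lemma step_const_gt0 : 0 < step_const.
Proof. by rewrite invr_gt0; move: ux0 vux0; lra. Qed.

Lemma step_const_le w : (0 < n)%N ->
  w <= M * (128 * (4 * u ^+ 2 * xm ^+ 2 + 1) + v * u * xm ^+ 2) ->
  step_const / M * w <= 1.
Proof.
move=> nn0 hw; have M0 := scale_gt0 nn0.
rewrite -mulrA mulrC /step_const ler_pdivrMr; last first.
  by move: ux0 vux0; lra.
by rewrite mul1r mulrC ler_pdivrMr// mulrC.
Qed.

Lemma step_const_noise : (0 < n)%N ->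
  64 * (step_const / M * (xm * kappa + sigmaz ^+ 2) ^+ 2) <= 1.
Proof.
move=> nn0; have M0 := scale_gt0 nn0; have [h4 _ _] := scale_ge.
rewrite mulrCA; apply: step_const_le => //.
have hc : (xm * kappa + sigmaz ^+ 2) ^+ 2 <= 2 * (xm * kappa) ^+ 2 + 2 * sigmaz ^+ 4.
  rewrite (_ : sigmaz ^+ 4 = (sigmaz ^+ 2) ^+ 2) -?exprM//.
  by have := sqr_ge0 (xm * kappa - sigmaz ^+ 2); nra.
rewrite exprMn in hc.
have := ler_wpM2l (sqr_ge0 xm) radius_sqr_le.
have := mulr_ge0 (ltW M0) vux0; move: hc h4; lra.
Qed.

Lemma step_const_gap : (0 < n)%N ->
  v * (step_const / M / 2 * kappa * (n%:R * xm ^+ 2)) <= 1.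
Proof.
move=> nn0; have M0 := scale_gt0 nn0; have [_ hm hn] := scale_ge.
have hd : (m%:R + n%:R) * n%:R <= 2 * M.
  by have := sqr_ge0 (m%:R - n%:R : R); move: hm hn; nra.
have -> : v * (step_const / M / 2 * kappa * (n%:R * xm ^+ 2)) =
   step_const / M * (v * u * xm ^+ 2 * ((m%:R + n%:R) * n%:R) / 2) by ring.
apply: step_const_le => //.
have := ler_wpM2l vux0 hd; have := mulr_ge0 (ltW M0) ux0; lra.
Qed.

End step.

Lemma net_size_le (a b : R) (n k : nat) : 0 < a -> a <= n%:R -> (2 <= n)%N ->
  (1 <= k)%N ->
  2 * (a * n%:R `^ b / n%:R ^- 2) ^+ k <= expR ((b + 4) * k%:R * ln n%:R).
Proof.
move=> a0 an n2 k1; have nr : (0 : R) < n%:R by rewrite ltr0n; lia.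
have nr2 : (2 : R) <= n%:R by rewrite ler_nat.
have -> : (b + 4) * k%:R * ln n%:R = k%:R * ((b + 3) * ln n%:R) + k%:R * ln n%:R.
  by ring.
rewrite expRD mulrC !expRM_natl lnK ?posrE//; apply: ler_pM => //.
- by rewrite exprn_ge0// divr_ge0// ?mulr_ge0 ?powR_ge0// ?(ltW a0)// invr_ge0 exprn_ge0.
- apply: lerXn2r; rewrite ?nnegrE ?expR_ge0//.
    by rewrite divr_ge0// ?mulr_ge0 ?powR_ge0// ?(ltW a0)// invr_ge0 exprn_ge0.
  rewrite invrK mulrDl expRD expRM_natl lnK ?posrE// /powR gt_eqF//.
  rewrite -mulrA mulrCA (exprS _ 2).
  by apply: ler_wpM2l; [exact: expR_ge0 | apply: ler_wpM2r => //; exact: sqr_ge0].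
- by apply: (le_trans nr2); apply: ler_eXnr => //; lra.
Qed.

End tuning.

Theorem theorem2p7 (R : realType) (xmin xmax a b : R)
  (hmin : 0 < xmin) (hmax : xmin < xmax) (ha : 0 < a) (hb : 0 <= b) :
  exists (Cst : R) (n0 : nat), 0 < Cst /\
  forall (n m L k : nat) (sigmaz : R),
    (n0 < n)%N -> (1 <= m)%N -> (1 <= L)%N -> (1 <= k <= n)%N -> 0 <= sigmaz ->
    (m * L)%:R <= n%:R ^+ 4 * k%:R * ln (n%:R : R) ->
  forall (d : measure_display) (T : measurableType d) (P : probability T R)
    (A : 'I_L -> {RV P >-> 'M[R]_(m, n)})
    (w : 'I_L -> {RV P >-> 'cV[R]_n}) (z : 'I_L -> {RV P >-> 'cV[R]_m}),
    noise_model A w z sigmaz -> gaussian_sensing A ->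
  forall C : set 'cV[R]_n, signal_class xmin xmax a b k C ->
    (minimax_risk A w z C <=
      (Cst * Num.min
        (Num.max (sigmaz ^+ 4) (Num.max (m%:R ^+ 2) (n%:R ^+ 2))
           * k%:R * ln n%:R / (m%:R ^+ 2 * n%:R * L%:R))
        1)%:E)%E.
Proof.
pose xm := xmax ^+ 2.
have xm0 : 0 < xm by rewrite exprn_gt0//; lra.
pose u : R := 1152.
have u0 : 0 <= u by exact: ler0n.
pose v : R := 10 ^+ 9.
have v0 : 0 <= v by rewrite exprn_ge0.
pose lamC := step_const u v xm.
have lamC0 : 0 < lamC by exact: step_const_gt0.
(* [d1 k ln n] will bound the drift due to the radius of the net. *)
pose d1 := 4 * lamC * (4 * u ^+ 2) * (16 * xm).
have d10 : 0 <= d1.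
  by rewrite /d1; have := mulr_ge0 (ltW lamC0) (mulr_ge0 (sqr_ge0 u) (ltW xm0)); lra.
pose R1 := 32 * (d1 + b + 9) / lamC.
have R10 : 0 <= R1.
  by rewrite /R1; apply: divr_ge0; [lra | exact: ltW].
have xmin2 : 0 < xmin ^+ 2 by rewrite exprn_gt0.
have q0 : 0 <= R1 / (2 * xmin ^+ 2) by rewrite divr_ge0// mulr_ge0// ltW.
(* This [n0] ensures that [2 <= n], [a <= n] and [n^-1 <= a]. *)
exists (R1 / (2 * xmin ^+ 2) + 8 + 2 * xm), (Num.truncn (a + a^-1)).+1; split; first by lra.
move=> n m L k sigmaz hn m0 L0 /andP[k1 kn] _ hmL d T P A w z noise sensing C classC.
have [_ Cbox _] := classC.
have an : a + a^-1 <= n%:R.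
  have h := Num.Theory.truncnS_gt (a + a^-1).
  by apply: (le_trans (ltW h)); rewrite ler_nat ltnW.
have ai0 : 0 < a^-1 by rewrite invr_gt0.
have n2 : (2 <= n)%N by apply: leq_trans hn.
have n0 : (0 < n)%N by exact: ltnW.
have nr2 : (2 : R) <= n%:R by rewrite ler_nat.
have nr0 : (0 : R) < n%:R by rewrite ltr0n.
have mr1 : (1 : R) <= m%:R by rewrite ler1n.
have Lr1 : (1 : R) <= L%:R by rewrite ler1n.
have kr1 : (1 : R) <= k%:R by rewrite ler1n.
have krn : (k%:R : R) <= n%:R by rewrite ler_nat.
pose M := scale sigmaz m n.
have M0 : 0 < M by exact: scale_gt0.
have [_ mM _] := scale_ge sigmaz m n.
set lg := ln (n%:R : R).
have lg0 : 0 < lg by rewrite ln_gt0//; lra.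
have lgn : lg <= n%:R - 1.
  have := @le_ln1Dx R (n%:R - 1); rewrite (_ : 1 + _ = n%:R); last by ring.
  by apply; lra.
have expl (j : nat) : expR (j%:R * lg) = n%:R ^+ j.
  by rewrite expRM_natl lnK ?posrE.
pose rate := M * k%:R * lg / (m%:R ^+ 2 * n%:R * L%:R).
have m20 : (0 : R) < m%:R ^+ 2 by rewrite exprn_gt0//; lra.
have mnL0 : 0 < m%:R ^+ 2 * n%:R * L%:R :> R by rewrite !mulr_gt0//; lra.
have Lle : L%:R <= n%:R ^+ 4 * k%:R * lg.
  by apply: le_trans hmL; rewrite ler_nat leq_pmull.
have n4 : (0 : R) < n%:R ^+ 4 by rewrite exprn_gt0.
have rate_ge : n%:R ^- 5 <= rate.
  rewrite /rate ler_pdivlMr// mulrC ler_pdivrMr ?exprn_gt0//.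
  apply: (@le_trans _ _ (M * n%:R * (n%:R ^+ 4 * k%:R * lg))).
    by apply: ler_pM => //; rewrite ler_wpM2r.
  by rewrite (exprS _ 4) le_eqVlt; apply/orP; left; apply/eqP; ring.
pose eps : R := n%:R ^- 2.
have eps0 : 0 < eps by rewrite invr_gt0 exprn_gt0.
have heps : 0 < eps <= a * n%:R `^ b.
  rewrite eps0/=; apply: (@le_trans _ _ (a * 1)); last first.
    apply: ler_wpM2l; first exact: ltW.
    by have := @ler_powR R n%:R _ 0 b hb; rewrite powRr0; apply; lra.
  rewrite mulr1 /eps -[leRHS]invrK lef_pV2 ?posrE ?exprn_gt0//.
  by rewrite expr2; nra.
have [c0 [r [szr netC netx]]] := class_net classC heps.
pose lam := lamC / M.
have lam0 : 0 <= lam by rewrite divr_ge0// ltW.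
pose rho2 := R1 * M * k%:R * lg / (L%:R * m%:R ^+ 2).
have rho0 : 0 <= rho2.
  rewrite /rho2; apply: divr_ge0; last by apply: mulr_ge0 => //; exact: ltW.
  exact: (mulr_ge0 (mulr_ge0 (mulr_ge0 R10 (ltW M0)) (ler0n R k)) (ltW lg0)).
pose est := least_squares m L sigmaz c0 r.
apply: (@le_trans _ _ (ereal_sup [set risk A w z est x | x in C])).
  by apply: ereal_inf_lbound; exists est.
apply: ge_ereal_sup => _ [x Cx <-].
rewrite minr_pMr; last by lra.
rewrite -/M -/rate EFin_min le_min; apply/andP; split; last first.
  apply: le_trans (risk_least_squares_le_box sigmaz A w z hmin hmax Cbox netC Cx n0) _.
  by rewrite lee_fin mulr1 -/xm; lra.
have hlam := step_const_noise xm sigmaz m u0 v0 n0.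
have hgap := step_const_gap xm sigmaz m u0 v0 n0.
apply: (le_trans (risk_least_squares_le noise sensing hmin hmax Cbox netC
  (netx x Cx) Cx m0 n0 lam0 rho0 hlam hgap)).
rewrite lee_fin -/xm.
have e1 : rho2 / (2 * xmin ^+ 2) / n%:R = R1 / (2 * xmin ^+ 2) * rate.
  rewrite /rho2 /rate; field.
  by rewrite !lt0r_neq0//; lra.
have e2 : 8 * eps ^+ 2 / n%:R <= 8 * rate.
  rewrite -mulrA ler_wpM2l//; apply: le_trans rate_ge.
  by rewrite /eps -exprVn -exprM -exprVn [leRHS]exprSr.
have e3 : L%:R * expR (- (12 * n%:R)) <= rate.
  apply: le_trans rate_ge; rewrite -expl -expRN.
  apply: (@le_trans _ _ (expR (6%:R * lg) * expR (- (12 * n%:R)))).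
    rewrite ler_wpM2r ?expR_ge0// expl; apply: (le_trans Lle).
    rewrite -mulrA (exprD _ 4 2); apply: ler_wpM2l; first exact: ltW.
    rewrite expr2; apply: ler_pM => //; first exact: ltW.
    by move: lgn; lra.
  by rewrite -expRD ler_expR; move: lgn; lra.
have e4 : (size (c0 :: r))%:R * expR (4 * lam * L%:R * (u * (m%:R + n%:R)) ^+ 2 *
      (16 * xm * eps ^+ 2) - lam * L%:R * m%:R ^+ 2 * rho2 / 32) <= rate.
  apply: le_trans rate_ge; rewrite -expl -expRN.
  have sz := le_trans szr (@net_size_le R a b n k ha _ n2 k1).
  apply: (@le_trans _ _ (expR ((b + 4) * k%:R * lg) *
      expR (d1 * k%:R * lg - (d1 + b + 9) * k%:R * lg))).
    apply: ler_pM; rewrite ?expR_ge0//.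
      by apply: sz; lra.
    rewrite ler_expR; apply: lerB.
      have := radius_sqr_le u sigmaz m n; rewrite -/M => hk.
      have k0 : 0 <= 4 * lam * L%:R * (16 * xm * eps ^+ 2).
        exact: (mulr_ge0 (mulr_ge0 (mulr_ge0 (ler0n R 4) lam0) (ler0n R L))
          (mulr_ge0 (mulr_ge0 (ler0n R 16) (ltW xm0)) (sqr_ge0 eps))).
      have := ler_wpM2l k0 hk.
      have -> : 4 * lam * L%:R * (16 * xm * eps ^+ 2) * (4 * u ^+ 2 * M) =
          d1 * (L%:R / n%:R ^+ 4).
        rewrite /lam /d1 /eps; field.
        by rewrite !lt0r_neq0.
      have : d1 * (L%:R / n%:R ^+ 4) <= d1 * (k%:R * lg).
        by apply: ler_wpM2l => //; rewrite ler_pdivrMr// mulrC mulrA.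
      lra.
    rewrite le_eqVlt; apply/orP; left; apply/eqP; rewrite /lam /rho2 /R1; field.
    by rewrite !lt0r_neq0//; lra.
  rewrite -expRD ler_expR.
  have : lg <= k%:R * lg by rewrite ler_peMl// ltW.
  by lra.
have x34 := ler_wpM2l (ltW xm0) (lerD e3 e4).
rewrite mulrDl e1; apply: le_trans (lerD (lerD (lexx _) e2) x34) _.
by rewrite le_eqVlt; apply/orP; left; apply/eqP; ring.
Qed.
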